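(* The fifth Singer cohomological transfer in internal degree $5(2^0-1)+18\cdot2^0=18$, $$Tr_5^{\mathscr A}:(\mathbb F_2\otimes_{GL_5}P_{\mathscr A}((\mathcal P_5)^* ))_{18}\to\mathrm{Ext}_{\mathscr A}^{5,5+18}(\mathbb F_2,\mathbb F_2),$$ is an isomorphism. Consequently, Singer's conjecture holds in rank $5$ and degree $18$, i.e. $Tr_5^{\mathscr A}$ is a monomorphism in this degree.
   Context: Let $\mathscr A$ be the mod 2 Steenrod algebra, $\overline{\mathscr A}$ its positive degree part, and $\mathcal P_m=\mathbb F_2[x_1,\dots,x_m]=H^*((K(\mathbb F_2,1))^{\times m};\mathbb F_2)$ with $\deg x_i=1$, with its usual $\mathscr A$-module structure and the action of $GL_m=GL(m,\mathbb F_2)$ by linear substitution, which commutes with $\mathscr A$. Put $Q^{\otimes m}=\mathbb F_2\otimes_{\mathscr A}\mathcal P_m$, with degree $n$ part $Q^{\otimes m}_n$ and induced $GL_m$-action. $(\mathcal P_m)^*=H_*((K(\mathbb F_2,1))^{\times m};\mathbb F_2)$ is the graded dual of $\mathcal P_m$, and $P_{\mathscr A}((\mathcal P_m)^* )$ is its subspace of elements annihilated by all (dual) Steenrod operations of positive degree; it is dual to $Q^{\otimes m}$. The space of coinvariants $(\mathbb F_2\otimes_{GL_m}P_{\mathscr A}((\mathcal P_m)^* ))_n$ is dual to the space of invariants $(Q^{\otimes m}_n)^{GL_m}$. Singer transfer: let $\widehat{\mathcal P}_1\subset\mathbb F_2[x,x^{-1}]$ be the span of $x^i$, $i\ge-1$,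 with $\mathscr A$-action extending that on $\mathcal P_1=\mathbb F_2[x]$ by $Sq^i(x^{-1})=x^{i-1}$. The short exact sequence of $\mathscr A$-modules $0\to\mathcal P_1\to\widehat{\mathcal P}_1\to\Sigma^{-1}\mathbb F_2\to0$ defines a class $e_1\in\mathrm{Ext}^1_{\mathscr A}(\Sigma^{-1}\mathbb F_2,\mathcal P_1)$. Its $m$-fold product is a class $e_m\in\mathrm{Ext}^m_{\mathscr A}(\Sigma^{-m}\mathbb F_2,\mathcal P_m)$. Cap product with $e_m$ gives a map $\mathrm{Tor}^{\mathscr A}_m(\mathbb F_2,\Sigma^{-m}\mathbb F_2)\to\mathrm{Tor}_0^{\mathscr A}(\mathbb F_2,\mathcal P_m)=Q^{\otimes m}$ whose image lies in the $GL_m$-invariants, i.e. maps $\mathrm{Tor}^{\mathscr A}_{m,m+n}(\mathbb F_2,\mathbb F_2)\to(Q^{\otimes m}_n)^{GL_m}$. The transfer $Tr_m^{\mathscr A}:(\mathbb F_2\otimes_{GL_m}P_{\mathscr A}((\mathcal P_m)^* ))_n\to\mathrm{Ext}^{m,m+n}_{\mathscr A}(\mathbb F_2,\mathbb F_2)$ is the $\mathbb F_2$-linear dual of this map. Singer's conjecture in rank $m$ and degree $n$ is the statement that $Tr_m^{\mathscr A}$ is injective in degree $n$. *)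

(* Defs.v *)
From HB Require Import structures.
From mathcomp Require Import all_boot all_algebra.
From mathcomp Require Import generic_quotient ring_quotient.
From mathcomp Require Import finmap.
From mathcomp Require Import boolp functions.
From mathcomp Require Import monalg mpoly.

Set Implicit Arguments.
Unset Strict Implicit.
Unset Printing Implicit Defensive.

Import GRing.Theory.
Local Open Scope ring_scope.
Local Open Scope quotient_scope.

Notation F2 := 'F_2.

Fact fct_lincombE (R : pzRingType) (U : Type) (V : lmodType R) (k : R)
  (f g : U -> V) (x : U) : (k *: f + g) x = k *: f x + g x.
Proof. by []. Qed.

Fact fct_zeroE (U : Type) (V : nmodType) (x : U) : (0 : U -> V) x = 0.
Proof. by []. Qed.

Section Span.
Variables (R : pzRingType) (V : lmodType R).

Definition span (S : V -> Prop) : {pred V} := fun x =>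
  `[< exists2 s : seq (R * V), {in s, forall y, S y.2} &
        x = \sum_(y <- s) y.1 *: y.2 >].

Lemma span_submod_closed S : submod_closed (span S).
Proof.
split=> [|k x y /asboolP[s Ss ->] /asboolP[t St ->]]; apply/asboolP.
  by exists [::]; rewrite ?big_nil.
exists ([seq (k * z.1, z.2) | z <- s] ++ t).
  move=> z; rewrite mem_cat => /orP[/mapP[w ws ->]|/St //].
  exact: Ss w ws.
rewrite big_cat big_map scaler_sumr; congr (_ + _).
by apply: eq_bigr => z _; rewrite scalerA.
Qed.

HB.instance Definition _ S :=
  GRing.isSubmodClosed.Build R V (span S) (span_submod_closed S).
End Span.


Section SpanQuotient.
Variables (R : pzRingType) (V : lmodType R) (S : V -> Prop).

Definition span_quot := Quotient.quot (span S).
HB.instance Definition _ := Choice.on span_quot.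
HB.instance Definition _ := GRing.Zmodule.on span_quot.
HB.instance Definition _ : EqQuotient V (Quotient.equiv (span S)) span_quot :=
  EqQuotient.on span_quot.

Lemma span_quotP (x y : V) : \pi_span_quot x = \pi y <-> x - y \in span S.
Proof. by rewrite (Quotient.idealrBE (span S)); split=> [->|/eqP]. Qed.

Lemma span_quotD (x y : V) : \pi_span_quot (x + y) = \pi x + \pi y.
Proof. exact: (Quotient.pi_add (span S)). Qed.

Definition span_quot_scale (k : R) (x : span_quot) : span_quot :=
  \pi_span_quot (k *: repr x).

Lemma span_quotZ k (x : V) : \pi_span_quot (k *: x) = span_quot_scale k (\pi x).
Proof.
apply/span_quotP; rewrite -scalerBr rpredZ //.
by apply/span_quotP; rewrite reprK.
Qed.

Let scaleA a b v :
  span_quot_scale a (span_quot_scale b v) = span_quot_scale (a * b) v.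
Proof. by elim/quotW: v => v; rewrite -!span_quotZ scalerA. Qed.
Let scale1 : left_id 1 span_quot_scale.
Proof. by elim/quotW=> v; rewrite -span_quotZ scale1r. Qed.
Let scaleDr : right_distributive span_quot_scale +%R.
Proof.
move=> a; elim/quotW=> u; elim/quotW=> v.
by rewrite -span_quotD -!span_quotZ scalerDr span_quotD.
Qed.
Let scaleDl v : {morph span_quot_scale^~ v : a b / a + b}.
Proof.
move=> a b; elim/quotW: v => v.
by rewrite -!span_quotZ scalerDl span_quotD.
Qed.

HB.instance Definition _ :=
  GRing.Zmodule_isLmodule.Build R span_quot scaleA scale1 scaleDr scaleDl.
End SpanQuotient.


Section PresentedAlgebra.
Variables (R : comNzRingType) (T : algType R) (S : T -> Prop).

Definition two_sided_multiple (x : T) : Prop :=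
  exists u r v : T, S r /\ x = u * r * v.

Lemma span_multipleM (x y z : T) :
  x \in span two_sided_multiple -> y * x * z \in span two_sided_multiple.
Proof.
move=> /asboolP[s Ss ->]; apply/asboolP.
exists [seq (w.1, y * w.2 * z) | w <- s].
  move=> _ /mapP[w ws ->] /=; have [u [r [v [rr ->]]]] := Ss w ws.
  by exists (y * u), r, (v * z); rewrite !mulrA.
rewrite big_map mulr_sumr mulr_suml; apply: eq_bigr => w _ /=.
by rewrite scalerAl scalerAr.
Qed.

Definition alg_quot := span_quot two_sided_multiple.
HB.instance Definition _ := GRing.Lmodule.on alg_quot.
HB.instance Definition _ := EqQuotient.on alg_quot.

Definition alg_quot_one : alg_quot := \pi_alg_quot 1.
Definition alg_quot_mul (x y : alg_quot) : alg_quot :=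
  \pi_alg_quot (repr x * repr y).

Lemma alg_quotM x y : \pi_alg_quot (x * y) = alg_quot_mul (\pi x) (\pi y).
Proof.
have piK z : z - repr (\pi_alg_quot z) \in span two_sided_multiple.
  by apply/span_quotP; rewrite reprK.
apply/span_quotP; set x' := repr _; set y' := repr _.
have -> : x * y - x' * y' = 1 * (x - x') * y + x' * (y - y') * 1.
  by rewrite mul1r mulr1 mulrBl mulrBr addrA subrK.
by rewrite rpredD // span_multipleM.
Qed.

Fact alg_quot_mulA : associative alg_quot_mul.
Proof.
move=> x y z; rewrite -[x]reprK -[y]reprK -[z]reprK.
move: (repr x) (repr y) (repr z) => a b c.
rewrite -(alg_quotM b c) -(alg_quotM a (b * c)).
by rewrite -(alg_quotM a b) -(alg_quotM (a * b) c) mulrA.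
Qed.
Fact alg_quot_mul1r : left_id alg_quot_one alg_quot_mul.
Proof. by move=> x; rewrite -[x]reprK -(alg_quotM 1 (repr x)) mul1r. Qed.
Fact alg_quot_mulr1 : right_id alg_quot_one alg_quot_mul.
Proof. by move=> x; rewrite -[x]reprK -(alg_quotM (repr x) 1) mulr1. Qed.
Fact alg_quot_mulDl : left_distributive alg_quot_mul +%R.
Proof.
move=> x y z; rewrite -[x]reprK -[y]reprK -[z]reprK.
move: (repr x) (repr y) (repr z) => a b c.
rewrite -span_quotD -(alg_quotM (a + b) c) mulrDl span_quotD.
by rewrite (alg_quotM a c) (alg_quotM b c).
Qed.
Fact alg_quot_mulDr : right_distributive alg_quot_mul +%R.
Proof.
move=> x y z; rewrite -[x]reprK -[y]reprK -[z]reprK.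
move: (repr x) (repr y) (repr z) => a b c.
rewrite -span_quotD -(alg_quotM a (b + c)) mulrDr span_quotD.
by rewrite (alg_quotM a b) (alg_quotM a c).
Qed.
HB.instance Definition _ := GRing.Zmodule_isPzRing.Build alg_quot
  alg_quot_mulA alg_quot_mul1r alg_quot_mulr1 alg_quot_mulDl alg_quot_mulDr.

End PresentedAlgebra.

Definition free_steenrod := {malg F2[{fmonom nat}]}.
HB.instance Definition _ := GRing.Lalgebra.on free_steenrod.
Fact free_steenrod_scaleAr (k : F2) (x y : free_steenrod) :
  k *: (x * y) = x * (k *: y).
Proof. by rewrite -[k]natr_Zp !scaler_nat mulrnAr. Qed.
HB.instance Definition _ :=
  GRing.Lalgebra_isAlgebra.Build F2 free_steenrod free_steenrod_scaleAr.

Definition free_Sq (k : nat) : free_steenrod := << fmu k >>.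

Definition adem_relator (a b : nat) : free_steenrod :=
  free_Sq a * free_Sq b -
    \sum_(j < a./2.+1)
      (free_Sq (a + b - j) * free_Sq j) *+ 'C(b - 1 - j, a - 2 * j).

Definition steenrod_relator (r : free_steenrod) : Prop :=
  r = free_Sq 0 - 1 \/
  exists a b : nat, [/\ (0 < a)%N, (a < 2 * b)%N & r = adem_relator a b].

Definition steenrod := alg_quot steenrod_relator.
HB.instance Definition _ := GRing.Lmodule.on steenrod.
HB.instance Definition _ := GRing.PzRing.on steenrod.
HB.instance Definition _ := EqQuotient.on steenrod.

Definition homogeneous_op (d : nat) (a : steenrod) : Prop :=
  exists2 x : free_steenrod,
    forall w : {fmonom nat}, monalg.mcoeff w x != 0 -> sumn w = d
    & a = \pi_steenrod x.

(* The action of a on v is computed on a representative of a in the free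
   algebra. It does not depend on this representative when sq 0 is the identity,
   the sq k are linear and they satisfy the Adem relations, as do the three
   families F2_Sq, Sq and hat_Sq below. *)
Section Action.
Variables (V : lmodType F2) (sq : nat -> V -> V).

Definition free_act (x : free_steenrod) (v : V) : V :=
  \sum_(w <- monalg.msupp x) monalg.mcoeff w x *: foldr sq v w.

Definition act (a : steenrod) (v : V) : V := free_act (repr a) v.
End Action.

Definition F2_Sq (k : nat) (c : F2^o) : F2^o := if k == 0%N then c else 0.

Definition augmentation (a : steenrod) : F2 := act F2_Sq a 1.

(* The polynomial algebra of mpoly: {mpoly F2[m]} is ambiguous here, since
   monalg declares the same notation in type_scope. *)
Notation Pol m := (mpoly.mpoly m F2).

(* The total square sum_k Sq^k t^k is the ring morphism with
   x_i |-> x_i + x_i^2 t. *)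
Definition total_Sq m : Pol m -> {poly (Pol m)} :=
  mpoly.mmap (fun c : F2 => (c%:MP_[m])%:P)
    (fun i : 'I_m => ('X_i)%:P + ('X_i ^+ 2)%:P * 'X).

Definition Sq m (k : nat) (p : Pol m) : Pol m :=
  (total_Sq p)`_k.

(* P_m (x) \hat P_1, where x := 'X_ord_max is the variable of \hat P_1: the pair
   (p, q) stands for p x^-1 + q. By the Cartan formula and
   Sq^j (x^-1) = x^(j-1), Sq^k (p x^-1) = sum_j Sq^(k-j) p x^(j-1). *)
Definition hatP m := (Pol m * Pol m.+1)%type.

Definition hat_Sq m (k : nat) (u : hatP m) : hatP m :=
  (Sq k u.1,
   Sq k u.2 + \sum_(1 <= j < k.+1) mwiden (Sq (k - j) u.1) * 'X_ord_max ^+ j.-1).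

(* Cocycle of the extension
     0 -> P_m (x) P_1 -> P_m (x) \hat P_1 -> Sigma^-1 P_m -> 0
   for the section p |-> p x^-1: (a, p) |-> a (p x^-1) - (a p) x^-1. *)
Definition e1_cocycle m (a : steenrod) (p : Pol m) : Pol m.+1 :=
  (act (@hat_Sq m) a (p, 0)).2.

Definition bar (s : nat) := {ffun 'I_s -> steenrod}.

Definition bar_tail s (a : bar s.+1) : bar s := [ffun j => a (lift ord0 j)].
Definition bar_init s (a : bar s.+1) : bar s :=
  [ffun j => a (widen_ord (leqnSn s) j)].
Definition bar_merge s (i : 'I_s) (a : bar s.+1) : bar s :=
  [ffun j : 'I_s =>
     if (j < i)%N then a (widen_ord (leqnSn s) j)
     else if j == i then a (widen_ord (leqnSn s) j) * a (lift ord0 j)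
     else a (lift ord0 j)].
Definition bar_set s (a : bar s) (i : 'I_s) (x : steenrod) : bar s :=
  [ffun j => if j == i then x else a j].

Definition chain s := {malg F2[bar s]}.

Definition extend s (V : lmodType F2) (f : bar s -> V) (z : chain s) : V :=
  \sum_(a <- monalg.msupp z) monalg.mcoeff a z *: f a.

Lemma extend_lincomb s (V : lmodType F2) k (f g : bar s -> V) (z : chain s) :
  extend (k *: f + g) z = k *: extend f z + extend g z.
Proof.
rewrite /extend scaler_sumr -big_split /=.
by apply: eq_bigr => a _; rewrite scalerDr !scalerA mulrC.
Qed.

Definition bar_boundary s (a : bar s.+1) : chain s :=
  augmentation (a ord0) *: << bar_tail a >>
  + \sum_(i < s) << bar_merge i a >>
  + augmentation (a ord_max) *: << bar_init a >>.

(* Cochains Hom_A(Bar_s(F2), F2) for the unnormalized bar resolution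
   Bar_s(F2) = A (x) A^(x)s are the F2-multilinear maps A^s -> F2. *)

Definition multilinear s (c : bar s -> F2^o) : Prop :=
  forall (a : bar s) (i : 'I_s) (k : F2) (x y : steenrod),
    c (bar_set a i (k *: x + y)) = k *: c (bar_set a i x) + c (bar_set a i y).

Definition has_internal_degree s t (c : bar s -> F2^o) : Prop :=
  forall (a : bar s) (d : 'I_s -> nat),
    (forall i, homogeneous_op (d i) (a i)) -> (\sum_i d i)%N <> t -> c a = 0.

Definition is_cochain s t (c : bar s -> F2^o) : Prop :=
  multilinear c /\ has_internal_degree t c.

Definition coboundary_map s (c : bar s -> F2^o) : bar s.+1 -> F2^o :=
  fun a => extend c (bar_boundary a).

Definition cocycle s t : {pred bar s -> F2^o} :=
  fun c => `[< is_cochain t c /\ forall a, coboundary_map c a = 0 >].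

Fact cocycle_submod_closed s t : submod_closed (@cocycle s t).
Proof.
split=> [|k c c' /asboolP[[mc dc] zc] /asboolP[[mc' dc'] zc']]; apply/asboolP.
  split; first split.
  - by move=> a i k x y; rewrite !fct_zeroE addr0 scaler0.
  - by [].
  - by move=> a; rewrite /coboundary_map /extend big1 // => b _; rewrite scaler0.
split; first split.
- move=> a i l x y; rewrite !fct_lincombE mc mc' !scalerDr !scalerA [k * l]mulrC.
  by rewrite addrACA.
- by move=> a d ad dt; rewrite !fct_lincombE (dc a d) // (dc' a d) // scaler0 addr0.
- move=> a; have := zc a; have := zc' a; rewrite /coboundary_map => z1 z2.
  by rewrite extend_lincomb z1 z2 scaler0 addr0.
Qed.
HB.instance Definition _ s t := GRing.isSubmodClosed.Build F2 (bar s -> F2^o)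
  (@cocycle s t) (cocycle_submod_closed s t).

Definition cocycles s t := {c : bar s -> F2^o | c \in @cocycle s t}.
HB.instance Definition _ s t := SubChoice.on (cocycles s t).
HB.instance Definition _ s t :=
  [SubChoice_isSubLmodule of cocycles s t by <:].

Definition coboundary s t : cocycles s t -> Prop :=
  match s return cocycles s t -> Prop with
  | 0 => fun _ => False
  | r.+1 => fun z => exists2 c : bar r -> F2^o,
      is_cochain t c & val z = coboundary_map c
  end.

Definition Ext s t := span_quot (@coboundary s t).
HB.instance Definition _ s t := EqQuotient.on (Ext s t).
HB.instance Definition _ s t := GRing.Lmodule.on (Ext s t).

(* Chains of F2 (x)_A Bar(F2), whose homology is Tor^A(F2, F2), are formal sums
   of s-tuples modulo multilinearity. *)

Definition tensor_relation s (z : chain s) : Prop :=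
  exists (a : bar s) (i : 'I_s) (k : F2) (x y : steenrod),
    z = << bar_set a i (k *: x + y) >>
        - (k *: << bar_set a i x >> + << bar_set a i y >>).

Definition Tor_cycle s : chain s -> Prop :=
  match s return chain s -> Prop with
  | 0 => fun _ => True
  | r.+1 => fun z => extend (@bar_boundary r) z \in span (@tensor_relation r)
  end.

(* The class e_m, as a cocycle Bar_m(Sigma^-m F2) -> P_m: the Yoneda product of
   the extensions P_j (x) (0 -> P_1 -> \hat P_1 -> Sigma^-1 F2 -> 0), j < m. *)
Fixpoint e_cocycle (m : nat) : bar m -> Pol m :=
  match m return bar m -> Pol m with
  | 0 => fun _ => 1
  | k.+1 => fun a => e1_cocycle (a ord0) (e_cocycle (bar_tail a))
  end.

(* Cap product with e_m on chains; it induces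
   Tor_{m,m+n}(F2, F2) -> (F2 (x)_A P_m)_n. *)
Definition cap_e m (z : chain m) : Pol m := extend (@e_cocycle m) z.

(* P_A((P_m)^* )_n: the linear forms on P_m concentrated in degree n which are
   annihilated by the operations of positive degree. *)
Definition primitive m n : {pred Pol m -> F2^o} := fun f =>
  `[< [/\ linear f,
          forall w : multinom m, mdeg w <> n -> f (@mpolyX m F2 w) = 0
        & forall (d : nat) (a : steenrod) (p : Pol m),
            (0 < d)%N -> homogeneous_op d a -> f (act (@Sq m) a p) = 0] >].

Fact primitive_submod_closed m n : submod_closed (@primitive m n).
Proof.
split=> [|k f g /asboolP[lf df hf] /asboolP[lg dg hg]]; apply/asboolP.
  by split=> // k p q; rewrite !fct_zeroE scaler0 addr0.
split=> [l p q|w wn|d a p d0 ad]; rewrite !fct_lincombE.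
- by rewrite lf lg !scalerDr !scalerA [k * l]mulrC addrACA.
- by rewrite df // dg // scaler0 addr0.
- by rewrite (hf d) // (hg d) // scaler0 addr0.
Qed.
HB.instance Definition _ m n := GRing.isSubmodClosed.Build F2 (Pol m -> F2^o)
  (@primitive m n) (primitive_submod_closed m n).

Definition primitives m n := {f : Pol m -> F2^o | f \in @primitive m n}.
HB.instance Definition _ m n := SubChoice.on (primitives m n).
HB.instance Definition _ m n :=
  [SubChoice_isSubLmodule of primitives m n by <:].

Definition linear_substitution m (g : 'M[F2]_m) (p : Pol m) : Pol m :=
  p \mPo [tuple \sum_i g i j *: @mpolyX m F2 U_(i) | j < m].

Definition GL_relation m n (f : primitives m n) : Prop :=
  exists (g : 'M[F2]_m) (h : primitives m n),
    g \in unitmx /\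
    forall p, val f p = val h (linear_substitution g p) - val h p.

Definition coinvariants m n := span_quot (@GL_relation m n).
HB.instance Definition _ m n := EqQuotient.on (coinvariants m n).
HB.instance Definition _ m n := GRing.Lmodule.on (coinvariants m n).

(* Tr is the linear dual of the cap product with e_m: <Tr [f], z> =
   <f, z /\ e_m> for every Tor class z. This determines Tr, since Ext is the
   dual of Tor. *)
Definition is_singer_transfer m n
    (Tr : coinvariants m n -> Ext m (m + n)) : Prop :=
  forall (f : primitives m n) (c : cocycles m (m + n)),
    Tr (\pi_(coinvariants m n) f) = \pi_(Ext m (m + n)) c ->
  forall z : chain m, Tor_cycle z -> extend (val c) z = val f (cap_e z).

(* Main.v *)
(* Both sides are one-dimensional. On the Ext side, a contracting homotopy of a
   minimal resolution through the relevant degrees, compared with the bar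
   resolution by a zigzag, attaches to every 5-cocycle of degree 23 a single
   number which vanishes exactly on coboundaries; on the image of a primitive f
   this number is f(u) for an explicit polynomial u. An explicit f0 has
   f0(u) = 1. On the other side, after extending scalars to contain a 31st root
   of unity om, averaging f over the normalizer of a Singer cycle of GL_5
   (order 31 * 5) and using the eigenvectors y_i = sum_l om^(l 2^i) x_l, on which
   Sq acts by y_i |-> y_i + y_(i-1)^2, determines f modulo GL-relations by its
   values on five orbits of monomials of weight 0. Relations coming from
   permutations of spike functionals (dual to monomials with all exponents of
   the form 2^a - 1) cut these five parameters down to one. *)
From HB Require Import structures.
From mathcomp Require Import all_boot all_algebra.
From mathcomp Require Import generic_quotient ring_quotient.
From mathcomp Require Import finmap.
From mathcomp Require Import boolp functions.
From mathcomp Require Import monalg mpoly.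
From mathcomp Require Import zify ring.
From mathcomp Require Import vector all_field.
Require Import Defs.

Set Implicit Arguments.
Unset Strict Implicit.
Unset Printing Implicit Defensive.

Import GRing.Theory.
Local Open Scope ring_scope.
Local Open Scope quotient_scope.

(** The number $f(u)$ is defined on coinvariants because the class of [e_cocycle] is
    $GL_5$-invariant, and this has to be proved at cochain level. Transvections generate
    $GL_5(\mathbb F_2)$, commutators reduce them to adjacent indices, and there explicit cochains
    bound the change of the cocycle. No Laurent polynomials occur: $Sq^k$ commutes with $x^{2^N}$
    for $k<2^N$, so $x^{2^N-1}$ replaces $x^{-1}$ for any finite set of operations. Averaging loses
    nothing since the normalizer has odd order $155$: modulo relations $f$ equals its average.
    Invariance under the Singer cycle kills the values on monomials of nonzero weight mod 31,
    invariance under Frobenius identifies rotated monomials, and the sums over rotations lie in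
    $\mathbb F_2$. The two bounds meet as follows: $f_0(u)=1$ shows that $f_0$ is not a relation,
    hence for every primitive $f$ either $f$ or $f+f_0$ is one, and $f(u)$ tells which. The homotopy
    and the reduction modulo hits come from Gaussian elimination; evaluation checks the homotopy
    identity and the monomials at which the reduction ends. *)

Notation free_span := (span (two_sided_multiple steenrod_relator)).
Notation piA := (\pi_steenrod).

(** * Linear extension from a basis; arithmetic in characteristic two *)

Section LinearExtension.
Variables (K : choiceType) (V : lmodType F2) (h : K -> V).

(** [free_act] and [extend] both unfold to this sum, so its linearity serves for either. *)
Definition linear_extension (z : {malg F2[K]}) : V :=
  \sum_(k <- monalg.msupp z) monalg.mcoeff k z *: h k.

Lemma linear_extensionEw (d : {fset K}) z : (monalg.msupp z `<=` d)%fset ->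
  linear_extension z = \sum_(k <- d) monalg.mcoeff k z *: h k.
Proof.
move=> le; rewrite /linear_extension (big_fset_incl _ le) //= => x xd.
by move/monalg.mcoeff_outdom ->; rewrite scale0r.
Qed.

Lemma linear_extension_is_linear : linear linear_extension.
Proof.
move=> c x y; set d := (monalg.msupp x `|` monalg.msupp y)%fset.
have le : (monalg.msupp (c *: x + y) `<=` d)%fset.
  apply: fsubset_trans (monalg.msuppD_le _ _) _.
  exact/fsetSU/monalg.msuppZ_le.
rewrite (linear_extensionEw le) (@linear_extensionEw d x) ?fsubsetUl //.
rewrite (@linear_extensionEw d y) ?fsubsetUr // scaler_sumr -big_split /=.
apply: eq_bigr => k _.
by rewrite monalg.mcoeffD monalg.mcoeffZ scalerDl scalerA.
Qed.
HB.instance Definition _ :=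
  GRing.isLinear.Build F2 {malg F2[K]} V _ linear_extension
    linear_extension_is_linear.

Lemma linear_extensionU k : linear_extension << k >> = h k.
Proof.
rewrite (linear_extensionEw monalg.msuppU_le) big_seq_fset1.
by rewrite monalg.mcoeffUU scale1r.
Qed.
End LinearExtension.


Lemma F2_case (c : F2) : c = 0 \/ c = 1.
Proof. by case: c => [[|[|]]] //= ?; [left|right]; apply/val_inj. Qed.

Lemma addF2 (V : lmodType F2) (v : V) : v + v = 0.
Proof.
rewrite -[v]scale1r -scalerDl.
suff -> : (1 + 1 : F2) = 0 by rewrite scale0r.
exact/val_inj.
Qed.

Lemma oppF2 (V : lmodType F2) (v : V) : - v = v.
Proof. by apply/eqP; rewrite eq_sym -addr_eq0 addF2. Qed.

Lemma mulrnF2 (V : lmodType F2) (v : V) n : v *+ n = if odd n then v else 0.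
Proof.
rewrite -[n in LHS]odd_double_half mulrnDr -muln2 mulnC mulrnA mulr2n addF2 mul0rn.
by rewrite addr0; case: (odd n).
Qed.

Section LinearProp.
Variables (U V : lmodType F2) (f : U -> V).
Hypothesis fl : linear f.

Lemma lin0 : f 0 = 0.
Proof. by have := fl (-1) 0 0; rewrite scaler0 addr0 scaleN1r addNr. Qed.
Lemma linD u v : f (u + v) = f u + f v.
Proof. by have := fl 1 u v; rewrite !scale1r. Qed.
Lemma linZ c v : f (c *: v) = c *: f v.
Proof. by have := fl c v 0; rewrite lin0 !addr0. Qed.
Lemma linMn v n : f (v *+ n) = f v *+ n.
Proof. by elim: n => [|n IH]; rewrite ?mulr0n ?lin0 // !mulrS linD IH. Qed.
Lemma lin_sum I r (P : pred I) F :
  f (\sum_(i <- r | P i) F i) = \sum_(i <- r | P i) f (F i).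
Proof. by apply: (big_morph f); [apply: linD | apply: lin0]. Qed.
End LinearProp.

Lemma malgU_scale (K : choiceType) c (w : K) : << c *g w >> = c *: << w >> :> {malg F2[K]}.
Proof.
by apply/monalg.malgP => k'; rewrite monalg.mcoeffZ !monalg.mcoeffU mulrnAr mulr1.
Qed.

(** * Words in the squares acting on modules that satisfy the Adem relations *)

Definition word (w : seq nat) : steenrod := piA << FMonom w >>.

Lemma free_SqE k : free_Sq k = << FMonom [:: k] >>.
Proof. by rewrite /free_Sq monalg.fmuE. Qed.

Lemma free_wordM v w :
  << FMonom v >> * << FMonom w >> = << FMonom (v ++ w) >> :> free_steenrod.
Proof.
have := @monalg.fgmulUU {fmonom nat} F2 1 1 (FMonom v) (FMonom w).
rewrite mulr1 -monalg.malgM_def => ->; congr (<< _ >>).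
by apply/eqP; rewrite monalg.fmP monalg.fmM.
Qed.

Lemma free_one : 1 = << FMonom [::] >> :> free_steenrod.
Proof.
have -> : 1 = << monalg.mone >> :> {malg F2[{fmonom nat}]} by [].
congr (<< _ >>).
by apply/eqP; rewrite monalg.fmP monalg.fm1.
Qed.

Lemma free_scaleAl c (x y : free_steenrod) : (c *: x) * y = c *: (x * y).
Proof. by rewrite -scalerAl. Qed.
Lemma free_scaleAr c (x y : free_steenrod) : x * (c *: y) = c *: (x * y).
Proof. by rewrite -scalerAr. Qed.

Section ModuleAction.
Variables (V : lmodType F2) (sq : nat -> V -> V).

Definition adem_module :=
  [/\ sq 0 =1 id, forall k, linear (sq k) &
    forall a b v, (0 < a)%N -> (a < 2 * b)%N -> sq a (sq b v) =
      \sum_(j < a./2.+1) sq (a + b - j) (sq j v) *+ 'C(b - 1 - j, a - 2 * j)].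

Lemma free_actE x v : free_act sq x v = linear_extension (fun w : {fmonom nat} => foldr sq v w) x.
Proof. by []. Qed.

Lemma free_actD x y v : free_act sq (x + y) v = free_act sq x v + free_act sq y v.
Proof. by rewrite !free_actE raddfD. Qed.
Lemma free_actB x y v : free_act sq (x - y) v = free_act sq x v - free_act sq y v.
Proof. by rewrite !free_actE raddfB. Qed.
Lemma free_actZ c x v : free_act sq (c *: x) v = c *: free_act sq x v.
Proof. by rewrite !free_actE linearZ. Qed.
Lemma free_act_sum I r (P : pred I) F v :
  free_act sq (\sum_(i <- r | P i) F i) v = \sum_(i <- r | P i) free_act sq (F i) v.
Proof. by rewrite !free_actE raddf_sum. Qed.
Lemma free_actMn x n v : free_act sq (x *+ n) v = free_act sq x v *+ n.
Proof. by rewrite !free_actE raddfMn. Qed.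
Lemma free_actU w v : free_act sq << FMonom w >> v = foldr sq v w.
Proof. by rewrite free_actE linear_extensionU. Qed.

Hypothesis sq_adem : adem_module.

Lemma foldr_sq_linear (w : seq nat) : linear (fun v => foldr sq v w).
Proof.
case: sq_adem => _ sql _; elim: w => [|k w IH] c x y //=.
by rewrite IH sql.
Qed.

Lemma free_act_linear x : linear (free_act sq x).
Proof.
move=> c u v; rewrite /free_act scaler_sumr -big_split /=; apply: eq_bigr => w _.
by rewrite foldr_sq_linear scalerDr !scalerA mulrC.
Qed.

Lemma free_act0 x : free_act sq x 0 = 0.
Proof.
by have := free_act_linear x (-1) 0 0; rewrite scaler0 addr0 scaleN1r addNr.
Qed.

Lemma free_actM x y v : free_act sq (x * y) v = free_act sq x (free_act sq y v).
Proof.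
have sumE (z : free_steenrod) :
    z = \sum_(w <- monalg.msupp z) monalg.mcoeff w z *: (<< w >> : free_steenrod).
  by rewrite [LHS]monalg.monalgE; apply: eq_bigr => w _; apply: malgU_scale.
suff E (w : {fmonom nat}) :
    free_act sq ((<< w >> : free_steenrod) * y) v =
    free_act sq (<< w >> : free_steenrod) (free_act sq y v).
  rewrite (sumE x) mulr_suml !free_act_sum; apply: eq_bigr => w _.
  by rewrite free_scaleAl [LHS]free_actZ [RHS]free_actZ E.
case: w => w; rewrite free_actU.
rewrite (sumE y) mulr_sumr !free_act_sum (lin_sum (foldr_sq_linear w)).
apply: eq_bigr => -[u] _.
rewrite free_scaleAr [LHS]free_actZ [in RHS]free_actZ (linZ (foldr_sq_linear w)).
rewrite free_wordM !free_actU /=.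

by rewrite foldr_cat.
Qed.

Lemma free_act_relator r v : steenrod_relator r -> free_act sq r v = 0.
Proof.
case: (sq_adem) => sq0 _ ad [->|[a [b [a0 ab ->]]]].
  by rewrite free_actB free_SqE free_one !free_actU /= sq0 subrr.
rewrite free_actB free_actM !free_SqE !free_actU /= ad // free_act_sum.
apply/eqP; rewrite subr_eq0; apply/eqP; apply: eq_bigr => j _.
by rewrite free_actMn !free_SqE free_actM !free_actU.
Qed.

Lemma free_act_span x v : x \in free_span -> free_act sq x v = 0.
Proof.
move=> /asboolP[s Ss ->]; rewrite free_act_sum big1_seq // => y /andP[_ ys].
have [u [r [w [rr ->]]]] := Ss y ys.
by rewrite free_actZ !free_actM (free_act_relator _ rr) free_act0 scaler0.
Qed.

(** The action kills the two-sided ideal of relators, so the representative chosen by [act] can be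
    exchanged for any other one. *)
Lemma act_pi x v : act sq (piA x) v = free_act sq x v.
Proof.
apply/eqP; rewrite /act -subr_eq0 -free_actB; apply/eqP/free_act_span.
by apply/span_quotP; rewrite reprK.
Qed.

Lemma act_word w v : act sq (word w) v = foldr sq v w.
Proof. by rewrite act_pi free_actU. Qed.

Lemma act_linear a : linear (act sq a).
Proof. exact: free_act_linear. Qed.

Lemma act_linearl c a b v : act sq (c *: a + b) v = c *: act sq a v + act sq b v.
Proof.
rewrite -[a]reprK -[b]reprK; move: (repr a) (repr b) => x y.
have -> : c *: piA x + piA y = piA (c *: x + y).
  by rewrite (span_quotD _ (c *: x) y) (span_quotZ _ c x).
by rewrite !act_pi free_actD free_actZ.
Qed.

Lemma act_mul a b v : act sq (a * b) v = act sq a (act sq b v).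
Proof.
rewrite -[a]reprK -[b]reprK; move: (repr a) (repr b) => x y.
have -> : piA x * piA y = piA (x * y) by rewrite (alg_quotM steenrod_relator x y).
by rewrite !act_pi free_actM.
Qed.

Lemma actD a u v : act sq a (u + v) = act sq a u + act sq a v.
Proof. by have := act_linear a 1 u v; rewrite !scale1r. Qed.
Lemma act0 a : act sq a 0 = 0.
Proof. exact: free_act0. Qed.
Lemma actZ a c v : act sq a (c *: v) = c *: act sq a v.
Proof. by have := act_linear a c v 0; rewrite act0 !addr0. Qed.
Lemma actDl a b v : act sq (a + b) v = act sq a v + act sq b v.
Proof. by have := act_linearl 1 a b v; rewrite !scale1r. Qed.
Lemma act0l v : act sq 0 v = 0.
Proof. by apply: (addrI (act sq 0 v)); rewrite -actDl !addr0. Qed.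
Lemma act_suml I r (P : pred I) F v :
  act sq (\sum_(i <- r | P i) F i) v = \sum_(i <- r | P i) act sq (F i) v.
Proof.
by apply: (big_morph (fun a => act sq a v)) => [a b|]; [apply: actDl | apply: act0l].
Qed.
End ModuleAction.

Lemma addr_regroup (V : nmodType) (a b c d : V) : a + (b + c) + d = a + b + (c + d).
Proof. by rewrite !addrA. Qed.

Lemma addr_collect (R : pzRingType) (x y z a b c d s : R) :
  b + c = s -> x * a + y * b + (y * c + z * d) = x * a + y * s + z * d.
Proof. by move=> <-; rewrite mulrDr !addrA. Qed.

(** * The total square over an arbitrary base ring *)

Section PolynomialExt.
Variables (m : nat) (R : comNzRingType).

Lemma mpoly_rmorph_ext (S : comNzRingType) (f g : {rmorphism mpoly.mpoly m R -> S}) :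
  (forall c, f c%:MP_[m] = g c%:MP_[m]) -> (forall i, f ('X_i) = g ('X_i)) -> f =1 g.
Proof.
move=> fgC fgX p; rewrite (mpolyE p) !raddf_sum /=; apply: eq_bigr => w _.
rewrite -mul_mpolyC !rmorphM /= fgC mpolyXE_id !rmorph_prod; congr (_ * _).
by apply: eq_bigr => i _; rewrite !rmorphXn /= fgX.
Qed.

(** The shape of the induction matches [Sq_mulX], the Cartan formula for a product with one
    variable. *)
Lemma mpoly_mulX_ind (P : mpoly.mpoly m R -> Prop) :
  (forall p q, P p -> P q -> P (p + q)) -> (forall c p, P p -> P (c *: p)) ->
  P 1 -> (forall i p, P p -> P ('X_i * p)) -> forall p, P p.
Proof.
move=> PD PZ P1 PX p; rewrite (mpolyE p).
have P0 : P 0 by rewrite -(scale0r 1); apply: PZ.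
elim: (msupp p) => [|w s IH]; first by rewrite big_nil.
rewrite big_cons; apply: PD => //; apply: PZ; rewrite mpolyXE_id.
suff H r : P r -> P ((\prod_(i < m) 'X_i ^+ w i) * r) by have := H 1 P1; rewrite mulr1.
move: r; apply: (@big_ind _ (fun q => forall r, P r -> P (q * r))) => [r|q q' Pq Pq' r Pr|i _ r Pr].
- by rewrite mul1r.
- by rewrite -mulrA; apply/Pq/Pq'.
- by elim: (w i) => [|k IHk]; [rewrite expr0 mul1r|rewrite exprS -mulrA; apply: PX].
Qed.

(** The formula of [total_Sq] over any base: the torus argument works over an extension of $\mathbb
    F_2$. *)
Definition total_square : mpoly.mpoly m R -> {poly (mpoly.mpoly m R)} :=
  mpoly.mmap (fun c : R => (c%:MP_[m])%:P)
    (fun i : 'I_m => ('X_i)%:P + ('X_i ^+ 2)%:P * 'X).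

Let f : {rmorphism R -> {poly (mpoly.mpoly m R)}} := polyC \o @mpolyC m R.
Let total_squareE : total_square = mpoly.mmap f
    (fun i : 'I_m => ('X_i)%:P + ('X_i ^+ 2)%:P * 'X).
Proof. by []. Qed.

Lemma total_square_is_additive : additive total_square.
Proof. exact: (mpoly.mmap_is_additive _ f). Qed.
HB.instance Definition _ := GRing.isAdditive.Build _ _ total_square total_square_is_additive.

Lemma total_square_is_multiplicative : multiplicative total_square.
Proof. exact: (mpoly.mmap_is_multiplicative _ f). Qed.
HB.instance Definition _ :=
  GRing.isMultiplicative.Build _ _ total_square total_square_is_multiplicative.

Lemma total_squareC c : total_square c%:MP_[m] = (c%:MP_[m])%:P.
Proof. by rewrite total_squareE mpoly.mmapC. Qed.

Lemma total_squareX i : total_square 'X_i = ('X_i)%:P + ('X_i ^+ 2)%:P * 'X.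
Proof. by rewrite total_squareE mpoly.mmapX mpoly.mmap1U. Qed.

Lemma total_squareZ c p : total_square (c *: p) = (c%:MP_[m])%:P * total_square p.
Proof. by rewrite -mul_mpolyC rmorphM /= total_squareC. Qed.
End PolynomialExt.

(** The guard matters: for $2j>a$ truncated subtraction would turn the binomial into $1$. *)
Definition adem_coef a b j := if (2 * j <= a)%N then 'C(b - 1 - j, a - 2 * j) else 0%N.

(** Pascal's rule once on each side. The hypothesis gives $j<b$ whenever $2j\le a$, so that $b-1-j$
    is not truncated. *)
Lemma adem_coef_step a b j : (a.+1 <= 2 * b)%N ->
  (adem_coef a.+1 b.+1 j + adem_coef a.+1 b.+1 j.+1 =
   adem_coef a b.+1 j + adem_coef a.+1 b j)%N.
Proof.
move=> ab; rewrite /adem_coef.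
case: (leqP (2 * j) a) => [ja|]; last first.
  case: (leqP (2 * j) a.+1) => // ja aj.
    have -> : (2 * j.+1 <= a.+1)%N = false by lia.
    have -> : (a.+1 - 2 * j = 0)%N by lia.
    by rewrite !bin0.
  by have -> : (2 * j.+1 <= a.+1)%N = false by lia.
have -> : (2 * j <= a.+1)%N by lia.
have -> : (b.+1 - 1 - j = (b - 1 - j).+1)%N by lia.
case: (leqP (2 * j.+1) a.+1) => ja2.
  have -> : (b.+1 - 1 - j.+1 = b - 1 - j)%N by lia.
  have -> : (a.+1 - 2 * j = (a.+1 - 2 * j.+1).+2)%N by lia.
  have -> : (a - 2 * j = (a.+1 - 2 * j.+1).+1)%N by lia.
  by rewrite !binS; lia.
have -> : (a.+1 - 2 * j = 1)%N by lia.
have -> : (a - 2 * j = 0)%N by lia.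
by rewrite bin0 !bin1; lia.
Qed.

Lemma adem_coef_ge a b j : (2 * b <= a)%N -> adem_coef a b j = (2 * j == a)%N.
Proof.
move=> ba; rewrite /adem_coef; case: ltngtP => //= ja.
  by rewrite bin_small //; lia.
have -> : (a - 2 * j = 0)%N by lia.
by rewrite bin0.
Qed.

Lemma adem_coef0 b : adem_coef 0 b 0 = 1%N.
Proof. by rewrite /adem_coef bin0. Qed.

Lemma adem_coef_small a b j : (a < 2 * j)%N -> adem_coef a b j = 0%N.
Proof. by rewrite /adem_coef; case: leqP. Qed.

Lemma adem_coef_shift a b j : adem_coef a.+2 b.+1 j.+1 = adem_coef a b j.
Proof.
rewrite /adem_coef; have -> : (2 * j.+1 <= a.+2)%N = (2 * j <= a)%N by lia.
by case: leqP => // ja; congr 'C(_, _); lia.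
Qed.

Lemma adem_coef_odd b j : adem_coef (2 * b).+1 b.+1 j = 0%N.
Proof.
rewrite /adem_coef; case: leqP => // ja.
by rewrite bin_small //; lia.
Qed.

Lemma adem_coef_even b j : adem_coef (2 * b) b.+1 j = (j == b).
Proof.
rewrite /adem_coef; case: leqP => ja; last by case: eqP => //; lia.
case: eqP => [->|jb]; last by rewrite bin_small //; lia.
have -> : (2 * b - 2 * b = 0)%N by lia.
by rewrite bin0.
Qed.

(** * Adem relations by induction on the number of variable factors *)

Section AdemInduction.
Variables (R : comNzRingType) (S : nat -> R -> R).
Hypothesis R2 : forall v : R, v + v = 0.
Hypotheses (SD : forall k, {morph S k : p q / p + q}) (S0r : forall k, S k 0 = 0).
Hypothesis S0 : forall p, S 0 p = p.
Implicit Types p q : R.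

Definition sq_pred k p := if k is k'.+1 then S k' p else 0.

Definition cartan_var x := forall k p, S k (x * p) = x * S k p + x ^+ 2 * sq_pred k p.

Lemma cartan_var_sqr x : cartan_var x -> forall k p,
  S k (x ^+ 2 * p) = x ^+ 2 * S k p + x ^+ 4 * sq_pred k.-1 p.
Proof.
move=> Sx k p; have -> : x ^+ 2 * p = x * (x * p) by ring.
rewrite !Sx; case: k => [|k] /=; first by ring.
rewrite Sx.
transitivity (x ^+ 2 * S k.+1 p + (x ^+ 3 * S k p + x ^+ 3 * S k p) +
  x ^+ 4 * sq_pred k p); first by ring.
by rewrite R2 addr0.
Qed.

Lemma adem_sum (f : nat -> R) a b N : (a./2 < N)%N ->
  \sum_(j < a./2.+1) f j *+ 'C(b - 1 - j, a - 2 * j) =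
  \sum_(0 <= j < N) f j *+ adem_coef a b j.
Proof.
move=> aN; rewrite -(big_mkord xpredT (fun j => f j *+ 'C(b - 1 - j, a - 2 * j))).
rewrite [RHS](big_cat_nat _ (n := a./2.+1)) //=.
rewrite [X in _ = _ + X]big_nat_cond [X in _ = _ + X]big1 ?addr0 => [|j].
  apply: eq_big_nat => j /andP[_ ja]; rewrite /adem_coef.
  by have -> : (2 * j <= a)%N by lia.
move=> /andP[/andP[ja _] _]; rewrite /adem_coef.
by have -> : (2 * j <= a)%N = false by lia.
Qed.

(** The range is widened to $a\le 2b$ with $a=0$ allowed. At $a=2b$ only $j=b$ survives and the
    relation is trivial, but the induction step lowers $b$ and meets this case. The summation bound
    [N] is free so that sums of different lengths can be compared. *)
Definition adem_at p := forall a b N, (a <= 2 * b)%N -> (a < N)%N ->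
  S a (S b p) = \sum_(0 <= j < N) S (a + b - j) (S j p) *+ adem_coef a b j.

Lemma adem_sum_widen (f : nat -> R) a b N : (a < N)%N ->
  \sum_(0 <= j < N) f j *+ adem_coef a b j =
  \sum_(0 <= j < a.+1) f j *+ adem_coef a b j.
Proof. by move=> aN; rewrite -!adem_sum //; lia. Qed.

Lemma adem_mulX x p : cartan_var x -> adem_at p -> adem_at (x * p).
Proof.
move=> Sx IH a b N; case: a => [|a] ab aN.
  rewrite adem_sum_widen // big_nat1 adem_coef0 add0n subn0 !S0.
  by rewrite mulr1n.
have [e|ab'] := eqVneq a.+1 (2 * b)%N.
  rewrite e (bigD1_seq b) ?mem_index_iota ?iota_uniq //=; last by lia.
  rewrite [X in _ = _ + X]big1 => [|j jb].
    by rewrite addr0 addnK (adem_coef_ge _ (leqnn _)) eqxx.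
  by rewrite (adem_coef_ge _ (leqnn _)) eqn_mul2l (negbTE jb).
case: b => [|b] in ab ab' *; first by lia.
rewrite adem_sum_widen //.
have Sum c (f : nat -> R) : \sum_(0 <= j < a.+2) (c * f j) *+ adem_coef a.+1 b.+1 j =
    c * \sum_(0 <= j < a.+2) f j *+ adem_coef a.+1 b.+1 j.
  by rewrite mulr_sumr; apply: eq_bigr => j _; rewrite mulrnAr.
have jb j : adem_coef a.+1 b.+1 j != 0%N -> (2 * j <= a.+1)%N.
  by case: leqP => // ja; rewrite adem_coef_small.
(* Collect by powers of $x$. Two applications of the Cartan formula leave $x$, $x^2$ and $x^4$; the
   $x^3$ terms have cancelled in [cartan_var_sqr]. *)
transitivity (x * \sum_(0 <= j < a.+2) S (a.+1 + b.+1 - j) (S j p) *+ adem_coef a.+1 b.+1 j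
 + x ^+ 2 * (\sum_(0 <= j < a.+2) S (a + b.+1 - j) (S j p) *+ adem_coef a.+1 b.+1 j
     + \sum_(0 <= j < a.+2) S (a.+1 + b.+1 - j) (sq_pred j p) *+ adem_coef a.+1 b.+1 j)
 + x ^+ 4 * \sum_(0 <= j < a.+2) S (a + b - j) (sq_pred j p) *+ adem_coef a.+1 b.+1 j);
  last first.
  rewrite mulrDr -!Sum -!big_split /=; apply: eq_bigr => j _; rewrite -!mulrnDl.
  have [-> |/jb ja] := eqVneq (adem_coef a.+1 b.+1 j) 0%N; first by rewrite !mulr0n.
  congr (_ *+ _); rewrite Sx SD Sx (cartan_var_sqr Sx).
  have -> : (a.+1 + b.+1 - j = (a + b - j).+2)%N by lia.
  have -> : (a + b.+1 - j = (a + b - j).+1)%N by lia.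
  exact: addr_regroup.
rewrite -(IH _ _ _ ab (ltnSn a.+1)).
have top : adem_coef a.+1 b.+1 a.+2 = 0%N by apply: adem_coef_small; lia.
have -> : \sum_(0 <= j < a.+2) S (a.+1 + b.+1 - j) (sq_pred j p) *+ adem_coef a.+1 b.+1 j =
    \sum_(0 <= j < a.+2) S (a + b.+1 - j) (S j p) *+ adem_coef a.+1 b.+1 j.+1.
  rewrite (big_nat_recl _ _ _ (leq0n _)) [sq_pred 0 _]/= S0r mul0rn add0r.
  rewrite [RHS](big_nat_recr _ _ _ (leq0n _)) top mulr0n [RHS]addr0.
  by apply: eq_bigr => j _; rewrite addSn subSS.
have -> : \sum_(0 <= j < a.+2) S (a + b - j) (sq_pred j p) *+ adem_coef a.+1 b.+1 j =
    sq_pred a (S b p).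
  rewrite (big_nat_recl _ _ _ (leq0n _)) [sq_pred 0 _]/= S0r mul0rn add0r.
  case: a => [|a] in ab ab' aN top Sum jb *; first by rewrite big_nat1 adem_coef_small ?mulr0n.
  have ab2 : (a <= 2 * b)%N by lia.
  rewrite [RHS](IH _ _ _ ab2 (leqnSn a.+1)).
  apply: eq_big_nat => j /andP[_ ja]; rewrite adem_coef_shift.
  by have -> : (a.+1 + b - j.+1 = a + b - j)%N by lia.
rewrite Sx SD Sx (cartan_var_sqr Sx) /=; apply: addr_collect.
rewrite -big_split /=.
under [RHS]eq_bigr do rewrite -mulrnDr.
have [ab2|ab2] := leqP a.+1 (2 * b).
  rewrite (IH _ _ _ (ltnW ab) (leqnSn a.+1)) (IH _ _ _ ab2 (ltnSn a.+1)).
  rewrite -big_split /=; apply: eq_bigr => j _.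
  by rewrite addSnnS -mulrnDr adem_coef_step.
(* Now $(a+1,b)$ is out of range. All coefficients on the right vanish, and on the left the relation
   $Sq^{2b}Sq^{b+1}=Sq^{2b+1}Sq^b$ makes the two terms equal. *)
have -> : a = (2 * b)%N by lia.
rewrite big1 => [|j _]; last by rewrite !adem_coef_odd mulr0n.
have ab3 : (2 * b <= 2 * b.+1)%N by lia.
rewrite (IH _ _ _ ab3 (ltnSn _)).
have b_in : b \in index_iota 0 (2 * b).+1 by rewrite mem_index_iota; lia.
rewrite (bigD1_seq _ b_in (iota_uniq _ _)) /=.
rewrite [X in _ + X + _]big1 => [|j jb']; last by rewrite adem_coef_even (negbTE jb').
rewrite adem_coef_even eqxx addr0.
have -> : (2 * b + b.+1 - b = (2 * b).+1)%N by lia.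
exact: R2.
Qed.

Lemma adem_atD p q : adem_at p -> adem_at q -> adem_at (p + q).
Proof.
move=> IHp IHq a b N ab aN; rewrite !SD (IHp _ _ _ ab aN) (IHq _ _ _ ab aN).
by rewrite -big_split; apply: eq_bigr => j _; rewrite !SD mulrnDl.
Qed.

Lemma adem_at0 : adem_at 0.
Proof.
by move=> a b N ab aN; rewrite !S0r big1 // => j _; rewrite !S0r mul0rn.
Qed.

Lemma adem_at1 : (forall k, S k 1 = if k == 0%N then 1 else 0) -> adem_at 1.
Proof.
move=> S1 a b N ab aN; rewrite adem_sum_widen // big_nat_recl // subn0 !S1.
rewrite big1 => [|j _]; last by rewrite S1 S0r mul0rn.
rewrite addr0; case: b ab => [|b] ab.
  by case: a ab aN => // _ _; rewrite adem_coef0 mulr1n /= ?S1.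

by rewrite addnS /= S0r ?S1 /= mul0rn.
Qed.
End AdemInduction.

(** * Steenrod squares on polynomial algebras *)

Section SqPol.
Variable m : nat.
Implicit Types (p q : Pol m) (i : 'I_m).

Lemma total_SqE p : total_Sq p = total_square p.
Proof. by []. Qed.

Lemma Sq_linear k : linear (@Sq m k).
Proof.
move=> c p q; rewrite /Sq !total_SqE raddfD /= coefD total_squareZ coefCM.
by rewrite mul_mpolyC.
Qed.

Lemma SqD k p q : Sq k (p + q) = Sq k p + Sq k q.
Proof. exact: (linD (@Sq_linear k)). Qed.
Lemma SqZ k c p : Sq k (c *: p) = c *: Sq k p.
Proof. exact: (linZ (@Sq_linear k)). Qed.
Lemma Sq0r k : Sq k (0 : Pol m) = 0.
Proof. exact: (lin0 (@Sq_linear k)). Qed.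
Lemma Sq_sum k I r (P : pred I) F :
  Sq k (\sum_(i <- r | P i) F i : Pol m) = \sum_(i <- r | P i) Sq k (F i).
Proof. exact: (lin_sum (@Sq_linear k)). Qed.

Lemma SqC k c : Sq k (c%:MP_[m]) = if k == 0%N then c%:MP_[m] else 0.
Proof. by rewrite /Sq total_SqE total_squareC coefC. Qed.

Lemma Sq1 k : Sq k (1 : Pol m) = if k == 0%N then 1 else 0.
Proof. by rewrite -mpolyC1 SqC. Qed.

Lemma Sq_mulX i : cartan_var (@Sq m) 'X_i.
Proof.
move=> k p; rewrite /Sq total_SqE rmorphM /= total_squareX mulrDl coefD coefCM.
by congr (_ + _); rewrite mulrAC coefMX; case: k => [|k] /=; rewrite ?mulr0 ?coefCM.
Qed.

Lemma Sq0 p : Sq 0 p = p.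
Proof.
elim/mpoly_mulX_ind: p => [p q IHp IHq|c p IH||i p IH].
- by rewrite SqD IHp IHq.
- by rewrite SqZ IH.
- by rewrite Sq1.
- by rewrite Sq_mulX IH /= mulr0 addr0.
Qed.

Lemma adem_at_all p : adem_at (@Sq m) p.
Proof.
elim/mpoly_mulX_ind: p => [p q IHp IHq|c p IH||i p IH].
- exact: (adem_atD SqD IHp IHq).
- case: (F2_case c) => ->; last by rewrite scale1r.
  by rewrite scale0r; exact: (adem_at0 Sq0r).
- exact: (adem_at1 Sq0r Sq0 Sq1).
- exact: (adem_mulX (@addF2 _) SqD Sq0r Sq0 (Sq_mulX i)).
Qed.
End SqPol.

Lemma Pol_adem m : adem_module (@Sq m).
Proof.
split; [exact: Sq0 | exact: Sq_linear | move=> a b v _ ab].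
rewrite (adem_at_all v (ltnW ab) (ltnSn a)).
by symmetry; apply: (adem_sum (fun j => Sq (a + b - j) (Sq j v))); lia.
Qed.

(** * Maps commuting with operations of bounded letters *)

Section Equivariance.
Variables (V W : lmodType F2) (sq : nat -> V -> V) (sq' : nat -> W -> W) (phi : V -> W).
Hypothesis phil : linear phi.

Lemma free_act_equivariant_bounded n (x : free_steenrod) v :
  (forall k u, (k < n)%N -> phi (sq k u) = sq' k (phi u)) ->
  (forall w : {fmonom nat}, w \in monalg.msupp x -> all (fun k => k < n)%N w) ->
  phi (free_act sq x v) = free_act sq' x (phi v).
Proof.
move=> phiE xn; rewrite /free_act (lin_sum phil) !big_seq; apply: eq_bigr => w wx.
rewrite (linZ phil); congr (_ *: _); elim: (fmonom_val w) (xn w wx) => //= k s IH.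
by case/andP=> kn sn; rewrite phiE // IH.
Qed.

Lemma act_equivariant a v :
  (forall k u, phi (sq k u) = sq' k (phi u)) -> phi (act sq a v) = act sq' a (phi v).
Proof.
move=> phiE; rewrite /act /free_act (lin_sum phil); apply: eq_bigr => w _.
by rewrite (linZ phil); congr (_ *: _); elim: (fmonom_val w) => //= k s <-.
Qed.
End Equivariance.

(** A strict bound for the squares in the representative used by [act]; it says how large $2^N$ must
    be for multiplication by $x^{2^N}$ to commute with [a]. *)
Definition letter_bound (a : steenrod) : nat :=
  \max_(w <- monalg.msupp (repr a)) \max_(k <- fmonom_val w) k.+1.

Lemma letter_boundP a n w : (letter_bound a <= n)%N -> w \in monalg.msupp (repr a) ->
  all (fun k => k < n)%N (fmonom_val w).
Proof.
move=> an wa; apply/allP => k kw; apply: leq_trans an.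
apply: (@leq_trans (\max_(k <- fmonom_val w) k.+1)).
  by rewrite (big_rem k) //= leq_max leqnn.
by rewrite /letter_bound (big_rem w) //= leq_max leqnn.
Qed.

Lemma act_equivariant_bounded (V W : lmodType F2) (sq : nat -> V -> V) (sq' : nat -> W -> W)
    (phi : V -> W) n a v : linear phi -> (letter_bound a <= n)%N ->
  (forall k u, (k < n)%N -> phi (sq k u) = sq' k (phi u)) ->
  phi (act sq a v) = act sq' a (phi v).
Proof.
move=> phil an phiE; apply: (free_act_equivariant_bounded phil _ phiE) => w.
exact: letter_boundP.
Qed.

Section Substitution.
Variables (R : comNzRingType) (m n : nat).
Variable phi : {rmorphism mpoly.mpoly m R -> mpoly.mpoly n R}.
Hypothesis phiC : forall c, phi c%:MP_[m] = c%:MP_[n].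
Hypothesis phiX : forall i, total_square (phi 'X_i) = (phi 'X_i)%:P + (phi 'X_i ^+ 2)%:P * 'X.

Lemma total_square_subst p : total_square (phi p) = map_poly phi (total_square p).
Proof.
pose f : {rmorphism mpoly.mpoly m R -> {poly (mpoly.mpoly n R)}} :=
  (@total_square n R : {rmorphism _ -> _}) \o phi.
pose g : {rmorphism mpoly.mpoly m R -> {poly (mpoly.mpoly n R)}} :=
  (map_poly phi : {rmorphism _ -> _}) \o (@total_square m R : {rmorphism _ -> _}).
rewrite -[LHS]/(f p) -[RHS]/(g p).
apply: mpoly_rmorph_ext => [c|i] /=.
  by rewrite phiC !total_squareC map_polyC /= phiC.
rewrite phiX total_squareX rmorphD rmorphM /= !map_polyC /= map_polyX.
by rewrite (rmorphXn phi).
Qed.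
End Substitution.

(** * The powers $x^{2^N}$ as a substitute for inverting $x$ *)

Section FrobeniusPower.
Variables (m N : nat).
Implicit Types (p x : Pol m).

Lemma total_Sq_Frobenius x : total_Sq x = x%:P + (x ^+ 2)%:P * 'X ->
  total_Sq (x ^+ (2 ^ N)) = (x ^+ (2 ^ N))%:P + (x ^+ (2 ^ N.+1))%:P * 'X^(2 ^ N).
Proof.
move=> Sx; rewrite total_SqE.
have -> : total_square (x ^+ (2 ^ N)) = total_square x ^+ (2 ^ N) by rewrite rmorphXn.
rewrite -total_SqE {}Sx; elim: N => [|n IH]; first by rewrite !expn0 !expr1.
rewrite expnSr exprM {}IH expr2 mulrDl !mulrDr.
set A := (x ^+ _)%:P; set B := (x ^+ _)%:P; set T := 'X^_.
have -> : A * A + A * (B * T) + (B * T * A + B * T * (B * T)) =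
  A * A + B * B * (T * T) + (A * B * T + A * B * T) by ring.
have -> : A * B * T + A * B * T = 0 by rewrite -mulrDr; apply/polyP => i; rewrite -mulr2n mulrnAr coefMn coef0 mulrnF2.
rewrite addr0 /A /B /T -!polyCM -!exprD.
by rewrite !addnn -!muln2 -!expnSr.
Qed.

(** The total square of $x^{2^N}$ is $x^{2^N}+x^{2^{N+1}}t^{2^N}$, with nothing strictly between
    $t^0$ and $t^{2^N}$. *)
Lemma Sq_mul_Frobenius x k p : total_Sq x = x%:P + (x ^+ 2)%:P * 'X ->
  (k < 2 ^ N)%N -> Sq k (x ^+ (2 ^ N) * p) = x ^+ (2 ^ N) * Sq k p.
Proof.
move=> Sx kN; rewrite /Sq !total_SqE rmorphM /= -total_SqE total_Sq_Frobenius //.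
by rewrite mulrDl coefD coefCM mulrAC coefMXn kN addr0.
Qed.
End FrobeniusPower.

Lemma total_Sq_var m (i : 'I_m) : total_Sq ('X_i : Pol m) = ('X_i)%:P + ('X_i ^+ 2)%:P * 'X.
Proof. by rewrite total_SqE total_squareX. Qed.

Lemma mwiden_var m (i : 'I_m) : mwiden ('X_i : Pol m) = 'X_(widen_ord (leqnSn m) i).
Proof. by rewrite mwidenX mnmwiden1. Qed.

Lemma Sq_mwiden m k (p : Pol m) : Sq k (mwiden p) = mwiden (Sq k p).
Proof.
rewrite /Sq !total_SqE.
rewrite (@total_square_subst F2 m m.+1 (@mwiden m F2 : {rmorphism _ -> _})) /=.
- by rewrite coef_map.
- by move=> c; rewrite mwidenC.
- by move=> i; rewrite mwiden_var total_squareX.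
Qed.

Lemma varX_neq0 m (i : 'I_m) : ('X_i : Pol m) != 0.
Proof.
apply/eqP => /(congr1 (mcoeff U_(i))) /eqP.
by rewrite mcoeffX mcoeff0 eqxx.
Qed.

Lemma inv_step (R : idomainType) (R2 : forall v : R, v + v = 0) (x y0 y1 s : R) M :
  (0 < M)%N -> x != 0 -> x ^+ M * s = x * y1 + x ^+ 2 * y0 ->
  y1 = x ^+ M.-1 * s + x * y0.
Proof.
move=> M0 x0 E; apply: (mulfI x0).
have -> : x * (x ^+ M.-1 * s + x * y0) = x ^+ M * s + x ^+ 2 * y0.
  by rewrite -[in RHS](prednK M0) exprS; ring.
by rewrite E -addrA R2 addr0.
Qed.

Lemma Pol2 m (v : Pol m) : v + v = 0.
Proof. exact: addF2. Qed.

Section InverseVariable.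
Variables (m N : nat) (i : 'I_m).
Local Notation x := ('X_i : Pol m).
Local Notation M := (2 ^ N)%N.

(** This is $Sq^j(x^{-1})=x^{j-1}$ multiplied by $x^M$. Compare the Cartan formula for $x\cdot
    x^{M-1}p$ with $Sq^{k+1}(x^Mp)=x^MSq^{k+1}p$ and cancel $x$: the result is a recursion in
    $k$. *)
Lemma Sq_mul_inverse k (p : Pol m) : (k < M)%N ->
  Sq k (x ^+ M.-1 * p) = \sum_(0 <= j < k.+1) x ^+ (M.-1 + j) * Sq (k - j) p.
Proof.
have M0 : (0 < M)%N by rewrite expn_gt0.
have Sx := total_Sq_var i; elim: k => [|k IH] kM.
  by rewrite big_nat1 !Sq0 addn0.
have E : x ^+ M * Sq k.+1 p = x * Sq k.+1 (x ^+ M.-1 * p) + x ^+ 2 * Sq k (x ^+ M.-1 * p).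
  rewrite -(Sq_mul_Frobenius _ Sx kM) -{1}(prednK M0) exprS -mulrA.
  exact: Sq_mulX.
rewrite (@inv_step (mpoly.mpoly m F2) (@Pol2 m) _ _ _ _ _ M0 (varX_neq0 i) E) (IH (ltnW kM)).
rewrite [RHS](big_nat_recl _ _ _ (leq0n _)) addn0 subn0; congr (_ + _).
rewrite mulr_sumr; apply: eq_bigr => j _.
by rewrite mulrA -exprS addnS subSS.
Qed.
End InverseVariable.


(** * The module $\mathcal P_m\otimes\widehat{\mathcal P}_1$ inside polynomials *)

Section HatEmbedding.
Variable m : nat.
Local Notation x := ('X_ord_max : Pol m.+1).

(** Multiplication by $x^{2^N}$, which clears the pole of $px^{-1}+q$. *)
Definition hat_embed N (u : hatP m) : Pol m.+1 :=
  x ^+ (2 ^ N).-1 * mwiden u.1 + x ^+ (2 ^ N) * u.2.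

Lemma hat_embedE N p q :
  hat_embed N (p, q) = x ^+ (2 ^ N).-1 * mwiden p + x ^+ (2 ^ N) * q.
Proof. by []. Qed.

Lemma hat_embed0 N p : hat_embed N (p, 0) = x ^+ (2 ^ N).-1 * mwiden p.
Proof. by rewrite hat_embedE mulr0 addr0. Qed.

Lemma hat_embed_linear N : linear (hat_embed N).
Proof.
move=> c u v; rewrite /hat_embed /= mwidenD mwidenZ !mulrDr -!scalerAr scalerDr.
by rewrite -!addrA; congr (_ + _); rewrite addrCA.
Qed.

Lemma hat_embed_sq N k u : (k < 2 ^ N)%N ->
  hat_embed N (hat_Sq k u) = Sq k (hat_embed N u).
Proof.
move=> kN; rewrite /hat_embed /= SqD (Sq_mul_Frobenius _ (total_Sq_var _) kN).
rewrite (Sq_mul_inverse _ _ kN) (big_nat_recl _ _ _ (leq0n _)) addn0 subn0 Sq_mwiden.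
rewrite mulrDr addrCA [RHS]addrC; congr (_ + (_ + _)).
rewrite big_add1 /= mulr_sumr; apply: eq_bigr => j _.
rewrite -Sq_mwiden; move: (Sq _ _) => q.
rewrite mulrCA -exprD mulrC; congr (_ ^+ _ * _).
have : (0 < 2 ^ N)%N by rewrite expn_gt0.
lia.
Qed.

Definition drop_last (p : Pol m.+1) : Pol m :=
  p \mPo [tuple if insub (val j) is Some i then 'X_(i : 'I_m) else 0 | j < m.+1].

Lemma drop_lastD : {morph drop_last : p q / p + q}.
Proof. exact: comp_mpolyD. Qed.
Lemma drop_lastM : {morph drop_last : p q / p * q}.
Proof. by move=> p q; rewrite /drop_last rmorphM. Qed.
Lemma drop_last0 : drop_last 0 = 0.
Proof. exact: comp_mpoly0. Qed.

Lemma drop_last_mwiden p : drop_last (mwiden p) = p.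
Proof.
pose f : {rmorphism Pol m -> Pol m} := (comp_mpoly
  [tuple if insub (val j) is Some i then 'X_(i : 'I_m) else 0 | j < m.+1] : {rmorphism _ -> _})
  \o (@mwiden m F2 : {rmorphism _ -> _}).
rewrite -[LHS]/(f p) -[RHS]/(idfun p).
apply: mpoly_rmorph_ext => [c|i] /=; first by rewrite mwidenC comp_mpolyC.
rewrite mwiden_var comp_mpolyXU -tnth_nth tnth_mktuple /=.
by case: insubP => [j _ /val_inj ->|/negP[]].
Qed.

Lemma drop_lastX : drop_last x = 0.
Proof.
by rewrite /drop_last comp_mpolyXU -tnth_nth tnth_mktuple /= insubF ?ltnn.
Qed.

(** Divide by $x^{2^N-1}$; setting $x=0$ then isolates the first component. *)
Lemma hat_embed_inj N u : hat_embed N u = 0 -> u = 0.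
Proof.
case: u => p q; rewrite /hat_embed /=; have M0 : (0 < 2 ^ N)%N by rewrite expn_gt0.
rewrite -[in x ^+ (2 ^ N)](prednK M0) exprSr -mulrA -mulrDr => /eqP.
rewrite mulf_eq0 expf_eq0 (negbTE (varX_neq0 _)) andbF /= => /eqP E.
have p0 : p = 0.
  have := congr1 drop_last E.
  by rewrite drop_lastD drop_lastM drop_last_mwiden drop_lastX mul0r addr0 drop_last0.
move: E; rewrite p0 mwiden0 add0r => /eqP.
by rewrite mulf_eq0 (negbTE (varX_neq0 _)) /= => /eqP ->.
Qed.

Lemma hat_Sq_linear k : linear (@hat_Sq m k).
Proof.
move=> c u v; rewrite /hat_Sq /= !Sq_linear; congr (_, _) => /=.
rewrite scalerDr [RHS]addrACA; congr (_ + _); rewrite scaler_sumr -big_split /=.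
apply: eq_bigr => j _.
by rewrite Sq_linear mwidenD mwidenZ mulrDl scalerAl.
Qed.

(** All squares in one Adem relation are at most $a+b<2^N$, so the relation can be read after
    [hat_embed N], where it holds for polynomials. *)
Lemma hat_adem : adem_module (@hat_Sq m).
Proof.
split=> [[p q]||a b u a0 ab]; first by rewrite /hat_Sq /= !Sq0 big_geq ?addr0.
- exact: hat_Sq_linear.
pose N := (a + b).+1.
have bound k : (k <= a + b)%N -> (k < 2 ^ N)%N.
  by move=> kab; apply: leq_ltn_trans kab (ltn_trans (ltnSn _) (ltn_expl _ _)).
have emb_lin := hat_embed_linear N.
apply/eqP; rewrite -subr_eq0; apply/eqP; apply: (@hat_embed_inj N).
have [_ _ ad] := Pol_adem m.+1.
rewrite -[- _]scaleN1r addrC emb_lin scaleN1r addrC.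
rewrite (hat_embed_sq _ (bound _ (leq_addr _ _))) (hat_embed_sq _ (bound _ (leq_addl _ _))).
rewrite (ad _ _ _ a0 ab) (lin_sum emb_lin); apply/eqP; rewrite subr_eq0; apply/eqP.
apply: eq_bigr => j _.
rewrite [RHS](linMn emb_lin); congr (_ *+ _).
have jab : (j <= a + b)%N by have := ltn_ord j; lia.
by rewrite (hat_embed_sq _ (bound _ (leq_subr _ _))) (hat_embed_sq _ (bound _ jab)).
Qed.
End HatEmbedding.

(** * The cocycle of the one-variable extension *)

Section E1Cocycle.
Variable m : nat.
Implicit Types (a b : steenrod) (p q : Pol m).

Lemma act_hat_fst a (u : hatP m) : (act (@hat_Sq m) a u).1 = act (@Sq m) a u.1.
Proof. by apply: (act_equivariant (phi := fst)). Qed.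

Lemma act_hat_poly a (q : Pol m.+1) : act (@hat_Sq m) a (0, q) = (0, act (@Sq m.+1) a q).
Proof.
pose inr (q : Pol m.+1) : hatP m := (0, q).
have inr_lin : linear inr by move=> c p p'; congr (_, _); rewrite /= ?scaler0 ?addr0.
suff E k (p : Pol m.+1) : inr (Sq k p) = hat_Sq k (inr p) by rewrite -(act_equivariant inr_lin a q E).
rewrite /hat_Sq /= Sq0r big1 ?addr0 // => j _.
by rewrite Sq0r mwiden0 mul0r.
Qed.

Lemma e1_cocycle_linear a : linear (@e1_cocycle m a).
Proof.
move=> c p q; rewrite /e1_cocycle.
have -> : (c *: p + q, 0) = c *: (p, 0) + (q, 0) :> hatP m.
  by congr (_, _); rewrite /= ?scaler0 ?addr0.
by rewrite (act_linear (@hat_adem m)).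
Qed.

Lemma e1_cocycle_linearl c a b p :
  e1_cocycle (c *: a + b) p = c *: e1_cocycle a p + e1_cocycle b p.
Proof. by rewrite /e1_cocycle (act_linearl (@hat_adem m)). Qed.

Lemma act_hat a (u : hatP m) :
  act (@hat_Sq m) a u = (act (@Sq m) a u.1, e1_cocycle a u.1 + act (@Sq m.+1) a u.2).
Proof.
have {1}-> : u = (u.1, 0) + (0, u.2).
  by case: u => p q; congr (_, _); rewrite /= ?addr0 ?add0r.
rewrite (actD (@hat_adem m)) act_hat_poly; congr (_, _) => /=.
by rewrite act_hat_fst addr0.
Qed.

(** The second component of $(ab)(px^{-1})=a(b(px^{-1}))$: a crossed homomorphism rule. *)
Lemma e1_cocycleM a b p :
  e1_cocycle (a * b) p = e1_cocycle a (act (@Sq m) b p) + act (@Sq m.+1) a (e1_cocycle b p).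
Proof.
have E := act_mul (@hat_adem m) a b (p, 0).
have Eb : act (@hat_Sq m) b (p, 0) = (act (@Sq m) b p, e1_cocycle b p).
  by rewrite act_hat (act0 (Pol_adem m.+1)) addr0.
by rewrite -[LHS]/((act (@hat_Sq m) (a * b) (p, 0)).2) E Eb act_hat.
Qed.

(** The defining formula $a(px^{-1})-(ap)x^{-1}$ with the denominator cleared. It transfers
    questions about the cocycle to the action on polynomials. *)
Lemma e1_cocycle_embed a p N : (letter_bound a <= 2 ^ N)%N ->
  'X_ord_max ^+ (2 ^ N) * e1_cocycle a p =
  act (@Sq m.+1) a ('X_ord_max ^+ (2 ^ N).-1 * mwiden p) +
  'X_ord_max ^+ (2 ^ N).-1 * mwiden (act (@Sq m) a p).
Proof.
move=> aN; have := act_equivariant_bounded (p, 0) (@hat_embed_linear m N) aN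
  (fun k u kn => hat_embed_sq u kn).
rewrite act_hat (act0 (Pol_adem m.+1)) addr0 hat_embedE hat_embed0 => <-.
by rewrite [RHS]addrAC Pol2 add0r.
Qed.
End E1Cocycle.

(** * The bar differential on lists *)

Definition merge_at i (l : seq steenrod) : seq steenrod :=
  take i l ++ nth 0 l i * nth 0 l i.+1 :: drop i.+2 l.

Section Merges.
Variable V : lmodType F2.
Implicit Types (phi : seq steenrod -> V) (l s t : seq steenrod) (a b : steenrod).

Definition merges phi l : V := \sum_(i < (size l).-1) phi (merge_at i l).

Lemma merges1 phi a : merges phi [:: a] = 0.
Proof. by rewrite /merges big_ord0. Qed.

Lemma merges_cons phi a b r :
  merges phi (a :: b :: r) = phi (a * b :: r) + merges (fun t => phi (a :: t)) (b :: r).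
Proof. by rewrite /merges big_ord_recl /= /merge_at /= drop0. Qed.

Lemma eq_merges phi phi' l : (forall s, (size s).+1 = size l -> phi s = phi' s) ->
  merges phi l = merges phi' l.
Proof.
move=> E; apply: eq_bigr => i _; apply: E; have := ltn_ord i.
by rewrite /merge_at size_cat /= size_take size_drop; case: ifP; lia.
Qed.

Lemma merges_rcons phi s a b :
  merges phi (rcons (rcons s a) b) =
  merges (fun t => phi (rcons t b)) (rcons s a) + phi (rcons s (a * b)).
Proof.
elim: s phi => [|c s IH] phi /=.
  by rewrite merges_cons !merges1 addr0 add0r.
case: s IH => [|d s] IH /=.
  by have := IH (fun t => phi (c :: t)); rewrite /= !merges_cons /= => ->; rewrite addrA.
rewrite merges_cons [in RHS]merges_cons -addrA; congr (_ + _).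
exact: (IH (fun t => phi (c :: t))).
Qed.
End Merges.

Lemma lin_merges (V W : lmodType F2) (f : V -> W) (phi : seq steenrod -> V) l : linear f ->
  merges (fun s => f (phi s)) l = f (merges phi l).
Proof. by move=> fl; rewrite /merges (lin_sum fl). Qed.

Section SeqCochains.
Variable V : lmodType F2.
Implicit Types (phi : seq steenrod -> V) (l s t : seq steenrod) (a b : steenrod).

(* [bar_left] is the bar differential without its last face; on cochains with
   values in a module, that face involves the last entry only. *)
Definition bar_left phi l : V :=
  if l is a :: r then augmentation a *: phi r + merges phi l else 0.

Definition bar_diff phi l : V :=
  bar_left phi l + augmentation (last 0 l) *: phi (take (size l).-1 l).

Definition multilin phi n := forall s t k x y, (size s + size t).+1 = n ->
  phi (s ++ (k *: x + y) :: t) = k *: phi (s ++ x :: t) + phi (s ++ y :: t).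

Definition has_degree phi n (d : nat) := forall l (e : seq nat), size l = n -> size e = n ->
  (forall i, (i < n)%N -> homogeneous_op (nth 0%N e i) (nth 0 l i)) -> sumn e <> d -> phi l = 0.
End SeqCochains.

(** * Translation between [bar] and lists *)

Definition seq_of_bar s (a : bar s) : seq steenrod := codom a.
Definition bar_of_seq s (l : seq steenrod) : bar s := [ffun j : 'I_s => nth 0 l j].

Lemma size_seq_of_bar s (a : bar s) : size (seq_of_bar a) = s.
Proof. by rewrite /seq_of_bar size_codom card_ord. Qed.

Lemma nth_seq_of_bar s (a : bar s) (i : 'I_s) : nth 0 (seq_of_bar a) i = a i.
Proof.
rewrite /seq_of_bar /codom /image_mem (nth_map i) ?size_enum_ord //.
by rewrite nth_ord_enum.
Qed.

Lemma seq_of_barK s : cancel (@seq_of_bar s) (@bar_of_seq s).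
Proof. by move=> a; apply/ffunP => i; rewrite ffunE nth_seq_of_bar. Qed.

Lemma bar_of_seqK s l : size l = s -> seq_of_bar (bar_of_seq s l) = l.
Proof.
move=> ls; apply: (@eq_from_nth _ 0) => [|i]; rewrite size_seq_of_bar // => ltis.
by rewrite (nth_seq_of_bar _ (Ordinal ltis)) ffunE.
Qed.

Lemma seq_of_bar_tail s (a : bar s.+1) : seq_of_bar (bar_tail a) = behead (seq_of_bar a).
Proof.
apply: (@eq_from_nth _ 0) => [|i]; rewrite ?size_behead !size_seq_of_bar // => ltis.
rewrite (nth_seq_of_bar _ (Ordinal ltis)) ffunE nth_behead.
have i1 : (i.+1 < s.+1)%N by [].
by rewrite -[in RHS](_ : Ordinal i1 = i.+1 :> nat) // nth_seq_of_bar; congr (a _); apply/val_inj.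
Qed.

Lemma seq_of_bar_init s (a : bar s.+1) : seq_of_bar (bar_init a) = take s (seq_of_bar a).
Proof.
apply: (@eq_from_nth _ 0) => [|i].
  by rewrite size_take !size_seq_of_bar ltnSn.
rewrite !size_seq_of_bar // => ltis.
rewrite (nth_seq_of_bar _ (Ordinal ltis)) ffunE nth_take //.
have i1 : (i < s.+1)%N by apply: ltnW.
by rewrite -[in RHS](_ : Ordinal i1 = i :> nat) // nth_seq_of_bar; congr (a _); apply/val_inj.
Qed.

Lemma seq_of_bar_merge s (i : 'I_s) (a : bar s.+1) :
  seq_of_bar (bar_merge i a) = merge_at i (seq_of_bar a).
Proof.
have is1 := ltn_ord i.
apply: (@eq_from_nth _ 0) => [|j].
  rewrite /merge_at size_cat /= size_take size_drop !size_seq_of_bar.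
  by case: ifP; lia.
rewrite size_seq_of_bar => ltjs.
have nthE k (ks : (k < s.+1)%N) : nth 0 (seq_of_bar a) k = a (Ordinal ks).
  by rewrite -(nth_seq_of_bar a (Ordinal ks)).
rewrite (nth_seq_of_bar _ (Ordinal ltjs)) ffunE /merge_at nth_cat size_take size_seq_of_bar.
have -> : (i < s.+1)%N by lia.
have widenE k (ks : (k < s)%N) (ks' : (k < s.+1)%N) :
    a (widen_ord (leqnSn s) (Ordinal ks)) = a (Ordinal ks').
  by congr (a _); apply/val_inj.
have liftE k (ks : (k < s)%N) (ks' : (k.+1 < s.+1)%N) :
    a (lift ord0 (Ordinal ks)) = a (Ordinal ks').
  by congr (a _); apply/val_inj.
have ltjs1 : (j < s.+1)%N by lia.
have ltjs2 : (j.+1 < s.+1)%N by [].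
rewrite [nat_of_ord (Ordinal _)]/= (widenE _ _ ltjs1) (liftE _ _ ltjs2).
case: ltnP => [ji|ij]; first by rewrite nth_take // nthE.
have [ji|ji] := eqVneq j i.
  have -> : (Ordinal ltjs == i) by apply/eqP/val_inj.
  by rewrite -ji subnn /= (nthE _ ltjs1) (nthE _ ltjs2).
have -> : (Ordinal ltjs == i) = false by apply/negbTE; apply: contra ji => /eqP <-.
have -> : (j - i = (j - i.+1).+1)%N by move/eqP: ji; lia.
rewrite /= nth_drop; have -> : (i.+2 + (j - i.+1) = j.+1)%N by move/eqP: ji; lia.
by rewrite (nthE _ ltjs2).
Qed.

Lemma seq_of_bar_set s (i : 'I_s) (a : bar s) x :
  seq_of_bar (bar_set a i x) = take i (seq_of_bar a) ++ x :: drop i.+1 (seq_of_bar a).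
Proof.
have is1 := ltn_ord i; apply: (@eq_from_nth _ 0) => [|j].
  by rewrite size_cat /= size_take size_drop !size_seq_of_bar is1; lia.
rewrite size_seq_of_bar => ltjs.
rewrite (nth_seq_of_bar _ (Ordinal ltjs)) ffunE nth_cat size_take size_seq_of_bar is1.
have nthE : nth 0 (seq_of_bar a) j = a (Ordinal ltjs).
  by rewrite -(nth_seq_of_bar a (Ordinal ltjs)).
have [ji|ij|ji] := ltngtP j i.
- rewrite nth_take // nthE; case: eqP => // E.
  by rewrite -E ltnn in ji.
- have -> : (j - i = (j - i.+1).+1)%N by lia.
  rewrite /= nth_drop subnKC // nthE; case: eqP => // E.
  by rewrite -E ltnn in ij.
have -> : (j - i = 0)%N by rewrite ji subnn.
by case: eqP => // -[]; apply/val_inj.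
Qed.

Lemma lin_faces (V W : lmodType F2) (f : V -> W) k k' u v w : linear f ->
  f (k *: u + v + k' *: w) = k *: f u + f v + k' *: f w.
Proof. by move=> fl; rewrite !(linD fl) !(linZ fl). Qed.

Lemma coboundary_mapE (s : nat) (c : bar s -> F2^o) (a : bar s.+1) :
  coboundary_map c a = bar_diff (fun l => c (bar_of_seq s l)) (seq_of_bar a).
Proof.
have cl := linear_extension_is_linear c.
have -> : coboundary_map c a = augmentation (a ord0) *: c (bar_tail a) +
    \sum_(i < s) c (bar_merge i a) + augmentation (a ord_max) *: c (bar_init a).
  rewrite -[LHS]/(linear_extension c (bar_boundary a)) /bar_boundary.
  rewrite (lin_faces _ _ _ _ _ cl) (linear_extensionU c) (linear_extensionU c (bar_init a)) (lin_sum cl).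
  by congr (_ + _ + _); apply: eq_bigr => i _; rewrite (linear_extensionU c).
rewrite /bar_diff.
have sz := size_seq_of_bar a; case E: (seq_of_bar a) => [|x r]; first by rewrite E in sz.
have xE : a ord0 = x by rewrite -nth_seq_of_bar E.
have rE : bar_tail a = bar_of_seq s r by rewrite -[LHS]seq_of_barK seq_of_bar_tail E.
have lE : a ord_max = last 0 (x :: r).
  by rewrite -nth_seq_of_bar E -nth_last /=; congr nth; rewrite E in sz; case: sz.
have iE : bar_init a = bar_of_seq s (take (size (x :: r)).-1 (x :: r)).
  by rewrite -[LHS]seq_of_barK seq_of_bar_init -E sz.
rewrite /bar_left lE iE xE rE /merges; congr (_ + _ + _).
rewrite -E sz /=; apply: eq_bigr => i _; congr (c _).
by rewrite -seq_of_bar_merge seq_of_barK.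
Qed.

(** * The iterated cocycle on lists *)

Lemma F2_adem : adem_module F2_Sq.
Proof.
split=> // [k c u v|a b v a0 ab]; first by rewrite /F2_Sq; case: eqP; rewrite ?scaler0 ?addr0.
rewrite /F2_Sq; have -> : (a == 0%N) = false by case: a a0 ab.
rewrite big1 // => j _; have -> : (a + b - j == 0)%N = false by have := ltn_ord j; lia.
by rewrite mul0rn.
Qed.

Lemma augmentationM a b : augmentation (a * b) = augmentation a * augmentation b.
Proof.
rewrite /augmentation (act_mul F2_adem).
have {1}-> : act F2_Sq b 1 = act F2_Sq b 1 *: (1 : F2^o) by rewrite /GRing.scale /= mulr1.
by rewrite (actZ F2_adem) mulrC.
Qed.

Lemma augmentation_linear k a b :
  augmentation (k *: a + b) = k * augmentation a + augmentation b.
Proof. by rewrite /augmentation (act_linearl F2_adem). Qed.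

Lemma act_Sq1 m a : act (@Sq m) a 1 = augmentation a *: 1.
Proof.
pose phi (c : F2^o) : Pol m := c *: 1.
have phil : linear phi by move=> k u v; rewrite /phi scalerDl scalerA.
suff E k u : phi (F2_Sq k u) = Sq k (phi u).
  by have := act_equivariant phil a 1 E; rewrite /phi scale1r => <-.
by rewrite /phi SqZ Sq1 /F2_Sq; case: eqP => // _; rewrite scaler0 scale0r.
Qed.

Fixpoint e_seq m (l : seq steenrod) : Pol m :=
  if m is k.+1 return Pol m then e1_cocycle (head 0 l) (e_seq k (behead l)) else 1.

Lemma e_seqS m a l : e_seq m.+1 (a :: l) = e1_cocycle a (e_seq m l).
Proof. by []. Qed.

Lemma e_cocycleE m (a : bar m) : e_cocycle a = e_seq m (seq_of_bar a).
Proof.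
elim: m a => [|m IH] a; first by [].
rewrite -[LHS]/(e1_cocycle (a ord0) (e_cocycle (bar_tail a))) IH seq_of_bar_tail.
rewrite -[RHS]/(e1_cocycle (head 0 (seq_of_bar a)) (e_seq m (behead (seq_of_bar a)))).
by rewrite -nth0 (nth_seq_of_bar a ord0).
Qed.

(** The cocycle identity of $e_m$. The first merge expands by [e1_cocycleM]; the others pass inside
    the outer [e1_cocycle], where the induction hypothesis produces the term that cancels the
    surplus of that expansion. *)
Lemma merges_e_seq m a r : size r = m ->
  merges (e_seq m) (a :: r) =
  act (@Sq m) a (e_seq m r) + augmentation (last a r) *: e_seq m (belast a r).
Proof.
elim: m a r => [|m IH] a r; first by case: r => // _; rewrite merges1 act_Sq1 addF2.
case: r => [|b r] // [rm]; rewrite merges_cons.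
rewrite -[e_seq m.+1 (b :: r)]/(e1_cocycle b (e_seq m r)) [last _ _]/= [belast _ _]/=.
rewrite -[e_seq m.+1 (a * b :: r)]/(e1_cocycle (a * b) (e_seq m r)) e1_cocycleM.
rewrite -[e_seq m.+1 (a :: _)]/(e1_cocycle a (e_seq m (belast b r))).
rewrite (lin_merges (e_seq m) (b :: r) (e1_cocycle_linear a)) (IH _ _ rm).
rewrite (linD (e1_cocycle_linear a)) (linZ (e1_cocycle_linear a)).
move: (e1_cocycle a (act _ _ _)) (act _ a _) (_ *: _) => x y z.
by rewrite addrAC addrA addF2 add0r addrC.
Qed.

Lemma e_seq_multilin m : multilin (e_seq m) m.
Proof.
elim: m => [|m IH] s t k x y; first by [].
case: s => [|c s] [st]; first exact: e1_cocycle_linearl.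
have e_cons u : e_seq m.+1 ((c :: s) ++ u) = e1_cocycle c (e_seq m (s ++ u)) by [].
by rewrite !e_cons (IH _ _ _ _ _ st) (e1_cocycle_linear c).
Qed.

(** * Internal degrees of polynomials and cocycles *)

Section Degrees.

(* A polynomial placed in a module in which its degree is lowered by [s]. *)
Definition homogeneous_shift m s D (p : Pol m) : Prop :=
  forall w : 'X_{1..m}, p@_w != 0 -> (mdeg w + s)%N = D.

Lemma hshift_lin m s D c (p q : Pol m) :
  homogeneous_shift s D p -> homogeneous_shift s D q -> homogeneous_shift s D (c *: p + q).
Proof.
move=> hp hq w; rewrite mcoeffD mcoeffZ.
have [E|/hp //] := eqVneq (p@_w) 0.
by have [E'|/hq //] := eqVneq (q@_w) 0; rewrite E E' mulr0 addr0 eqxx.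
Qed.

Lemma hshift0 m s D : homogeneous_shift s D (0 : Pol m).
Proof. by move=> w; rewrite mcoeff0 eqxx. Qed.

Lemma hshiftD m s D (p q : Pol m) :
  homogeneous_shift s D p -> homogeneous_shift s D q -> homogeneous_shift s D (p + q).
Proof. by move=> hp hq; have := hshift_lin (c := 1) hp hq; rewrite scale1r. Qed.

Lemma hshift_sum m s D I r (P : pred I) (F : I -> Pol m) :
  (forall i, P i -> homogeneous_shift s D (F i)) ->
  homogeneous_shift s D (\sum_(i <- r | P i) F i).
Proof. by move=> hF; apply: big_ind hF; [apply: hshift0 | apply: hshiftD]. Qed.

Lemma hshift_homog m s d (p : Pol m) : p \is d.-homog -> homogeneous_shift s (d + s) p.
Proof. by move=> hp w; rewrite -mcoeff_msupp => /(dhomog_mf hp) <-. Qed.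

Lemma hshiftP m s D (p : Pol m) : homogeneous_shift s D p ->
  p = 0 \/ exists2 d, D = (d + s)%N & p \is d.-homog.
Proof.
move=> hp; have [->|] := eqVneq p 0; [by left | rewrite -msupp_eq0 => pn; right].
case E: (msupp p) pn => [|w r] // _; exists (mdeg w).
  by rewrite -(hp w) // -mcoeff_msupp E mem_head.
apply/dhomogP => w' wp; apply: (@addIn s).
by rewrite (hp w') ?(hp w) // -mcoeff_msupp // E mem_head.
Qed.

Lemma mnm_ind m (P : 'X_{1..m} -> Prop) :
  P 0%MM -> (forall i w, P w -> P (U_(i) + w)%MM) -> forall w, P w.
Proof.
move=> P0 PU w; move: {2}(mdeg w) (erefl (mdeg w)) => n; elim: n w => [|n IH] w wn.
  by have /eqP -> : w == 0%MM by rewrite -mdeg_eq0 wn.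
have [i wi] : exists i, w i != 0%N.
  apply/existsP; rewrite -negb_forall; apply/forallP => w0.
  by move: wn; rewrite mdegE big1 // => i _; apply/eqP.
have Uw : (U_(i) <= w)%MM by apply/mnm_lepP => j; rewrite mnm1E; case: eqP => [<-|]; rewrite ?lt0n.
rewrite -(submK Uw) addmC; apply/PU/IH.
by apply: (@addIn 1%N); rewrite -[in LHS](mdeg1 i) -mdegD submK // wn addn1.
Qed.

Lemma Sq_mon_homog m k (w : 'X_{1..m}) : Sq k ('X_[w] : Pol m) \is (mdeg w + k).-homog.
Proof.
elim/mnm_ind: w k => [|i w IH] k.
  by rewrite mpolyX0 Sq1 mdeg0 add0n; case: eqP => [->|_]; rewrite ?dhomog1 ?dhomog0.
have hX e : 'X_i ^+ e \is [in F2[m], e.-homog].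
  by rewrite -[X in X.-homog]mul1n; apply: dhomogMn; rewrite dhomogX /= mdeg1.
rewrite mpolyXD Sq_mulX mdegD mdeg1; apply: dhomogD.
  by rewrite -addnA; apply: dhomogM (hX 1%N) _.
case: k => [|k] /=; first by rewrite mulr0 dhomog0.
have -> : (1 + mdeg w + k.+1 = 2 + (mdeg w + k))%N by lia.
exact: dhomogM.
Qed.

Lemma Sq_homog m k d (p : Pol m) : p \is d.-homog -> Sq k p \is (d + k).-homog.
Proof.
move=> hp; rewrite [p]mpolyE Sq_sum big_seq; apply: rpred_sum => w wp.
by rewrite SqZ -(dhomog_mf hp wp); apply/dhomogZ/Sq_mon_homog.
Qed.

Lemma mwiden_homog m d (p : Pol m) : p \is d.-homog -> mwiden p \is d.-homog.
Proof.
move=> hp; rewrite [p]mpolyE raddf_sum /= big_seq; apply: rpred_sum => w wp.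
rewrite mwidenZ mwidenX; apply: dhomogZ; rewrite dhomogX /= -(dhomog_mf hp wp).
apply/eqP; rewrite mdegE big_ord_recr /= mnmwiden_ordmax addn0 mdegE.
by apply: eq_bigr => i _; rewrite mnmwiden_widen.
Qed.

Lemma hshift_Sq m s D k (p : Pol m) :
  homogeneous_shift s D p -> homogeneous_shift s (D + k) (Sq k p).
Proof.
case/hshiftP => [->|[d -> hp]]; first by rewrite Sq0r; apply: hshift0.
by rewrite addnAC; apply/hshift_homog/Sq_homog.
Qed.

Definition hat_homogeneous m s D (u : hatP m) :=
  homogeneous_shift s D u.1 /\ homogeneous_shift s.+1 D u.2.

Lemma hat_homogeneous_Sq m s D k (u : hatP m) :
  hat_homogeneous s D u -> hat_homogeneous s (D + k) (hat_Sq k u).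
Proof.
case=> h1 h2; split; first exact: hshift_Sq.
apply: hshiftD; first exact: hshift_Sq.
case/hshiftP: h1 => [->|[d -> hp]].
  by rewrite big1 => [|j _]; [apply: hshift0 | rewrite Sq0r mwiden0 mul0r].
rewrite big_nat; apply: hshift_sum => j /andP[j0 jk].
have -> : (d + s + k = (d + (k - j) + j.-1) + s.+1)%N by lia.
apply/hshift_homog/dhomogM; first exact/mwiden_homog/Sq_homog.
by rewrite -[X in X.-homog]mul1n; apply: dhomogMn; rewrite dhomogX /= mdeg1.
Qed.
End Degrees.

Lemma act_homogeneous (V : lmodType F2) (sq : nat -> V -> V) (H : nat -> V -> Prop) D d a v :
  adem_module sq -> (forall D k v, H D v -> H (D + k)%N (sq k v)) ->
  (forall D, H D 0) -> (forall D c u v, H D u -> H D v -> H D (c *: u + v)) ->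
  homogeneous_op d a -> H D v -> H (D + d)%N (act sq a v).
Proof.
move=> ad Hsq H0 Hl [x xd ->] Hv; rewrite (act_pi ad) /free_act big_seq.
apply: (big_ind (H (D + d)%N)) => // [u u' Hu Hu'|w wx].
  by rewrite -[u]scale1r; apply: Hl.
rewrite -[_ *: _]addr0; apply: Hl => //; rewrite -(xd w); last by rewrite monalg.mcoeff_neq0.
elim: (fmonom_val w) => [|k s IH] /=; first by rewrite addn0.
by rewrite addnCA addnC; apply: Hsq.
Qed.

Lemma e1_homogeneous m s D d a (p : Pol m) : homogeneous_op d a ->
  homogeneous_shift s D p -> homogeneous_shift s.+1 (D + d) (e1_cocycle a p).
Proof.
move=> ad hp; have [_ //] : hat_homogeneous s (D + d) (act (@hat_Sq m) a (p, 0)).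
apply: (@act_homogeneous _ _ (@hat_homogeneous m s)) ad _ => //.
- exact: hat_adem.
- by move=> D' k v; apply: hat_homogeneous_Sq.
- by move=> D'; split; apply: hshift0.
- by move=> D' c u v [? ?] [? ?]; split; apply: hshift_lin.
by split=> //; apply: hshift0.
Qed.

Lemma e_seq_homogeneous m l (e : seq nat) : size l = m -> size e = m ->
  (forall i, (i < m)%N -> homogeneous_op (nth 0%N e i) (nth 0 l i)) ->
  homogeneous_shift m (sumn e) (e_seq m l).
Proof.
elim: m l e => [|m IH] l e.
  case: e => // _ _ _ w; rewrite [e_seq _ _](_ : _ = 1) // mcoeff1.
  by case: (w =P 0%MM) => [-> _|_]; rewrite ?mdeg0 ?eqxx.
case: l e => [|a l] [|d e] // [lm] [em] ha.
rewrite -[e_seq _ _]/(e1_cocycle a (e_seq m l)) [sumn _]/= addnC.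
apply: e1_homogeneous; first exact: (ha 0%N).
by apply: IH => // i im; apply: (ha i.+1).
Qed.

(** * Linear substitutions *)

Section LinearSubstitution.
Variables (m : nat) (R : comNzRingType).
Implicit Types (g h : 'M[R]_m) (p q : mpoly.mpoly m R).

(** Over any ring, since matrices with entries in a larger field are substituted later; locked so
    that goals do not unfold into tuples. *)
Definition mx_subst g : mpoly.mpoly m R -> mpoly.mpoly m R :=
  locked (comp_mpoly [tuple \sum_i g i j *: @mpolyX m R U_(i) | j < m]).

Lemma mx_substE g p :
  mx_subst g p = p \mPo [tuple \sum_i g i j *: @mpolyX m R U_(i) | j < m].
Proof. by rewrite /mx_subst -lock. Qed.

Lemma mx_substD g : {morph mx_subst g : p q / p + q}.
Proof. by move=> p q; rewrite !mx_substE; apply: comp_mpolyD. Qed.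
Lemma mx_subst0 g : mx_subst g 0 = 0.
Proof. by rewrite mx_substE; apply: comp_mpoly0. Qed.
Lemma mx_substM g : {morph mx_subst g : p q / p * q}.
Proof. by move=> p q; rewrite !mx_substE rmorphM. Qed.
Lemma mx_substZ g c p : mx_subst g (c *: p) = c *: mx_subst g p.
Proof. by rewrite !mx_substE; apply: comp_mpolyZ. Qed.
Lemma mx_subst_linear g : linear (mx_subst g).
Proof. by move=> c p q; rewrite mx_substD mx_substZ. Qed.
Lemma mx_substC g c : mx_subst g c%:MP_[m] = c%:MP_[m].
Proof. by rewrite mx_substE; apply: comp_mpolyC. Qed.
Lemma mx_subst1 g : mx_subst g 1 = 1.
Proof. exact: mx_substC. Qed.
Lemma mx_substXn g p n : mx_subst g (p ^+ n) = mx_subst g p ^+ n.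
Proof. by elim: n => [|n IH]; rewrite ?expr0 ?mx_subst1 // !exprS mx_substM IH. Qed.
Lemma mx_substX g i : mx_subst g 'X_i = \sum_j g j i *: 'X_j.
Proof. by rewrite mx_substE comp_mpolyXU -tnth_nth tnth_mktuple. Qed.

Lemma mx_subst_comp g h p : mx_subst (g *m h) p = mx_subst g (mx_subst h p).
Proof.
elim/mpoly_mulX_ind: p => [p q IHp IHq|c p IH||i p IH].
- by rewrite !mx_substD IHp IHq.
- by rewrite !mx_substZ IH.
- by rewrite !mx_subst1.
rewrite (mx_substM (g *m h)) (mx_substM h) (mx_substM g) IH; congr (_ * _).
rewrite !mx_substX.
rewrite (big_morph _ (mx_substD g) (mx_subst0 g)).
under [RHS]eq_bigr do rewrite mx_substZ mx_substX scaler_sumr.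
rewrite exchange_big; apply: eq_bigr => j _; rewrite mxE scaler_suml.
by apply: eq_bigr => k _; rewrite scalerA mulrC.
Qed.

Lemma mx_subst_id p : mx_subst 1%:M p = p.
Proof.
elim/mpoly_mulX_ind: p => [p q IHp IHq|c p IH||i p IH].
- by rewrite mx_substD IHp IHq.
- by rewrite mx_substZ IH.
- by rewrite mx_subst1.
rewrite mx_substM IH mx_substX (bigD1 i) //= big1 => [|j ji].
  by rewrite mxE eqxx scale1r addr0.
by rewrite mxE (negbTE ji) scale0r.
Qed.

Lemma mx_subst_homog g d p : p \is d.-homog -> mx_subst g p \is d.-homog.
Proof.
move=> hp; rewrite [p]mpolyE (big_morph _ (mx_substD g) (mx_subst0 g)) big_seq.
apply: rpred_sum => w wp; rewrite mx_substZ; apply: dhomogZ.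
have <- : mdeg w = d := dhomog_mf hp wp; elim/mnm_ind: w {wp} => [|i w IH].
  by rewrite mdeg0 mpolyX0 mx_subst1 dhomog1.
rewrite mpolyXD mx_substM mdegD mdeg1; apply: dhomogM IH; rewrite mx_substX.
by apply: rpred_sum => j _; apply: dhomogZ; rewrite dhomogX /= mdeg1.
Qed.
End LinearSubstitution.

Section SubstitutionSq.
Variable m : nat.
Implicit Types (g h : 'M[F2]_m) (p q : Pol m).

Lemma linear_substitutionE g p : linear_substitution g p = mx_subst g p.
Proof. by rewrite mx_substE. Qed.

Lemma F2_sqr (c : F2) : c ^+ 2 = c.
Proof. by case: (F2_case c) => ->; rewrite ?expr0n ?expr1n. Qed.

Lemma Pol_sqrD p q : (p + q) ^+ 2 = p ^+ 2 + q ^+ 2.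
Proof. by rewrite sqrrD mulrnF2 addr0. Qed.

Lemma total_Sq_linear_form (c : 'I_m -> F2) (x := \sum_j c j *: 'X_j : Pol m) :
  total_Sq x = x%:P + (x ^+ 2)%:P * 'X.
Proof.
rewrite total_SqE raddf_sum /=.
have -> : x ^+ 2 = \sum_j c j *: 'X_j ^+ 2.
  rewrite /x (big_morph (fun p : Pol m => p ^+ 2) Pol_sqrD (expr0n _ 2)).
  by apply: eq_bigr => j _; rewrite exprZn F2_sqr.
rewrite /x !rmorph_sum /= mulr_suml -big_split /=; apply: eq_bigr => j _.
rewrite total_squareZ total_squareX mulrDr mulrA -!polyCM !mul_mpolyC //.
Qed.

Lemma Sq_subst g k p : Sq k (mx_subst g p) = mx_subst g (Sq k p).
Proof.
rewrite !mx_substE /Sq !total_SqE.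
rewrite (@total_square_subst F2 m m (comp_mpoly _ : {rmorphism Pol m -> Pol m})) /=.
- by rewrite coef_map.
- by move=> c; rewrite comp_mpolyC.
- by move=> i; rewrite comp_mpolyXU -tnth_nth tnth_mktuple -total_SqE total_Sq_linear_form.
Qed.

Lemma act_subst g a p : act (@Sq m) a (mx_subst g p) = mx_subst g (act (@Sq m) a p).
Proof.
by apply/esym/(act_equivariant (@mx_subst_linear m F2 g)) => k q; rewrite Sq_subst.
Qed.

Lemma hshift_subst g s D p : homogeneous_shift s D p -> homogeneous_shift s D (mx_subst g p).
Proof.
case/hshiftP => [->|[d -> hp]]; first by rewrite mx_subst0; apply: hshift0.
exact/hshift_homog/mx_subst_homog.
Qed.
End SubstitutionSq.

Lemma steenrod_ind (P : steenrod -> Prop) :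
  P 0 -> (forall c a b, P a -> P b -> P (c *: a + b)) -> (forall w, P (word w)) ->
  forall a, P a.
Proof.
move=> P0 Pl Pw a; rewrite -[a]reprK; move: (repr a) => x.
have Psum (s : seq {fmonom nat}) : P (piA (\sum_(w <- s) monalg.mcoeff w x *: << w >>)).
  elim: s => [|[w] s IH].
    rewrite big_nil -[X in piA X](scale0r (0 : free_steenrod)) (span_quotZ _ 0 0).
    by rewrite -[span_quot_scale _ _]/(0 *: (piA 0 : steenrod)) scale0r.
  rewrite big_cons (span_quotD _ (_ *: _)) (span_quotZ _ _ << _ >>).
  exact: (Pl _ (word w) (piA _) (Pw w) IH).
suff -> : x = \sum_(w <- monalg.msupp x) monalg.mcoeff w x *: << w >> by [].
by rewrite [LHS]monalg.monalgE; apply: eq_bigr => w _; apply: malgU_scale.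
Qed.

Lemma word_homogeneous w : homogeneous_op (sumn w) (word w).
Proof.
exists (<< FMonom w >>) => // w'; rewrite monalg.mcoeffU.
by case: (FMonom w =P w') => [<- //|_]; rewrite mulr0n eqxx.
Qed.

Lemma augmentation_word w : augmentation (word w) = (sumn w == 0%N)%:R.
Proof.
rewrite /augmentation (act_word F2_adem); elim: w => //= k w IH.
by rewrite /F2_Sq addn_eq0; case: eqP.
Qed.

(** * Primitive forms and cochains with values in polynomials *)

Section Primitives.
Variables (m n : nat).

Lemma primitive_linear f : f \in @primitive m n -> linear f.
Proof. by case/asboolP. Qed.

(** A word of zeros is the identity and any other word has positive degree, so under a primitive
    form an operation becomes its augmentation. *)
Lemma primitive_act f a p : f \in @primitive m n ->
  f (act (@Sq m) a p) = augmentation a * f p.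
Proof.
move=> fP; have fl := primitive_linear fP; elim/steenrod_ind: a => [|c a b IHa IHb|w].
- rewrite (act0l (Pol_adem m)) (lin0 fl).
  by rewrite /augmentation (act0l F2_adem) mul0r.
- rewrite (act_linearl (Pol_adem m)) fl IHa IHb augmentation_linear mulrDl.
  by rewrite -mulrA.
rewrite augmentation_word; case: eqP => [w0|/eqP w0].
  rewrite mul1r (act_word (Pol_adem m)); congr f.
  by elim: w w0 => //= k w IH /eqP; rewrite addn_eq0 => /andP[/eqP -> /eqP /IH ->]; rewrite Sq0.
rewrite mul0r; case/asboolP: fP => _ _; apply; last exact: word_homogeneous.
by rewrite lt0n.
Qed.

Lemma primitive_degree f D (p : Pol m) : f \in @primitive m n -> homogeneous_shift m D p ->
  D <> (m + n)%N -> f p = 0.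
Proof.
move=> fP hp Dn; have fl := primitive_linear fP; case/asboolP: fP => _ fd _.
rewrite [p]mpolyE (lin_sum fl) big_seq big1 // => w wp; rewrite (linZ fl) fd ?scaler0 // => wn.
by apply: Dn; rewrite -(hp w) ?wn 1?addnC // -mcoeff_msupp.
Qed.

Lemma primitive_subst f g : f \in @primitive m n -> (f \o mx_subst g) \in @primitive m n.
Proof.
move=> fP; have fl := primitive_linear fP; apply/asboolP; split.
- by move=> c p q /=; rewrite mx_subst_linear fl.
- move=> w wn /=; case/asboolP: fP => _ fd _.
  have /dhomogP hp : mx_subst g 'X_[w] \is (mdeg w).-homog.
    by apply: mx_subst_homog; rewrite dhomogX.
  rewrite [mx_subst _ _]mpolyE (lin_sum fl) big_seq big1 // => w' /hp w'w.
  by rewrite (linZ fl) fd ?scaler0 // w'w.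
by move=> d a p d0 ad /=; rewrite -act_subst; case/asboolP: fP => _ _ /(_ d a _ d0 ad).
Qed.
End Primitives.

Lemma eq_bar_diff (V : lmodType F2) (phi phi' : seq steenrod -> V) l :
  (forall s, (size s).+1 = size l -> phi s = phi' s) -> bar_diff phi l = bar_diff phi' l.
Proof.
case: l => [|a r] E.
  rewrite /bar_diff /bar_left !add0r /= /augmentation (act0l F2_adem).
  by rewrite !scale0r.
rewrite /bar_diff /bar_left (eq_merges E) (E r) // (E (take _ _)) // size_take.
by rewrite /= ltnSn.
Qed.

Lemma take_belast T (a : T) r : take (size r) (a :: r) = belast a r.
Proof. by rewrite lastI -cats1 take_size_cat // size_belast. Qed.

(** The bar differential for cochains with values in a left module: the first face acts on the
    value. *)
Definition module_bar_diff n (B : seq steenrod -> Pol n) a r : Pol n :=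
  act (@Sq n) a (B r) + merges B (a :: r) + augmentation (last a r) *: B (belast a r).

(** By [primitive_act] the first face turns into an augmentation, so composition with a primitive
    form is a cochain map. *)
Lemma bar_diff_primitive m n f (B : seq steenrod -> Pol m) a r : f \in @primitive m n ->
  bar_diff (fun l => f (B l) : F2^o) (a :: r) = f (module_bar_diff B a r).
Proof.
move=> fP; have fl := primitive_linear fP.
rewrite /bar_diff /bar_left /module_bar_diff (linD fl) (linD fl) (linZ fl) (primitive_act _ _ fP).
by rewrite (lin_merges _ _ fl) /= take_belast.
Qed.

Lemma module_bar_diff_e_seq m a r : size r = m -> module_bar_diff (e_seq m) a r = 0.
Proof.
move=> rm; rewrite /module_bar_diff merges_e_seq // addrA addF2 add0r.
exact: addF2.
Qed.

Lemma mul_linear m (c : Pol m) : linear (fun p => c * p).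
Proof. by move=> k p q; rewrite mulrDr scalerAr. Qed.

Lemma act_mul_Frobenius m N (i : 'I_m) a (p : Pol m) : (letter_bound a <= 2 ^ N)%N ->
  act (@Sq m) a ('X_i ^+ (2 ^ N) * p) = 'X_i ^+ (2 ^ N) * act (@Sq m) a p.
Proof.
move=> aN; apply/esym/(act_equivariant_bounded _ (@mul_linear m _) aN) => k q kN.
by rewrite (Sq_mul_Frobenius _ (total_Sq_var i) kN).
Qed.

(** * Multiplication by an old variable, and divisibility of cocycle values *)

Section HatMultiplication.
Variables (m : nat) (i : 'I_m).
Local Notation x := ('X_i : Pol m).
Local Notation y := ('X_(widen_ord (leqnSn m) i) : Pol m.+1).

Definition hat_mul n (u : hatP m) : hatP m := (x ^+ n * u.1, y ^+ n * u.2).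

Lemma hat_mul_linear n : linear (hat_mul n).
Proof. by move=> c u v; congr (_, _); exact: mul_linear. Qed.

Lemma hat_mul_fst n u : (hat_mul n u).1 = x ^+ n * u.1. Proof. by []. Qed.
Lemma hat_mul_snd n u : (hat_mul n u).2 = y ^+ n * u.2. Proof. by []. Qed.

Lemma hat_SqE k (u : hatP m) : hat_Sq k u = (Sq k u.1,
  Sq k u.2 + \sum_(1 <= j < k.+1) mwiden (Sq (k - j) u.1) * 'X_ord_max ^+ j.-1).
Proof. by []. Qed.

Lemma mwidenXn n : mwiden (x ^+ n) = y ^+ n.
Proof. by elim: n => [|n IH]; rewrite ?expr0 ?mwiden1 // !exprS mwidenM IH mwiden_var. Qed.

Lemma hat_mul_Sq N k u : (k < 2 ^ N)%N ->
  hat_mul (2 ^ N) (hat_Sq k u) = hat_Sq k (hat_mul (2 ^ N) u).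
Proof.
move=> kN; rewrite [RHS]hat_SqE hat_mul_fst hat_mul_snd.
rewrite (Sq_mul_Frobenius _ (total_Sq_var i) kN) (Sq_mul_Frobenius _ (total_Sq_var _) kN).
rewrite /hat_mul hat_SqE; congr (_, _); rewrite [LHS]mulrDr; congr (_ + _).
rewrite mulr_sumr big_nat [RHS]big_nat; apply: eq_bigr => j /andP[j0 jk].
have jN : (k - j < 2 ^ N)%N by apply: leq_ltn_trans (leq_subr _ _) kN.
by rewrite (Sq_mul_Frobenius _ (total_Sq_var i) jN) mwidenM mwidenXn mulrA.
Qed.

Lemma e1_mul_Frobenius N a p : (letter_bound a <= 2 ^ N)%N ->
  e1_cocycle a (x ^+ (2 ^ N) * p) = y ^+ (2 ^ N) * e1_cocycle a p.
Proof.
move=> aN; have := act_equivariant_bounded (p, 0) (hat_mul_linear (2 ^ N)) aN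
  (fun k u kn => hat_mul_Sq u kn).
move=> /(congr1 snd); rewrite hat_mul_snd /hat_mul mulr0.
by move=> ->.
Qed.

Lemma e1_mul_Frobenius_exp N a p c : (letter_bound a <= 2 ^ N)%N ->
  e1_cocycle a (x ^+ (2 ^ N * c) * p) = y ^+ (2 ^ N * c) * e1_cocycle a p.
Proof.
move=> aN; elim: c => [|c IH]; first by rewrite muln0 !expr0 !mul1r.
by rewrite mulnS !exprD -mulrA (e1_mul_Frobenius _ aN) IH mulrA.
Qed.

(** Multiples of $x_i^{2^N-1}$ are stable under $Sq^k$ for $k<2^N$ by [Sq_mul_inverse]: operations
    do not worsen a simple pole in $x_i$. *)
Lemma e1_mul_divisible N a p : (letter_bound a <= 2 ^ N)%N ->
  exists h, e1_cocycle a (x ^+ (2 ^ N).-1 * p) = y ^+ (2 ^ N).-1 * h.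
Proof.
move=> aN; set M1 := (2 ^ N).-1.
pose S := fun u => exists v : hatP m, u = hat_mul M1 v.
suff [v E] : S (act (@hat_Sq m) a (hat_mul M1 (p, 0))).
  exists v.2; move/(congr1 snd): E; rewrite hat_mul_snd => <-.
  by rewrite /e1_cocycle /hat_mul mulr0.
have S0 : S (hat_mul M1 (p, 0)) by exists (p, 0).
have Slin c u v : S u -> S v -> S (c *: u + v).
  by move=> [u' ->] [v' ->]; exists (c *: u' + v'); rewrite hat_mul_linear.
have Ssq k u : (k < 2 ^ N)%N -> S u -> S (hat_Sq k u).
  move=> kN [v ->]; rewrite /M1.
  exists (\sum_(0 <= j < k.+1) x ^+ j * Sq (k - j) v.1,
    \sum_(0 <= j < k.+1) y ^+ j * Sq (k - j) v.2 +
    \sum_(1 <= j < k.+1) mwiden (\sum_(0 <= j' < (k - j).+1) x ^+ j' * Sq (k - j - j') v.1)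
      * 'X_ord_max ^+ j.-1).
  have mulE n (i' : 'I_n) (q : Pol n) k' : (k' < 2 ^ N)%N ->
      Sq k' ('X_i' ^+ M1 * q) = 'X_i' ^+ M1 * \sum_(0 <= j < k'.+1) 'X_i' ^+ j * Sq (k' - j) q.
    move=> kN'; rewrite (Sq_mul_inverse _ _ kN') mulr_sumr; apply: eq_bigr => j _.
    by rewrite mulrA -exprD.
  rewrite hat_SqE hat_mul_fst hat_mul_snd !mulE // /hat_mul; congr (_, _).
  rewrite [RHS]mulrDr; congr (_ + _); rewrite mulr_sumr; apply: eq_bigr => j _.
  rewrite mulE; last exact: leq_ltn_trans (leq_subr _ _) kN.
  by rewrite mwidenM mwidenXn mulrA.
rewrite /act /free_act big_seq.
apply: (big_ind S) => [|u v Su Sv|w wa].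
- by exists 0; rewrite /hat_mul !mulr0.
- by rewrite -[u]scale1r; apply: Slin.
rewrite -[_ *: _]addr0; apply: Slin; last by exists 0; rewrite /hat_mul !mulr0.
elim: (fmonom_val w) (letter_boundP aN wa) => //= k s IH /andP[kN sN].
exact/Ssq/IH.
Qed.
End HatMultiplication.

Lemma division_linear n (x : Pol n) (V : lmodType F2) (D F : V -> Pol n) : x != 0 ->
  linear F -> (forall v, x * D v = F v) -> linear D.
Proof.
move=> x0 Fl E c u v; apply: (mulfI x0).
by rewrite E Fl mulrDr -scalerAr !E.
Qed.

(** * Transvections and divided differences *)

Section Transvection.
Variable n : nat.
Implicit Types (i j l : 'I_n) (p q : Pol n).

(** The substitution $x_i\mapsto x_i+x_j$. Columns hold the images of the variables, hence the order
    [j i]. *)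
Definition transvection i j : 'M[F2]_n := 1%:M + delta_mx j i.

Lemma transvectionX i j l : mx_subst (transvection i j) 'X_l =
  'X_l + (if l == i then 'X_j else 0).
Proof.
rewrite mx_substX; under eq_bigr do rewrite !mxE scalerDl.
rewrite big_split /= (bigD1 l) //= eqxx scale1r big1 ?addr0 => [|k /negbTE ->]; last first.
  by rewrite scale0r.
congr (_ + _); rewrite (bigD1 j) //= eqxx big1 ?addr0 => [|k /negbTE ->]; last first.
  by rewrite scale0r.
by case: eqP; rewrite ?scale1r ?scale0r.
Qed.

Lemma transvection_fixed i j l : l != i -> mx_subst (transvection i j) 'X_l = 'X_l.
Proof. by move=> li; rewrite transvectionX (negbTE li) addr0. Qed.

(** Modulo $x_j$ the substitution is the identity. *)
Lemma difference_quotient_ex i j q : exists d, 'X_j * d = q + mx_subst (transvection i j) q.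
Proof.
elim/mpoly_mulX_ind: q => [p q [d dE] [d' d'E]|c p [d dE]||l p [d dE]].
- by exists (d + d'); rewrite mulrDr dE d'E mx_substD addrACA.
- by exists (c *: d); rewrite -scalerAr dE mx_substZ scalerDr.
- by exists 0; rewrite mulr0 mx_subst1 addF2.
exists ('X_l * d + (if l == i then mx_subst (transvection i j) p else 0)).
rewrite mulrDr mulrCA dE mx_substM transvectionX mulrDl mulrDr -addrA; congr (_ + (_ + _)).
by case: eqP; rewrite ?mul0r ?mulr0.
Qed.

Definition difference_quotient i j q : Pol n := projT1 (cid (difference_quotient_ex i j q)).

Lemma difference_quotientE i j q :
  'X_j * difference_quotient i j q = q + mx_subst (transvection i j) q.
Proof. exact: projT2 (cid (difference_quotient_ex i j q)). Qed.

Lemma difference_quotient_linear i j : linear (difference_quotient i j).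
Proof.
apply: (division_linear (varX_neq0 j) _ (difference_quotientE i j)) => c p q.
by rewrite mx_subst_linear scalerDr addrACA.
Qed.

Lemma hshift_mulX_inv s D k l p :
  homogeneous_shift s D ('X_l ^+ k * p) -> homogeneous_shift (s + k) D p.
Proof.
move=> hp w pw; rewrite -(hp (w + U_(l) *+ k)%MM).
  by rewrite mdegD mdegMn mdeg1 mul1n addnA addnAC.
by rewrite mpolyXn mulrC addmC mcoeffMX.
Qed.
End Transvection.

Definition homogeneous_cochain n k (B : seq steenrod -> Pol n) := forall l (e : seq nat),
  size l = k -> size e = k ->
  (forall i, (i < k)%N -> homogeneous_op (nth 0%N e i) (nth 0 l i)) ->
  homogeneous_shift n (sumn e) (B l).

(* Invariance of the class of [e_n] under [g]: the cocycle changes by a coboundary. *)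
Definition e_invariant n (g : 'M[F2]_n.+1) := exists B : seq steenrod -> Pol n.+1,
  [/\ multilin B n, homogeneous_cochain n B &
   forall a r, size r = n ->
     mx_subst g (e_seq n.+1 (a :: r)) + e_seq n.+1 (a :: r) = module_bar_diff B a r].

(** * Invariance of the class of $e_n$ under adjacent transvections *)

Section WidenInvariance.
Variables (n : nat) (i j : 'I_n.+1).
Local Notation tau := (mx_subst (transvection i j)).
Local Notation tau' := (mx_subst (transvection (widen_ord (leqnSn n.+1) i) (widen_ord (leqnSn n.+1) j))).

Lemma transvection_mwiden p : tau' (mwiden p) = mwiden (tau p).
Proof.
elim/mpoly_mulX_ind: p => [p q IHp IHq|c p IH||l p IH].
- by rewrite mwidenD !mx_substD mwidenD; congr (_ + _); [exact: IHp | exact: IHq].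
- by rewrite mwidenZ !mx_substZ mwidenZ; congr (_ *: _); exact: IH.
- by rewrite mwiden1 !mx_subst1 mwiden1.
rewrite mwidenM (mx_substM _ (mwiden _)) (mx_substM _ 'X_l) mwidenM; congr (_ * _); last exact: IH.
rewrite mwiden_var !transvectionX mwidenD mwiden_var; congr (_ + _).
rewrite -val_eqE /= -[(_ == _ :> nat)]/(l == i).
by case: eqP; rewrite ?mwiden_var ?mwiden0.
Qed.

Lemma transvection_last : tau' 'X_ord_max = 'X_ord_max.
Proof.
apply: transvection_fixed; rewrite -val_eqE /=.
by rewrite neq_ltn (ltn_ord i) orbT.
Qed.

Lemma transvection_e1 a p : tau' (e1_cocycle a p) = e1_cocycle a (tau p).
Proof.
pose phi (u : hatP n.+1) : hatP n.+1 := (tau u.1, tau' u.2).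
have phil : linear phi by move=> c u v; congr (_, _); exact: mx_subst_linear.
have phi2 u : (phi u).2 = tau' u.2 by [].
have E k u : phi (hat_Sq k u) = hat_Sq k (phi u).
  rewrite /phi !hat_SqE; congr (_, _); first by rewrite Sq_subst.
  rewrite /fst /snd mx_substD Sq_subst; congr (_ + _).
  rewrite (lin_sum (@mx_subst_linear _ _ _)); apply: eq_bigr => l _.
  by rewrite mx_substM mx_substXn transvection_last transvection_mwiden Sq_subst.
have := congr1 snd (act_equivariant phil a (p, 0) E); rewrite phi2 => ->.
by rewrite /e1_cocycle /phi /fst /snd (lin0 (@mx_subst_linear _ _ _)).
Qed.

(** The new last variable is fixed, so the transvection commutes with the outermost [e1_cocycle];
    applying that operator to the bounding cochain bounds the new change. *)
Lemma e_invariant_widen : e_invariant (transvection i j) ->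
  e_invariant (transvection (widen_ord (leqnSn n.+1) i) (widen_ord (leqnSn n.+1) j)).
Proof.
case=> B [Bl Bh BE]; pose B' l := e1_cocycle (head 0 l) (B (behead l)).
have B'E a s : B' (a :: s) = e1_cocycle a (B s) by [].
exists B'; split.
- move=> [|c s] t k x y [st]; first exact: e1_cocycle_linearl.
  by rewrite !cat_cons !B'E (Bl _ _ _ _ _ st) (e1_cocycle_linear c).
- move=> [|a l] [|d e] // [lm] [em] ha; rewrite B'E [sumn _]/= addnC.
  apply: e1_homogeneous; first exact: (ha 0%N).
  by apply: Bh => // k kn; apply: (ha k.+1).
move=> a [|b r] // [rn].
rewrite e_seqS transvection_e1 -(linD (e1_cocycle_linear a)) (BE _ _ rn).
rewrite /module_bar_diff [last _ _]/= [belast _ _]/= merges_cons !B'E e1_cocycleM.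
rewrite (lin_merges B (b :: r) (e1_cocycle_linear a)).
rewrite !(linD (e1_cocycle_linear a)) (linZ (e1_cocycle_linear a)).
congr (_ + _).
move: (e1_cocycle a (act _ _ _)) (act _ a _) (e1_cocycle a (merges _ _)) => x y w.
by rewrite (addrC x y) -(addrA y x) (addrA y y) addF2 add0r.
Qed.
End WidenInvariance.

(** A substitution of the last two variables concerns the two outermost factors of the cocycle. A
    one-entry cochain [beta] bounding their change suffices: it is evaluated on the inner factor,
    whose own cocycle identity supplies the remaining faces. *)
Lemma e_invariant_base k (g : 'M[F2]_k.+2) (beta : steenrod -> Pol k -> Pol k.+2) :
  (forall a, linear (beta a)) ->
  (forall c a b p, beta (c *: a + b) p = c *: beta a p + beta b p) ->
  (forall D d a p, homogeneous_op d a -> homogeneous_shift k D p ->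
     homogeneous_shift k.+2 (D + d) (beta a p)) ->
  (forall a b p, mx_subst g (e1_cocycle a (e1_cocycle b p)) + e1_cocycle a (e1_cocycle b p) =
     act (@Sq k.+2) a (beta b p) + beta (a * b) p + beta a (act (@Sq k) b p)) ->
  e_invariant g.
Proof.
move=> bl bll bh bE; pose B l := beta (head 0 l) (e_seq k (behead l)).
have BE a s : B (a :: s) = beta a (e_seq k s) by [].
exists B; split.
- move=> [|c s] t z x y [st]; first exact: bll.
  by rewrite !cat_cons !BE (e_seq_multilin _ _ _ st) bl.
- move=> [|a l] [|d e] // [lm] [em] ha; rewrite BE [sumn _]/= addnC.
  apply: bh; first exact: (ha 0%N).
  by apply: e_seq_homogeneous => // i ik; apply: (ha i.+1).
move=> a [|b r] // [rk]; rewrite !e_seqS bE /module_bar_diff merges_cons !BE.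
rewrite (lin_merges (e_seq k) (b :: r) (bl a)) (merges_e_seq _ rk) !(linD (bl a)) (linZ (bl a)).
rewrite [last a _]/= -!addrA; congr (_ + (_ + _)).
rewrite -[LHS]addr0; congr (_ + _).
exact/esym/addF2.
Qed.

Lemma leq_exp2_self n : (n <= 2 ^ n)%N.
Proof. by rewrite ltnW // ltn_expl. Qed.

Lemma subst_fixed_mul n (g : 'M[F2]_n) M (x u : Pol n) : mx_subst g x = x ->
  mx_subst g (x ^+ M * u) = x ^+ M * mx_subst g u.
Proof. by move=> xE; rewrite mx_substM mx_substXn xE. Qed.

Lemma subst_fixed_pair n (g : 'M[F2]_n) a M (x u v : Pol n) : mx_subst g x = x ->
  mx_subst g (act (@Sq n) a (x ^+ M * u) + x ^+ M * v) =
  act (@Sq n) a (x ^+ M * mx_subst g u) + x ^+ M * mx_subst g v.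
Proof. by move=> xE; rewrite mx_substD -act_subst !(subst_fixed_mul _ _ xE). Qed.

Lemma act_difference n a M (x u u' v v' du dv : Pol n) : (0 < M)%N ->
  x * du = u + u' -> x * dv = v + v' ->
  (forall r, act (@Sq n) a (x ^+ M * r) = x ^+ M * act (@Sq n) a r) ->
  act (@Sq n) a (x ^+ M.-1 * u) + x ^+ M.-1 * v +
    (act (@Sq n) a (x ^+ M.-1 * u') + x ^+ M.-1 * v') =
  x ^+ M * (act (@Sq n) a du + dv).
Proof.
move=> M0 uE vE aM.
have XM r : x ^+ M.-1 * (x * r) = x ^+ M * r by rewrite mulrA -exprSr prednK.
have A : act (@Sq n) a (x ^+ M.-1 * u) + act (@Sq n) a (x ^+ M.-1 * u') =
    x ^+ M * act (@Sq n) a du.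
  by rewrite -(actD (Pol_adem n)) -mulrDr -uE (XM du) aM.
have B : x ^+ M.-1 * v + x ^+ M.-1 * v' = x ^+ M * dv by rewrite -mulrDr -vE (XM dv).
by rewrite (mulrDr (x ^+ M)) -A -B; exact: addrACA.
Qed.

Lemma six_swap (V : zmodType) (x y z u v w : V) :
  x + y + z + (u + v + w) = u + x + (v + y) + (w + z).
Proof. by rewrite addrACA (addrACA x) (addrC z) (addrC x) (addrC y). Qed.

Section FirstTransvection.
Variable k : nat.
Local Notation i := (widen_ord (leqnSn k.+1) ord_max).
Local Notation j := (@ord_max k.+1).
Local Notation tau := (mx_subst (transvection i j)).
Local Notation D := (@difference_quotient k.+2 i j).

Let ji : j != i.
Proof. by rewrite -val_eqE /= neq_ltn ltnSn orbT. Qed.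

(** With $x$ the last variable, the outer factor is $a(qx^{-1})+(aq)x^{-1}$ for $q$ the inner one,
    and $\tau$ fixes $x$. Its change is therefore $aD(q)+D(aq)$ with the polynomial $D(q)=(q+\tau
    q)/x$; [e1_cocycleM] rewrites $aq$. *)
Definition beta1 a (p : Pol k) : Pol k.+2 := D (mwiden (e1_cocycle a p)).

Lemma Dw_linear : linear (fun q : Pol k.+1 => D (mwiden q)).
Proof. by move=> c p q; rewrite mwidenD mwidenZ difference_quotient_linear. Qed.

Lemma e1_difference N a (q : Pol k.+1) : (letter_bound a <= 2 ^ N)%N ->
  'X_j ^+ (2 ^ N) * (e1_cocycle a q + tau (e1_cocycle a q)) =
  'X_j ^+ (2 ^ N) * (act (@Sq k.+2) a (D (mwiden q)) + D (mwiden (act (@Sq k.+1) a q))).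
Proof.
move=> aN; set M := (2 ^ N)%N.
have M0 : (0 < M)%N by rewrite expn_gt0.
have tX : tau 'X_j = 'X_j by rewrite transvection_fixed.
have E := e1_cocycle_embed q aN.
have tE := congr1 tau E; rewrite (subst_fixed_mul _ _ tX) (subst_fixed_pair _ _ _ _ tX) in tE.
rewrite mulrDr tE E; apply: act_difference => //.
- exact: difference_quotientE.
- exact: difference_quotientE.
by move=> r; apply: act_mul_Frobenius.
Qed.

Lemma e_invariant_first : e_invariant (transvection i j).
Proof.
apply: (@e_invariant_base _ _ beta1).
- by move=> a c p q; rewrite /beta1 (e1_cocycle_linear a c p q); exact: Dw_linear.
- by move=> c a b p; rewrite /beta1 (e1_cocycle_linearl c a b p); exact: Dw_linear.
- move=> E d a p ad hp.
  have hq := e1_homogeneous ad hp.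
  have hw : homogeneous_shift k.+1 (E + d) (mwiden (e1_cocycle a p)).
    case/hshiftP: hq => [->|[e -> he]]; first by rewrite mwiden0; apply: hshift0.
    exact/hshift_homog/mwiden_homog.
  have -> : homogeneous_shift k.+2 = @homogeneous_shift k.+2 (k.+1 + 1) by rewrite addn1.
  apply: (@hshift_mulX_inv _ _ _ 1 j); rewrite expr1.
  by rewrite difference_quotientE; apply: hshiftD => //; apply: hshift_subst.
move=> a b p; have := @e1_difference (letter_bound a) a (e1_cocycle b p) (leq_exp2_self _).
move=> /(mulfI (expf_neq0 _ (varX_neq0 _))) E.
have {}E : tau (e1_cocycle a (e1_cocycle b p)) + e1_cocycle a (e1_cocycle b p) =
  act (@Sq k.+2) a (beta1 b p) + D (mwiden (act (@Sq k.+1) a (e1_cocycle b p))).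
  by rewrite addrC.
rewrite {}E -addrA; congr (_ + _).
have -> : act (@Sq k.+1) a (e1_cocycle b p) =
    e1_cocycle (a * b) p + e1_cocycle a (act (@Sq k) b p).
  by rewrite e1_cocycleM addrAC addF2 add0r.
exact: (linD Dw_linear).
Qed.
End FirstTransvection.

Section SecondTransvection.
Variable k : nat.
Local Notation i := (@ord_max k.+1).
Local Notation j := (widen_ord (leqnSn k.+1) ord_max).
Local Notation tau := (mx_subst (transvection i j)).

Let ji : j != i.
Proof. by rewrite -val_eqE /= neq_ltn ltnSn. Qed.

Let tX : tau 'X_j = 'X_j.
Proof. exact: transvection_fixed. Qed.

(* [x^-(2^N) gamma N b p] is [b] applied to [p x^-1], made a cochain in the last variable. *)
Definition gamma N b (p : Pol k) : Pol k.+2 :=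
  e1_cocycle b ('X_(@ord_max k) ^+ (2 ^ N).-1 * mwiden p).

Lemma gamma_linear N b : linear (gamma N b).
Proof.
move=> c p q; rewrite /gamma mwidenD mwidenZ mulrDr -scalerAr.
exact: (e1_cocycle_linear b).
Qed.

Lemma gamma_linearl N c a b p : gamma N (c *: a + b) p = c *: gamma N a p + gamma N b p.
Proof. exact: e1_cocycle_linearl. Qed.

Lemma gamma_le N N' b p : (letter_bound b <= 2 ^ N)%N -> (N <= N')%N ->
  gamma N' b p = 'X_j ^+ (2 ^ N' - 2 ^ N) * gamma N b p.
Proof.
move=> bN NN'; have -> : (2 ^ N' - 2 ^ N = 2 ^ N * (2 ^ (N' - N) - 1))%N.
  by rewrite mulnBr muln1 -expnD subnKC.
rewrite -(e1_mul_Frobenius_exp _ _ _ bN) mulrA -exprD; congr (e1_cocycle b (_ ^+ _ * _)).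
have N0 : (0 < 2 ^ N)%N by rewrite expn_gt0.
have NN : (2 ^ N <= 2 ^ N')%N by rewrite leq_exp2l.
by rewrite mulnBr muln1 -expnD subnKC //; lia.
Qed.

(** Once $x_j$ is inverted, the double cocycle is the coboundary of [gamma] divided by $x_j^{2^N}$.
    Only the change of that cochain under the transvection is a polynomial. *)
Lemma e1_gamma N a b p : (letter_bound a <= 2 ^ N)%N -> (letter_bound b <= 2 ^ N)%N ->
  'X_j ^+ (2 ^ N) * e1_cocycle a (e1_cocycle b p) =
  act (@Sq k.+2) a (gamma N b p) + gamma N (a * b) p + gamma N a (act (@Sq k) b p).
Proof.
move=> aN bN; rewrite -(e1_mul_Frobenius _ _ aN) (e1_cocycle_embed _ bN).
rewrite (linD (e1_cocycle_linear a)) /gamma e1_cocycleM.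
congr (_ + _); move: (e1_cocycle a _) (act _ a _) => x y.
by rewrite addrCA addF2 addr0.
Qed.

Definition gamma_difference N b p := gamma N b p + tau (gamma N b p).

(** [gamma] is $x_j^{2^N-1}h$, and $h+\tau h$ supplies the missing factor $x_j$. One [z] must serve
    every [N], because linearity in [b] compares operations with different letter bounds; raising
    [N] multiplies both sides by the same power. *)
Lemma gamma_difference_ex b p : exists z, forall N, (letter_bound b <= 2 ^ N)%N ->
  'X_j ^+ (2 ^ N) * z = gamma_difference N b p.
Proof.
pose N0 := letter_bound b; have bN0 : (letter_bound b <= 2 ^ N0)%N by apply: leq_exp2_self.
have [h hE] := e1_mul_divisible ord_max (mwiden p) bN0.
have gE : gamma N0 b p = 'X_j ^+ (2 ^ N0).-1 * h by exact: hE.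
exists (difference_quotient i j h) => N bN.
have step M M' : (letter_bound b <= 2 ^ M)%N -> (M <= M')%N ->
    gamma_difference M' b p = 'X_j ^+ (2 ^ M' - 2 ^ M) * gamma_difference M b p.
  move=> bM MM'; rewrite /gamma_difference (gamma_le _ bM MM').
  by rewrite (subst_fixed_mul _ _ tX) mulrDr.
have E0 : 'X_j ^+ (2 ^ N0) * difference_quotient i j h = gamma_difference N0 b p.
  rewrite /gamma_difference gE (subst_fixed_mul _ _ tX) -mulrDr -difference_quotientE.
  by rewrite mulrA -exprSr prednK // expn_gt0.
case: (leqP N0 N) => NN.
  rewrite (step _ _ bN0 NN) -E0 mulrA -exprD subnK // leq_exp2l //.
have le2 : (2 ^ N <= 2 ^ N0)%N by rewrite leq_exp2l // ltnW.
apply: (mulfI (expf_neq0 (2 ^ N0 - 2 ^ N) (varX_neq0 j))).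
by rewrite mulrA -exprD subnK // E0 (step _ _ bN (ltnW NN)).
Qed.

Definition beta2 b p : Pol k.+2 := projT1 (cid (gamma_difference_ex b p)).

Lemma beta2E N b p : (letter_bound b <= 2 ^ N)%N ->
  'X_j ^+ (2 ^ N) * beta2 b p = gamma_difference N b p.
Proof. by move: N; exact: projT2 (cid (gamma_difference_ex b p)). Qed.

Lemma gamma_difference_linear N b : linear (gamma_difference N b).
Proof.
move=> c p q; rewrite /gamma_difference (gamma_linear N b c p q) mx_substD mx_substZ.
by rewrite scalerDr addrACA.
Qed.

Lemma exp_bound3 a b c : exists N, [/\ (a <= 2 ^ N)%N, (b <= 2 ^ N)%N & (c <= 2 ^ N)%N].
Proof.
exists (a + b + c)%N; have le := leq_exp2_self (a + b + c).
by split; apply: leq_trans le; lia.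
Qed.

Lemma e_invariant_second : e_invariant (transvection i j).
Proof.
have X0 N : 'X_j ^+ (2 ^ N) != 0 :> Pol k.+2 by rewrite expf_neq0 // varX_neq0.
apply: (@e_invariant_base _ _ beta2).
- move=> a; apply: (division_linear (X0 (letter_bound a)) (gamma_difference_linear _ a)) => p.
  by rewrite beta2E // leq_exp2_self.
- move=> c a b p.
  have [N [aN bN cN]] := exp_bound3 (letter_bound a) (letter_bound b) (letter_bound (c *: a + b)).
  apply: (mulfI (X0 N)); rewrite (beta2E _ cN) mulrDr -scalerAr (beta2E _ aN) (beta2E _ bN).
  rewrite /gamma_difference (gamma_linearl N c a b p) mx_substD mx_substZ.
  by rewrite scalerDr addrACA.
- move=> E d a p ad hp; pose N := letter_bound a.
  have aN : (letter_bound a <= 2 ^ N)%N by apply: leq_exp2_self.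
  have N0 : (0 < 2 ^ N)%N by rewrite expn_gt0.
  have hg : homogeneous_shift k.+1 (E + (2 ^ N).-1 + d) (gamma N a p).
    apply: (e1_homogeneous ad).
    case/hshiftP: hp => [->|[e -> he]]; first by rewrite mwiden0 mulr0; apply: hshift0.
    have -> : (e + k + (2 ^ N).-1 = (2 ^ N).-1 + e + k)%N by lia.
    apply/hshift_homog/dhomogM; last exact: mwiden_homog.
    by rewrite -[X in X.-homog]mul1n; apply: dhomogMn; rewrite dhomogX /= mdeg1.
  have hgd : homogeneous_shift k.+1 (E + (2 ^ N).-1 + d) ('X_j ^+ (2 ^ N) * beta2 a p).
    by rewrite (beta2E _ aN); apply: hshiftD => //; apply: hshift_subst.
  move=> w /(hshift_mulX_inv hgd); lia.
move=> a b p.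
have [N [aN bN abN]] := exp_bound3 (letter_bound a) (letter_bound b) (letter_bound (a * b)).
apply: (mulfI (X0 N)); rewrite mulrDr -(subst_fixed_mul (2 ^ N) _ tX) (e1_gamma _ aN bN).
rewrite !mulrDr (beta2E _ abN) (beta2E _ aN) -(act_mul_Frobenius _ _ aN) (beta2E _ bN).
rewrite /gamma_difference !mx_substD -act_subst (actD (Pol_adem _)).
exact: six_swap.
Qed.
End SecondTransvection.

Lemma addF2_telescope (V : lmodType F2) (x y z : V) : x + z = x + y + (y + z).
Proof. by rewrite -addrA (addrA y) addF2 add0r. Qed.

Lemma addFF (c : F2) : c + c = 0.
Proof. exact: (addF2 (c : F2^o)). Qed.

(** * Generation of $GL_n(\mathbb F_2)$ by transvections *)

Section Elementary.
Variable n : nat.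
Implicit Types (A : 'M[F2]_n) (i j k : 'I_n).
Local Notation elementary i j := (1%:M + delta_mx i j : 'M[F2]_n).

Lemma elementary_mulE i j A r c :
  (elementary i j *m A) r c = A r c + (if r == i then A j c else 0).
Proof.
rewrite mulmxDl mul1mx mxE; congr (_ + _).
rewrite mxE (bigD1 j) //= big1 => [|l lj]; rewrite mxE ?eqxx ?andbT ?addr0.
  by case: eqP => _; rewrite ?mul1r ?mul0r.
by rewrite (negbTE lj) andbF mul0r.
Qed.

Lemma elementaryK i j A : i != j -> elementary i j *m (elementary i j *m A) = A.
Proof.
move=> ij; apply/matrixP => r c; rewrite !elementary_mulE.
by case: eqP => [->|_]; rewrite ?addr0 // eq_sym (negbTE ij) addr0 -addrA addFF addr0.
Qed.

(** The usual commutator, each factor being its own inverse over $\mathbb F_2$. *)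
Lemma elementary_commutator i j k : i != j -> j != k -> i != k ->
  elementary i j *m (elementary j k *m (elementary i j *m elementary j k)) = elementary i k.
Proof.
move=> ij jk ik; apply/matrixP => r c; rewrite !elementary_mulE !mxE.
have [ji kj ki] : [/\ j != i, k != j & k != i] by split; rewrite eq_sym.
have E := (negbTE ij, negbTE jk, negbTE ik, negbTE ji, negbTE kj, negbTE ki, eqxx).
have [->|ri] := eqVneq r i; last have [->|rj] := eqVneq r j.
- by rewrite ?E /= ?(eq_sym c k); case: (i == c); case: (j == c); case: (k == c); apply/val_inj.
- by rewrite ?E /= ?(eq_sym c k); case: (i == c); case: (j == c); case: (k == c); apply/val_inj.
by rewrite ?(negbTE ri) ?(negbTE rj) ?E /=; case: (r == c); apply/val_inj.
Qed.

(** Gaussian elimination from the left: [good k] says that the first $k$ columns are those of the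
    identity, and [clear] empties the next column by induction on its number of nonzero entries off
    the pivot. *)
Lemma GL_ind (P : 'M[F2]_n -> Prop) : P 1%:M ->
  (forall i j A, i != j -> P A -> P (elementary i j *m A)) ->
  forall A, A \in unitmx -> P A.
Proof.
move=> P1 Pe; have back i j A : i != j -> P (elementary i j *m A) -> P A.
  by move=> ij /(Pe i j _ ij); rewrite elementaryK.
have unit_elementary i j A : i != j -> A \in unitmx -> elementary i j *m A \in unitmx.
  move=> ij Au; rewrite unitmx_mul Au andbT.
  by apply: (@mulmx1_unit _ _ _ (elementary i j) _).1; rewrite -[X in _ *m X]mulmx1 elementaryK.
pose good (k : nat) (A : 'M[F2]_n) := forall r c : 'I_n, (c < k)%N -> A r c = (r == c)%:R.
suff main (d k : nat) A : (k + d = n)%N -> A \in unitmx -> good k A -> P A.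
  by move=> A Au; apply: (main n 0%N).
elim: d k A => [|d IH] k A kd Au gA.
  suff -> : A = 1%:M by [].
  by apply/matrixP => r c; rewrite mxE gA // -[k]addn0 kd.
have kn : (k < n)%N by rewrite -kd addnS ltnS leq_addr.
pose K := Ordinal kn.
have good_elementary i j B : (k <= j)%N -> good k B -> good k (elementary i j *m B).
  move=> kj gB r c ck; rewrite elementary_mulE gB //.
  case: ifP => _; last exact: addr0.
  have -> : B j c = 0; last exact: addr0.
  rewrite gB //; case: (j =P c) => // jc.
  by rewrite -jc ltnNge kj in ck.
have clear N B : B \in unitmx -> good k B -> B K K = 1 ->
    #|[set i | (i != K) && (B i K != 0)]| = N -> P B.
  elim: N B => [|N IHN] B Bu gB BK /eqP cN.
    apply: (IH k.+1) => // [|r c]; first by rewrite addSnnS.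
    rewrite ltnS leq_eqVlt => /orP[/eqP ck|]; last exact: gB.
    have -> : c = K by apply/val_inj.
    have [-> //|rK] := eqVneq r K.
    move: cN; rewrite cards_eq0 => /eqP/setP/(_ r); rewrite !inE rK /= => /negbT.
    by rewrite negbK => /eqP.
  have /card_gt0P[i] : (0 < #|[set i | (i != K) && (B i K != 0%R)]|)%N by rewrite (eqP cN).
  rewrite inE => /andP[iK Bi].
  apply: (back i K) => //; apply: IHN.
  - exact: unit_elementary.
  - exact: good_elementary.
  - by rewrite elementary_mulE eq_sym (negbTE iK) addr0.
  move: cN; rewrite (cardsD1 i) inE iK Bi /= => /eqP[<-]; apply: eq_card => r.
  rewrite !inE elementary_mulE; have [-> /=|ri /=] := eqVneq r i; last by rewrite addr0.
  have -> : B i K = 1 by case: (F2_case (B i K)) Bi => ->.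
  by rewrite BK addFF eqxx andbF.
have [AK|AK] := F2_case (A K K); last by apply: (clear _ A) => //.
have [i /andP[ik Ai]] : exists i : 'I_n, (k <= i)%N && (A i K != 0).
  case: (pickP (fun i : 'I_n => (k <= i)%N && (A i K != 0))) => [i Pi|A0]; first by exists i.
  (* If column [K] vanishes from row $k$ on, it is a combination of the first $k$ columns; [v] is
     the resulting kernel vector. *)
  pose v : 'cV[F2]_n := \col_j (if (j < k)%N then A j K else (j == K)%:R).
  have Av : A *m v = 0.
    apply/matrixP => r c; rewrite !mxE.
    have E (j : 'I_n) : A r j * v j 0 = (if (j < k)%N then (r == j)%:R * A j K else 0) +
        (j == K)%:R * A r K.
      rewrite mxE; case: ltnP => [jk|kj].
        have -> : (j == K) = false by apply/eqP => E; rewrite E ltnn in jk.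
        by rewrite gA // mul0r addr0.
      by rewrite add0r mulrC; case: eqP => [->|]; rewrite ?mul0r.
    rewrite (ord1 c) (eq_bigr _ (fun j _ => E j)) big_split /= [X in _ + X](bigD1 K) //=.
    rewrite eqxx mul1r [X in _ + (_ + X)]big1 ?addr0 => [|j /negbTE ->]; last by rewrite mul0r.
    rewrite (bigD1 r) //= eqxx mul1r big1 => [|j jr].
      case: ltnP => rk; rewrite addr0 ?addFF // add0r.
      by have := A0 r; rewrite rk /= => /negbFE/eqP.
    by case: ifP => // _; rewrite eq_sym (negbTE jr) mul0r.
  have : v K 0 = 0 by rewrite -(mulKmx Au v) Av mulmx0 mxE.
  by rewrite mxE ltnn eqxx.
have iK : K != i by apply: contraNneq Ai => <-; rewrite AK.
apply: (back K i) => //; apply: clear => //.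
- exact: unit_elementary.
- exact: good_elementary.
by rewrite elementary_mulE eqxx AK add0r; case: (F2_case (A i K)) Ai => ->.
Qed.
End Elementary.

(** Either the pair contains the last variable and one of the two explicit cochains applies, or it
    is widened from one variable fewer. *)
Lemma e_invariant_adjacent n (i j : 'I_n.+1) : j = i.+1 :> nat ->
  e_invariant (transvection i j) /\ e_invariant (transvection j i).
Proof.
elim: n i j => [|n IH] i j ji; first by have := ltn_ord j; rewrite ji.
have in1 : (i < n.+1)%N by rewrite -ltnS -ji ltn_ord.
have -> : i = widen_ord (leqnSn n.+1) (Ordinal in1) by apply/val_inj.
have [jn|jn] := eqVneq (j : nat) n.+1.
  have -> : j = ord_max by apply/val_inj.
  have -> : Ordinal in1 = ord_max by apply/val_inj => /=; apply: succn_inj; rewrite -ji.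
  by split; [exact: e_invariant_first | exact: e_invariant_second].
have jn1 : (j < n.+1)%N by rewrite ltn_neqAle jn -ltnS ltn_ord.
have -> : j = widen_ord (leqnSn n.+1) (Ordinal jn1) by apply/val_inj.
have [H1 H2] := IH (Ordinal in1) (Ordinal jn1) ji.
by split; apply: e_invariant_widen.
Qed.

Lemma bar_diffD (V : lmodType F2) (phi psi : seq steenrod -> V) l :
  bar_diff (fun s => phi s + psi s) l = bar_diff phi l + bar_diff psi l.
Proof.
rewrite /bar_diff scalerDr addrACA; congr (_ + _).
case: l => [|a r]; first exact/esym/addr0.
by rewrite /bar_left /merges big_split scalerDr addrACA.
Qed.

Definition seq_cochain n t (phi : seq steenrod -> F2^o) := multilin phi n /\ has_degree phi n t.

Lemma seq_cochainD n t phi psi : seq_cochain n t phi -> seq_cochain n t psi ->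
  seq_cochain n t (fun s => phi s + psi s).
Proof.
move=> [pl pd] [ql qd]; split=> [s r k x y st|l e ln en he et].
  by rewrite (pl _ _ _ _ _ st) (ql _ _ _ _ _ st) scalerDr addrACA.
by rewrite (pd l e) // (qd l e) // addr0.
Qed.

(** * Invariance under all of $GL$ after applying a primitive form *)

Section CoboundaryInvariance.
Variables (n N : nat).

Definition class_invariant (g : 'M[F2]_n.+1) := forall f, f \in @primitive n.+1 N ->
  exists2 b, seq_cochain n (n.+1 + N) b & forall a r, size r = n ->
    f (mx_subst g (e_seq n.+1 (a :: r))) + f (e_seq n.+1 (a :: r)) = bar_diff b (a :: r).

Lemma class_invariant1 : class_invariant 1%:M.
Proof.
move=> f fP; exists (fun=> 0); first by split=> // s t k x y _; rewrite scaler0 addr0.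
move=> a r rn; rewrite mx_subst_id addF2 /bar_diff /bar_left !scaler0 addr0 add0r.
by rewrite /merges big1.
Qed.

Lemma class_invariantM g h : class_invariant g -> class_invariant h ->
  class_invariant (g *m h).
Proof.
move=> cg ch f fP; have [b bc bE] := cg f fP.
have [b' bc' bE'] := ch _ (primitive_subst g fP).
exists (fun s => b' s + b s); first exact: seq_cochainD.
move=> a r rn; rewrite bar_diffD -(bE _ _ rn) -(bE' _ _ rn) mx_subst_comp.
exact: addF2_telescope.
Qed.

Lemma e_invariant_class g : e_invariant g -> class_invariant g.
Proof.
case=> B [Bl Bh BE] f fP; have fl := primitive_linear fP; exists (fun s => f (B s)).
  split=> [s t k x y st|l e ln en he et]; first by rewrite (Bl _ _ _ _ _ st) fl.
  exact: primitive_degree fP (Bh _ _ ln en he) et.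
by move=> a r rn; rewrite (bar_diff_primitive _ _ _ fP) -(BE _ _ rn) (linD fl).
Qed.

(** Induction on the distance of the indices: a long transvection is a commutator of two shorter
    ones. *)
Lemma class_invariant_GL g : g \in unitmx -> class_invariant g.
Proof.
suff el d (i j : 'I_n.+1) : i != j -> (`|(i : nat) - j| <= d)%N -> class_invariant (1%:M + delta_mx i j).
  move: g; apply: GL_ind => [|i j A ij cA]; first exact: class_invariant1.
  by apply: class_invariantM cA; apply: el ij (leqnn _).
elim: d i j => [|d IH] i j ij; first by move: ij; rewrite -val_eqE /= => /eqP; lia.
have [ji|ji] := eqVneq (j : nat) i.+1.
  by move=> _; apply/e_invariant_class; exact: (e_invariant_adjacent ji).2.
have [ij'|ij'] := eqVneq (i : nat) j.+1.
  by move=> _; apply/e_invariant_class; exact: (e_invariant_adjacent ij').1.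
(* [l] is the neighbour of [i] on the side of [j]. *)
move=> ijd; have [l [li lj il jl]] : exists l : 'I_n.+1,
    [/\ i != l, l != j, (`|(i : nat) - l| <= d)%N & (`|(l : nat) - j| <= d)%N].
  have hi := ltn_ord i; have hj := ltn_ord j.
  move: ij ji ij' ijd; rewrite -val_eqE /= => /eqP ij /eqP ji /eqP ij' ijd.
  have [lt|lt] := ltnP i j.
    have h : (i.+1 < n.+1)%N by lia.
    by exists (Ordinal h); split; rewrite -?val_eqE /=; try apply/eqP; lia.
  have h : (i.-1 < n.+1)%N by lia.
  by exists (Ordinal h); split; rewrite -?val_eqE /=; try apply/eqP; lia.
rewrite -(elementary_commutator li lj ij).
have ci := IH _ _ li il; have cj := IH _ _ lj jl.
exact: class_invariantM ci (class_invariantM cj (class_invariantM ci cj)).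
Qed.
End CoboundaryInvariance.

(** * Admissible words span the Steenrod algebra *)

Lemma word_nil : word [::] = 1.
Proof. by rewrite /word -free_one. Qed.

Lemma word_cat v w : word (v ++ w) = word v * word w.
Proof. by rewrite /word -free_wordM (alg_quotM steenrod_relator). Qed.

Lemma word_cons i w : word (i :: w) = word [:: i] * word w.
Proof. exact: (word_cat [:: i] w). Qed.

Lemma piA0 : piA 0 = 0.
Proof.
rewrite -[X in piA X](scale0r (0 : free_steenrod)) (span_quotZ _ 0 0).
by rewrite -[span_quot_scale _ _]/(0 *: (piA 0 : steenrod)) scale0r.
Qed.

Lemma relator_eq0 r : steenrod_relator r -> piA r = 0.
Proof.
move=> rr; rewrite -piA0; apply/span_quotP; rewrite subr0; apply/asboolP; exists [:: (1, r)].
  by move=> y; rewrite inE => /eqP ->; exists 1, r, 1; split=> //; rewrite mul1r mulr1.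
by rewrite big_seq1 scale1r.
Qed.

Lemma word0 : word [:: 0%N] = 1.
Proof.
have := relator_eq0 (or_introl (erefl (free_Sq 0 - 1))).
rewrite -scaleN1r addrC (span_quotD _ (_ *: _)) (span_quotZ _ _ 1).
rewrite -[span_quot_scale _ _]/(-1 *: (1 : steenrod)) scaleN1r free_SqE.
by move/eqP; rewrite addrC subr_eq0 => /eqP.
Qed.

Lemma piA_sum I (r : seq I) (F : I -> free_steenrod) :
  piA (\sum_(i <- r) F i) = \sum_(i <- r) piA (F i).
Proof.
elim: r => [|i r IH]; first by rewrite !big_nil piA0.
by rewrite !big_cons (span_quotD _ (F i)) IH.
Qed.

Lemma piA_mulrn (x : free_steenrod) k : piA (x *+ k) = piA x *+ k.
Proof. by elim: k => [|k IH]; rewrite ?mulr0n ?piA0 // !mulrS (span_quotD _ x) IH. Qed.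

Lemma word_adem a b : (0 < a)%N -> (a < 2 * b)%N ->
  word [:: a; b] = \sum_(j < a./2.+1) word [:: (a + b - j)%N; j : nat] *+ 'C(b - 1 - j, a - 2 * j).
Proof.
move=> a0 ab; have rr : steenrod_relator (adem_relator a b) by right; exists a, b.
have := relator_eq0 rr; rewrite /adem_relator -scaleN1r (span_quotD _ (_ * _)).
rewrite (span_quotZ _ (-1) (\sum_(i < _) _)) -[span_quot_scale _ _]/(-1 *: (piA _ : steenrod)).
rewrite scaleN1r => /eqP; rewrite subr_eq0 !free_SqE free_wordM => /eqP E.
rewrite [LHS]E piA_sum; apply: eq_bigr => j _.
by rewrite piA_mulrn !free_SqE free_wordM.
Qed.

Fixpoint admissible (w : seq nat) : bool :=
  if w is i :: v then [&& 0 < i, 2 * head 0 v <= i & admissible v]%N else true.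

Definition words (s : seq (seq nat)) : steenrod := \sum_(w <- s) word w.

Lemma words_cat s t : words (s ++ t) = words s + words t.
Proof. exact: big_cat. Qed.

Section Spanning.

(** Each letter weighted by its position from $0$, plus the length. Deleting a zero lowers it, and
    so does an Adem rewriting, which replaces $b$ in the second place by $j\le a/2<b$. *)
Fixpoint moment (w : seq nat) : nat := if w is i :: v then (sumn w + moment v).+1 else 0.

Lemma moment_cat u v v' : (sumn v <= sumn v')%N -> (moment v < moment v')%N ->
  (moment (u ++ v) < moment (u ++ v'))%N.
Proof. by move=> sv mv; elim: u => //= i u IH; rewrite !sumn_cat; lia. Qed.

Lemma admissible_factor w : ~~ admissible w ->
  (exists u v, w = u ++ 0%N :: v) \/
  exists u a b v, [/\ w = u ++ [:: a, b & v], (0 < a)%N & (a < 2 * b)%N].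
Proof.
elim: w => //= i w IH; rewrite !negb_and -leqNgt leqn0 -ltnNge.
case/or3P => [/eqP -> | | /IH [[u [v ->]]|[u [a [b [v [-> a0 ab]]]]]]].
- by left; exists [::], w.
- case: i => [_|i]; first by left; exists [::], w.
  by case: w {IH} => [|b v] //= lt; right; exists [::], i.+1, b, v.
- by left; exists (i :: u), v.
by right; exists (i :: u), a, b, v.
Qed.

Definition adm_list s d := all (fun K => admissible K && (sumn K == d)) s.

Definition spanned d (x : steenrod) := exists2 s, adm_list s d & x = words s.

Lemma spannedD d x y : spanned d x -> spanned d y -> spanned d (x + y).
Proof.
move=> [s sa ->] [t ta ->]; exists (s ++ t); last by rewrite words_cat.
by rewrite /adm_list all_cat; apply/andP.
Qed.

Lemma word_span w : spanned (sumn w) (word w).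
Proof.
move: {2}(moment w).+1 (ltnSn (moment w)) => N; elim: N w => // N IH w; rewrite ltnS => wN.
have [aw|/admissible_factor[[u [v E]]|[u [a [b [v [E a0 ab]]]]]]] := boolP (admissible w).
- by exists [:: w]; rewrite ?/adm_list /= ?aw ?eqxx // /words big_seq1.
- have -> : word w = word (u ++ v) by rewrite E word_cat word_cons word0 mul1r -word_cat.
  have -> : sumn w = sumn (u ++ v) by rewrite E !sumn_cat.
  by apply: IH; apply: leq_trans wN; rewrite E; apply: moment_cat => //=; lia.
rewrite {2}E word_cat (word_cat [:: a; b] v) word_adem // mulr_suml mulr_sumr.
have S0 : spanned (sumn w) 0 by exists [::]; rewrite // /words big_nil.
apply: big_ind => [//|x y|j _]; first exact: spannedD.
rewrite mulrnAl mulrnAr mulrnF2; case: ifP => // _.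
have jb := ltn_ord j.
have -> : sumn w = sumn (u ++ [:: (a + b - j)%N; j : nat] ++ v).
  by rewrite E !sumn_cat /=; lia.
rewrite -word_cat -word_cat; apply: IH.
by apply: leq_trans wN; rewrite E; apply: moment_cat => /=; lia.
Qed.
End Spanning.

(** * Independence of admissible words, read off in the last variable *)

Section LastVariable.
Variable m : nat.
Local Notation x := ('X_ord_max : Pol m.+1).

Definition last_degree_lt d (q : Pol m.+1) :=
  forall w : 'X_{1..m.+1}, q@_w != 0 -> (w ord_max < d)%N.

Lemma last_degree_lin d c p q : last_degree_lt d p -> last_degree_lt d q ->
  last_degree_lt d (c *: p + q).
Proof.
move=> hp hq w; rewrite mcoeffD mcoeffZ.
have [E|/hp //] := eqVneq (p@_w) 0.
by have [E'|/hq //] := eqVneq (q@_w) 0; rewrite E E' mulr0 addr0 eqxx.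
Qed.

Lemma last_degree0 d : last_degree_lt d 0.
Proof. by move=> w; rewrite mcoeff0 eqxx. Qed.

Lemma last_degreeD d p q : last_degree_lt d p -> last_degree_lt d q -> last_degree_lt d (p + q).
Proof. by move=> hp hq; have := @last_degree_lin d 1 p q hp hq; rewrite scale1r. Qed.

Lemma last_degree_sum d I (r : seq I) (P : pred I) F :
  (forall i, P i -> last_degree_lt d (F i)) -> last_degree_lt d (\sum_(i <- r | P i) F i).
Proof. by move=> hF; apply: big_ind hF; [apply: last_degree0 | apply: last_degreeD]. Qed.

Lemma last_degree_leq d e q : (d <= e)%N -> last_degree_lt d q -> last_degree_lt e q.
Proof. by move=> de hq w /hq wd; apply: leq_trans de. Qed.

Lemma last_degree_monomial d (w : 'X_{1..m.+1}) : (w ord_max < d)%N -> last_degree_lt d 'X_[w].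
Proof. by move=> wd w'; rewrite mcoeffX; case: (w =P w') => [<- //|_]; rewrite eqxx. Qed.

Lemma last_degree_mulX i d e q : (d + (i == ord_max) <= e)%N ->
  last_degree_lt d q -> last_degree_lt e ('X_i * q).
Proof.
move=> de hq; rewrite [q]mpolyE mulr_sumr big_seq; apply: last_degree_sum => w wq.
rewrite -scalerAr -mpolyXD -[X in last_degree_lt _ X]addr0.
apply: last_degree_lin; last exact: last_degree0.
apply: last_degree_monomial; rewrite mnmDE mnm1E.
by apply: leq_trans de; rewrite addnC -addSn leq_add2r; apply: hq; rewrite -mcoeff_msupp.
Qed.

Lemma last_degree_mwiden q : last_degree_lt 1 (mwiden q).
Proof.
rewrite [q]mpolyE (big_morph _ (@mwidenD _ _) (@mwiden0 _ _)); apply: last_degree_sum => w _.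
rewrite mwidenZ mwidenX -[X in last_degree_lt _ X]addr0.
apply: last_degree_lin; last exact: last_degree0.
by apply: last_degree_monomial; rewrite mnmwiden_ordmax.
Qed.

Lemma last_degree_mulXn e d q : last_degree_lt d q -> last_degree_lt (d + e) (q * x ^+ e).
Proof.
move=> hq; elim: e => [|e IH]; first by rewrite addn0 expr0 mulr1.
by rewrite exprS mulrCA; apply: last_degree_mulX IH; rewrite eqxx addn1 addnS.
Qed.

Lemma last_degree_Sq_monomial k (w : 'X_{1..m.+1}) :
  last_degree_lt (w ord_max).*2.+1 (Sq k 'X_[w]).
Proof.
elim/mnm_ind: w k => [|i w IH] k.
  rewrite mpolyX0 Sq1; case: eqP => _; last exact: last_degree0.
  by rewrite -(mpolyX0 _ F2); apply: last_degree_monomial; rewrite mnm0E.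
rewrite mpolyXD Sq_mulX mnmDE mnm1E doubleD; apply: last_degreeD.
  by apply: last_degree_mulX (IH k); case: (i == _); lia.
case: k => [|k] /=; first by rewrite mulr0; apply: last_degree0.
rewrite expr2 -mulrA; apply: (last_degree_mulX _ (last_degree_mulX _ (IH k))); last exact: leqnn.
by case: (i == _); lia.
Qed.

Lemma last_degree_Sq k d q : last_degree_lt d q -> last_degree_lt d.*2.-1 (Sq k q).
Proof.
move=> hq; rewrite [q]mpolyE Sq_sum big_seq; apply: last_degree_sum => w wq.
rewrite SqZ -[X in last_degree_lt _ X]addr0; apply: last_degree_lin; last exact: last_degree0.
have := hq w; rewrite -mcoeff_msupp => /(_ wq) wd.
by apply: last_degree_leq (@last_degree_Sq_monomial k w); lia.
Qed.

Lemma muni_last_degree d e q : last_degree_lt d q -> (d <= e)%N -> (muni q)`_e = 0.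
Proof.
move=> hq de; rewrite muniE coef_sum big_seq big1 // => w wq.
rewrite coefZ coefXn; have := hq w; rewrite -mcoeff_msupp => /(_ wq) wd.
by rewrite gtn_eqF ?mulr0 //; apply: leq_trans de.
Qed.

Lemma muni_monomial w : muni ('X_[w] : Pol m.+1) =
  'X_[[multinom w (widen_ord (leqnSn m) i) | i < m]] *: 'X^(w ord_max).
Proof. by rewrite muniE msuppX big_seq1 mcoeffX eqxx scale1r. Qed.

Lemma muni_mwiden q : muni (mwiden q : Pol m.+1) = q%:P.
Proof.
rewrite [in LHS](mpolyE q) (big_morph _ (@mwidenD _ _) (@mwiden0 _ _)).
rewrite (big_morph _ (@muniD _ _) (@muni0 _ _)) [in RHS](mpolyE q) rmorph_sum /=.
apply: eq_bigr => w _; rewrite mwidenZ mwidenX muniZ muni_monomial.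
rewrite mnmwiden_ordmax expr0 alg_polyC scale_polyC mul_mpolyC; congr (_ *: 'X_[_])%:P.
by apply/mnmP => i; rewrite mnmE mnmwiden_widen.
Qed.

Lemma muniX_max : muni x = 'X.
Proof.
rewrite muni_monomial mnm1E eqxx expr1.
rewrite [X in 'X_[X]](_ : _ = 0%MM) ?mpolyX0 ?scale1r //.
apply/mnmP => i; rewrite mnmE mnm1E mnm0E -val_eqE /=.
by rewrite gtn_eqF ?ltn_ord.
Qed.
End LastVariable.

Lemma muni_expansion m h d (F : nat -> Pol m) : (h < d)%N ->
  (muni (\sum_(0 <= j < d) mwiden (F j) * 'X_ord_max ^+ j : Pol m.+1))`_h = F h.
Proof.
move=> hd; rewrite (big_morph _ (@muniD _ _) (@muni0 _ _)) coef_sum.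
have E j : (muni (mwiden (F j) * 'X_ord_max ^+ j : Pol m.+1))`_h = if j == h then F j else 0.
  rewrite muniM muni_mwiden rmorphXn /= muniX_max coefCM coefXn eq_sym.
  by case: eqP; rewrite ?mulr1 ?mulr0.
rewrite (eq_bigr _ (fun j _ => E j)) -big_mkcond big_mkord /=.
by rewrite (big_pred1 (Ordinal hd)).
Qed.

Lemma e1_letter m i (p : Pol m) : e1_cocycle (word [:: i]) p =
  \sum_(0 <= j < i) mwiden (Sq (i - j.+1) p) * 'X_ord_max ^+ j.
Proof.
rewrite /e1_cocycle (act_word (@hat_adem m)) [foldr _ _ _]/= hat_SqE /fst /snd Sq0r add0r.
by rewrite big_add1.
Qed.

(** Squares at most double exponents, and admissibility says that twice the next letter does not
    exceed the first. *)
Lemma e1_admissible m K (p : Pol m) : admissible K ->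
  last_degree_lt (head 0%N K) (e1_cocycle (word K) p).
Proof.
elim: K => [|i K IH].
  move=> _; rewrite /e1_cocycle (act_word (@hat_adem m)); exact: last_degree0.
move=> /= /and3P[i0 iK aK]; rewrite word_cons e1_cocycleM; apply: last_degreeD.
  rewrite e1_letter big_nat; apply: last_degree_sum => j /andP[_ ji].
  exact: last_degree_leq ji (last_degree_mulXn (@last_degree_mwiden m _)).
rewrite (act_word (Pol_adem m.+1)) [foldr _ (e1_cocycle _ _) _]/=.
have ii : ((head 0 K).*2.-1 <= i)%N by lia.
exact: last_degree_leq ii (last_degree_Sq (IH aK)).
Qed.

(** The top coefficient comes from the term $Sq^0$ in [e1_letter]; the remaining summand stays below
    by the doubling estimate. *)
Lemma e1_admissible_top m i K (p : Pol m) : admissible (i :: K) ->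
  (muni (e1_cocycle (word (i :: K)) p))`_i.-1 = foldr (@Sq m) p K.
Proof.
move=> /= /and3P[i0 iK aK]; rewrite word_cons e1_cocycleM muniD coefD.
rewrite (act_word (Pol_adem m.+1)) [foldr _ (e1_cocycle _ _) _]/=.
have ii : ((head 0 K).*2.-1 <= i.-1)%N by lia.
rewrite -[RHS]addr0; congr (_ + _); last exact: muni_last_degree (last_degree_Sq (e1_admissible aK)) ii.
rewrite (act_word (Pol_adem m) K) e1_letter.
rewrite (@muni_expansion m i.-1 i (fun j => Sq (i - j.+1) (foldr (@Sq m) p K))) ?prednK //.
by rewrite subnn Sq0.
Qed.

(* A relation in which only one leading letter is maximal survives, in the top
   coefficient of the last variable, as a relation between the tails. *)
Lemma words_faithful s : uniq s -> all admissible s ->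
  (forall n p, act (@Sq n) (words s) p = 0) -> s = [::].
Proof.
have [N sN] : exists N, forall K, K \in s -> (size K < N)%N.
  exists (\max_(K <- s) size K).+1 => K Ks; rewrite ltnS.
  by rewrite (big_rem _ Ks) leq_maxl.
elim: N s sN => [|N IH] s sN us sa s0.
  by case: s sN {us sa s0} => // K s /(_ K); rewrite mem_head => /(_ isT).
case: s => // K0 s1 in sN us sa s0 *; set s := K0 :: s1 in sN us sa s0 *.
have [h hs hmax] : exists2 h, h \in map (head 0%N) s & forall K, K \in s -> (head 0%N K <= h)%N.
  have [i _ hi] := @arg_maxnP 'I_(size s) ord0 xpredT (fun i => head 0%N (nth [::] s i)) isT.
  exists (head 0%N (nth [::] s i)); first by apply/map_f/mem_nth.
  move=> K Ks; rewrite -(nth_index [::] Ks).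
  by apply: (hi (@Ordinal (size s) (index K s) _)) => //; rewrite index_mem.
case: h hs hmax => [|h] hs hmax.
  have nilE K : K \in s -> K = [::].
    by move=> Ks; have := allP sa K Ks; have := hmax K Ks; case: (K) => //= i K'; case: i.
  have s1E : s = [:: [::]].
    have K0E := nilE K0 (mem_head _ _); case: (s1) @s us nilE {sN sa s0 hs hmax} => [|K1 s2] s us nilE.
      by rewrite /s K0E.
    by move: us; rewrite /s K0E (nilE K1) ?inE ?eqxx ?orbT.
  have := s0 0%N 1; rewrite s1E /words big_seq1 (act_word (Pol_adem 0)) /= => /eqP.
  by rewrite oner_eq0.
pose P K := head 0%N K == h.+1; have PE K : P K -> K = h.+1 :: behead K by case: K => //= i K; rewrite /P /= => /eqP ->.
pose t := [seq behead K | K <- s & P K].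
have tE : t = [::].
  apply: IH.
  - move=> _ /mapP[K + ->]; rewrite mem_filter => /andP[/PE KE Ks].
    by have := sN K Ks; rewrite {1}KE.
  - rewrite map_inj_in_uniq ?filter_uniq // => K L; rewrite !mem_filter.
    by move=> /andP[/PE KE _] /andP[/PE LE _] E; rewrite KE LE E.
  - apply/allP => _ /mapP[K + ->]; rewrite mem_filter => /andP[/PE KE Ks].
    by have := allP sa K Ks; rewrite {1}KE => /and3P[].
  move=> n p.
  (* By [e1_cocycle_embed] the cocycle value is, up to a power of $x$, a combination of actions on
     polynomials, and these vanish. *)
  have E0 : e1_cocycle (words s) p = 0.
    have := e1_cocycle_embed p (leq_exp2_self (letter_bound (words s))); rewrite !s0 mwiden0.
    rewrite mulr0 addr0 => /eqP; rewrite mulf_eq0 expf_eq0 (negbTE (varX_neq0 _)) andbF.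
    by move/eqP.
  have := congr1 (fun q => (muni q)`_h) E0; rewrite muni0 coef0 => <-.
  have el : linear (fun a => e1_cocycle a p) by move=> c a b; apply: e1_cocycle_linearl.
  rewrite [in RHS]/words (lin_sum el) (big_morph _ (@muniD _ _) (@muni0 _ _)) coef_sum.
  rewrite /words (act_suml (Pol_adem n)) big_map big_filter big_mkcond big_seq [RHS]big_seq.
  apply: eq_bigr => K Ks; have aK := allP sa K Ks; case: ifP => [PK|nPK].
    rewrite (act_word (Pol_adem n)); rewrite (PE K PK) in aK *.
    exact/esym/(e1_admissible_top p aK).
  rewrite (muni_last_degree (e1_admissible aK)) //.
  by have := hmax K Ks; rewrite leq_eqVlt -/(P K) nPK.
move: hs => /mapP[K Ks Kh].
by have : behead K \in t; [apply/map_f; rewrite mem_filter Ks /P -Kh eqxx | rewrite tE].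
Qed.

Lemma steenrod_scaleAl (k : F2) (x y : steenrod) : (k *: x) * y = k *: (x * y).
Proof. by case: (F2_case k) => ->; rewrite ?scale0r ?mul0r ?scale1r. Qed.

Lemma steenrod_scaleAr (k : F2) (x y : steenrod) : x * (k *: y) = k *: (x * y).
Proof. by case: (F2_case k) => ->; rewrite ?scale0r ?mulr0 ?scale1r. Qed.

(** * The bar differential without its last face *)

Section BarLeft.
Variable V : lmodType F2.
Implicit Types (phi psi : seq steenrod -> V) (l s t : seq steenrod) (a b : steenrod).

Lemma bar_left_rcons phi s a b :
  bar_left phi (rcons (rcons s a) b) =
  bar_left (fun t => phi (rcons t b)) (rcons s a) + phi (rcons s (a * b)).
Proof.
case: s => [|c s]; first by rewrite /= merges_cons !merges1 !addr0.
by rewrite !rcons_cons /bar_left -!rcons_cons merges_rcons addrA.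
Qed.

Lemma eq_bar_left phi psi l : (forall s, (size s).+1 = size l -> phi s = psi s) ->
  bar_left phi l = bar_left psi l.
Proof. by case: l => //= a r E; rewrite (E r) // (eq_merges (l := a :: r) E). Qed.

Lemma bar_leftD phi psi l :
  bar_left (fun s => phi s + psi s) l = bar_left phi l + bar_left psi l.
Proof.
case: l => [|a r]; first exact/esym/addr0.
by rewrite /bar_left /merges big_split scalerDr addrACA.
Qed.

Lemma bar_left0 l : bar_left (fun=> 0 : V) l = 0.
Proof. by case: l => //= a r; rewrite scaler0 add0r /merges big1. Qed.

Lemma bar_left_sum I (r : seq I) (F : I -> seq steenrod -> V) l :
  bar_left (fun s => \sum_(i <- r) F i s) l = \sum_(i <- r) bar_left (F i) l.
Proof.
elim: r => [|i r IH].
  by rewrite big_nil -[RHS](bar_left0 l); apply: eq_bar_left => s _; rewrite big_nil.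
rewrite big_cons -IH -bar_leftD.
by apply: eq_bar_left => s _; rewrite big_cons.
Qed.

Definition mul_last l b := rcons (take (size l).-1 l) (last 0 l * b).

Lemma mul_last_rcons s a b : mul_last (rcons s a) b = rcons s (a * b).
Proof. by rewrite /mul_last size_rcons last_rcons -[rcons s a]cats1 take_size_cat. Qed.

Lemma bar_left_mul_last phi s a b c :
  bar_left phi (rcons (rcons s a) (b * c)) =
  bar_left (fun l => phi (mul_last l c)) (rcons (rcons s a) b).
Proof.
rewrite (bar_left_rcons phi) (bar_left_rcons (fun l => phi (mul_last l c))) mul_last_rcons.
have -> : bar_left (fun l => phi (mul_last (rcons l b) c)) (rcons s a) =
    bar_left (fun t => phi (rcons t (b * c))) (rcons s a).
  by apply: eq_bar_left => t _; rewrite mul_last_rcons.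
by rewrite (mulrA a b c).
Qed.

(** Induction on the length from the right. Splitting off the last entry leaves two sums in which it
    is multiplied into its neighbour, and they agree by associativity. *)
Lemma bar_left_left phi l : (1 < size l)%N -> bar_left (bar_left phi) l = 0.
Proof.
move: {2}(size l) (leqnn (size l)) => N; elim: N l phi => [|N IH] l phi.
  by rewrite leqn0 => /eqP ->.
case/lastP: l => // l b; case/lastP: l => // s a; rewrite !size_rcons ltnS => lN _.
case/lastP: s lN => [|s c] lN.
  rewrite /= merges_cons !merges1 addr0 /= !merges1 !addr0 scalerA -augmentationM.
  exact: addF2.
rewrite bar_left_rcons.
have -> : bar_left (fun t => bar_left phi (rcons t b)) (rcons (rcons s c) a) =
    bar_left (bar_left (fun t => phi (rcons t b))) (rcons (rcons s c) a) +
    bar_left (fun t => phi (mul_last t b)) (rcons (rcons s c) a).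
  rewrite -bar_leftD; apply: eq_bar_left => t.
  case/lastP: t => [|t d] tE; last by rewrite bar_left_rcons mul_last_rcons.
  by move: tE; rewrite !size_rcons.
rewrite IH ?size_rcons ?add0r //; last by move: lN; rewrite !size_rcons.
by rewrite bar_left_mul_last addF2.
Qed.

Lemma multilin_cons phi n a : multilin phi n.+1 -> multilin (fun t => phi (a :: t)) n.
Proof. by move=> ml s t k x y st; apply: (ml (a :: s)); rewrite /= addSn st. Qed.

Lemma merges_lin k phi psi l :
  merges (fun s => k *: phi s + psi s) l = k *: merges phi l + merges psi l.
Proof. by rewrite /merges scaler_sumr -big_split. Qed.

Lemma multilin_merges phi n : multilin phi n -> multilin (merges phi) n.+1.
Proof.
elim: n phi => [|n IH] phi ml s t k x y.
  by case: s t => [|? ?] [|? ?] //= _; rewrite !merges1 scaler0 addr0.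
case: s => [|a [|b s]] [st].
- case: t st => // b t [st]; rewrite !cat0s !merges_cons scalerDr addrACA.
  rewrite mulrDl steenrod_scaleAl (ml [::] t) /= ?st //; congr (_ + _).
  rewrite -merges_lin; apply: eq_merges => u [ut]; apply: (ml [::] u).
  by rewrite /= ut st.
- rewrite !cat_cons !cat0s !merges_cons scalerDr addrACA.
  rewrite (IH _ (@multilin_cons _ _ a ml) [::] t) ?st //.
  by congr (_ + _); rewrite mulrDr steenrod_scaleAr (ml [::] t) ?st.
rewrite !cat_cons !merges_cons scalerDr addrACA.
rewrite (IH _ (@multilin_cons _ _ a ml) (b :: s) t) ?st //.
by congr (_ + _); apply: (ml (a * b :: s)); rewrite -st.
Qed.

Lemma multilin_bar_left phi n : multilin phi n -> multilin (bar_left phi) n.+1.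
Proof.
move=> ml; have mm := multilin_merges ml; move=> [|a s] t k x y [st]; rewrite ?cat0s ?cat_cons /bar_left.
  rewrite (mm [::] t) ?st // augmentation_linear scalerDl -scalerA.
  by rewrite scalerDr addrACA.
rewrite (mm (a :: s) t k x y); last by rewrite -st.
rewrite (ml s t k x y st) [_ ++ _]/= [(a :: s) ++ _]/=.
by rewrite !scalerDr !scalerA addrACA [_ * k]mulrC.
Qed.

(* Degrees are tested on words only, which is enough by multilinearity; [e] is
   the degree of a generator multiplied by the last entry. *)
Definition word_degree phi n e d := forall ws : seq (seq nat), size ws = n ->
  (e + sumn (map sumn ws))%N <> d -> phi (map word ws) = 0.

Lemma word_degree_cons phi n e d v : word_degree phi n.+1 e d ->
  word_degree (fun t => phi (word v :: t)) n (e + sumn v) d.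
Proof. by move=> wd ws wn wsd; apply: (wd (v :: ws)); rewrite /= ?wn // addnA. Qed.

Lemma word_degree_merges phi n e d : word_degree phi n e d -> word_degree (merges phi) n.+1 e d.
Proof.
elim: n e phi => [|n IH] e phi wd [|v [|w ws]] //; first by rewrite merges1.
move=> [wn] vwd; rewrite !map_cons merges_cons -word_cat -map_cons.
rewrite (wd ((v ++ w) :: ws)) ?add0r /= ?wn //; last by rewrite sumn_cat -addnA.
rewrite -map_cons (IH _ _ (word_degree_cons wd)) //= ?wn // -addnA.
exact: vwd.
Qed.

Lemma word_degree_bar_left phi n e d : word_degree phi n e d -> word_degree (bar_left phi) n.+1 e d.
Proof.
move=> wd [|v ws] // [wn] wsd; rewrite [map _ _]/= /bar_left -map_cons.
rewrite (word_degree_merges wd) ?addr0 //= ?wn //.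
rewrite augmentation_word; case: eqP => v0; last by rewrite scale0r.
by rewrite (wd ws wn) ?scaler0 // => wd'; apply: wsd; rewrite /= v0.
Qed.
End BarLeft.

(** * Formal sums mod 2 as lists; coordinates in admissible words *)

Section ToggleDefinition.
Variable T : eqType.
Implicit Types s t : seq T.
(** A formal sum over $\mathbb F_2$ is kept as the list of its support; adding a basis element
    toggles membership. *)
Definition toggle (x : T) s := if x \in s then rem x s else x :: s.
Definition add2 s t := foldr toggle t s.
End ToggleDefinition.

Section SumsCharTwo.
Variables (T : eqType) (V : zmodType).
Hypothesis V2 : forall v : V, v + v = 0.
Variable F : T -> V.
Implicit Types s t : seq T.

Lemma sum_toggle_char2 x s : \sum_(y <- toggle x s) F y = F x + \sum_(y <- s) F y.
Proof.
rewrite /toggle; case: ifP => xs; last by rewrite big_cons.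
by rewrite [in RHS](perm_big _ (perm_to_rem xs)) big_cons /= addrA V2 add0r.
Qed.

Lemma sum_add2_char2 s t : \sum_(y <- add2 s t) F y = \sum_(y <- s) F y + \sum_(y <- t) F y.
Proof.
elim: s => [|x s IH]; first by rewrite big_nil add0r.
by rewrite [add2 _ _]/= sum_toggle_char2 IH big_cons addrA.
Qed.

Lemma sum_foldr_add2_char2 (U : Type) (G : U -> seq T) (r : seq U) :
  \sum_(y <- foldr (fun u => add2 (G u)) [::] r) F y = \sum_(u <- r) \sum_(y <- G u) F y.
Proof.
elim: r => [|u r IH]; first by rewrite !big_nil.
by rewrite [foldr _ _ _]/= sum_add2_char2 IH big_cons.
Qed.
End SumsCharTwo.

Section SumsModTwo.
Variables (T : eqType) (V : lmodType F2) (F : T -> V).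
Implicit Types s t : seq T.

Lemma sum_add2 s t : \sum_(y <- add2 s t) F y = \sum_(y <- s) F y + \sum_(y <- t) F y.
Proof. exact: sum_add2_char2 (@addF2 V) F s t. Qed.

Lemma sum_foldr_add2 (U : Type) (G : U -> seq T) (r : seq U) :
  \sum_(y <- foldr (fun u => add2 (G u)) [::] r) F y = \sum_(u <- r) \sum_(y <- G u) F y.
Proof. exact: sum_foldr_add2_char2 (@addF2 V) F U G r. Qed.
End SumsModTwo.

Section Cancel.
Variable T : eqType.
Implicit Types s : seq T.

Lemma toggle_uniq x s : uniq s -> uniq (toggle x s).
Proof. by rewrite /toggle; case: ifP => xs us; [apply: rem_uniq | rewrite /= xs]. Qed.

Lemma add2_uniq s t : uniq t -> uniq (add2 s t).
Proof. by move=> ut; elim: s => //= x s IH; apply: toggle_uniq. Qed.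

Lemma mem_add2 s t x : x \in add2 s t -> (x \in s) || (x \in t).
Proof.
elim: s => //= y s IH; rewrite /toggle; case: ifP => ys; rewrite !inE.
  by move=> /mem_rem/IH /orP[->|->]; rewrite ?orbT.
by case/orP => [->//|/IH /orP[->|->]]; rewrite ?orbT.
Qed.
End Cancel.

(** The symmetric difference of the two lists sums to zero in the algebra, so it is empty by
    [words_faithful]. *)
Lemma words_sum_ext (V : lmodType F2) (F : seq nat -> V) s t :
  all admissible s -> all admissible t -> words s = words t ->
  \sum_(K <- s) F K = \sum_(K <- t) F K.
Proof.
move=> sa ta st; pose u := add2 (s ++ t) [::].
have sumE (W : lmodType F2) (G : seq nat -> W) :
    \sum_(K <- u) G K = \sum_(K <- s) G K + \sum_(K <- t) G K.
  by rewrite sum_add2 big_nil addr0 big_cat.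
have u0 : u = [::].
  apply: words_faithful => [||n p]; first exact: add2_uniq.
    apply/allP => K /mem_add2; rewrite orbF mem_cat => /orP[/(allP sa)|/(allP ta)] //.
  rewrite /words sumE -/(words s) -/(words t) st addF2.
  exact: act0l (Pol_adem n) p.
have := sumE V F; rewrite u0 big_nil => E.
by apply/eqP; rewrite -subr_eq0 oppF2 -E.
Qed.

Definition word_sum (P : seq nat -> Prop) (a : steenrod) :=
  exists2 s : seq (seq nat), {in s, forall w, P w} & a = words s.

Lemma piA_words x : piA x = words [seq fmonom_val w | w <- monalg.msupp x].
Proof.
rewrite /words big_map {1}(monalg.monalgE x) piA_sum big_seq [RHS]big_seq.
apply: eq_bigr => w wx.
have -> : monalg.mcoeff w x = 1.
  by case: (F2_case (monalg.mcoeff w x)) (wx) => // E; rewrite -monalg.mcoeff_neq0 E eqxx.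
by case: w {wx}.
Qed.

Lemma word_sumT a : word_sum (fun=> True) a.
Proof. by rewrite -[a]reprK piA_words; eexists. Qed.

Lemma word_sum_homogeneous d a : homogeneous_op d a -> word_sum (fun w => sumn w = d) a.
Proof.
move=> [x xd ->]; rewrite piA_words; eexists; last by [].
move=> _ /mapP[w wx ->]; apply: xd; by rewrite monalg.mcoeff_neq0.
Qed.

Lemma word_sum_admissible (P : nat -> Prop) a : word_sum (fun w => P (sumn w)) a ->
  exists s, [/\ all admissible s, {in s, forall K, P (sumn K)} & a = words s].
Proof.
move=> [s sP ->]; elim: s sP => [|w s IH] sP; first by exists [::].
have [|t [ta tP tE]] := IH; first by move=> v vs; apply: sP; rewrite inE vs orbT.
have [u ua uE] := word_span w; exists (u ++ t); split.
- by rewrite all_cat ta andbT; apply/allP => K /(allP ua) /andP[].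
- move=> K; rewrite mem_cat => /orP[/(allP ua)/andP[_ /eqP ->]|/tP //].
  by apply: sP; rewrite mem_head.
by rewrite words_cat -tE -uE /words big_cons.
Qed.

Lemma coords_ex a : exists s, all admissible s /\ a = words s.
Proof.
have [s [sa _ ->]] := @word_sum_admissible (fun=> True) a (word_sumT a).
by exists s.
Qed.

(** Sums over this chosen expansion depend linearly on the element, so a linear map may be
    prescribed on admissible words. *)
Definition coords a : seq (seq nat) := projT1 (cid (coords_ex a)).

Lemma coords_admissible a : all admissible (coords a).
Proof. by case: (projT2 (cid (coords_ex a))). Qed.

Lemma coordsK a : words (coords a) = a.
Proof. by case: (projT2 (cid (coords_ex a))). Qed.

Lemma coords_words (V : lmodType F2) (F : seq nat -> V) s : all admissible s ->
  \sum_(K <- coords (words s)) F K = \sum_(K <- s) F K.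
Proof. by move=> sa; apply: words_sum_ext (coords_admissible _) sa (coordsK _). Qed.

Lemma coords_linear (V : lmodType F2) (F : seq nat -> V) :
  linear (fun a => \sum_(K <- coords a) F K).
Proof.
move=> c a b; have [->|->] := F2_case c.
  by rewrite !scale0r !add0r.
rewrite !scale1r -{1}[a]coordsK -{1}[b]coordsK -words_cat coords_words ?big_cat //.
by rewrite all_cat !coords_admissible.
Qed.

Lemma multilin_slot (V : lmodType F2) (phi : seq steenrod -> V) n s t : multilin phi n ->
  (size s + size t).+1 = n -> linear (fun a => phi (s ++ a :: t)).
Proof. by move=> ml st k x y; apply: ml. Qed.

(** Reduces vanishing of a multilinear form to words; [P i] restricts slot [i], for instance to one
    degree or to one word. *)
Lemma multilin_words (V : lmodType F2) (phi : seq steenrod -> V) n (P : nat -> seq nat -> Prop) :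
  multilin phi n ->
  (forall ws, size ws = n -> (forall i, (i < n)%N -> P i (nth [::] ws i)) ->
     phi (map word ws) = 0) ->
  forall l, size l = n -> (forall i, (i < n)%N -> word_sum (P i) (nth 0 l i)) -> phi l = 0.
Proof.
move=> ml phiw l ln lP.
suff main t ws : (size ws + size t)%N = n -> (forall i, (i < size ws)%N -> P i (nth [::] ws i)) ->
    (forall i, (i < size t)%N -> word_sum (P (size ws + i)%N) (nth 0 t i)) ->
    phi (map word ws ++ t) = 0.
  by apply: (main l [::]); rewrite ?ln.
elim: t ws => [|a t IH] ws wt wP tP.
  rewrite cats0; move: wt; rewrite addn0 => wn; apply: phiw => // i.
  by rewrite -wn; apply: wP.
have [s sP] := tP 0%N isT; rewrite addn0 in sP; rewrite [nth _ _ _]/= => ->.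
have st : (size (map word ws) + size t).+1 = n by rewrite size_map -wt addnS.
rewrite /words (lin_sum (multilin_slot ml st)) big_seq big1 // => w ws'.
rewrite -cat_rcons -map_rcons; apply: IH; first by rewrite size_rcons addSnnS.
  move=> i; rewrite size_rcons ltnS nth_rcons leq_eqVlt.
  by case: ltngtP => // [lt _|-> _]; [apply: wP | apply: sP].
by move=> i it; rewrite size_rcons addSnnS; apply: (tP i.+1).
Qed.

(** * Computing normal forms in the Steenrod algebra *)

Fixpoint bin2 (fuel n k : nat) : bool :=
  if fuel is f.+1 then
    if k is 0 then true else if n is 0 then false else (odd k ==> odd n) && bin2 f n./2 k./2
  else false.

(** One binary digit of Lucas' theorem. *)
Lemma odd_bin_double n k (b c : bool) :
  odd 'C(b + n.*2, c + k.*2) = (c ==> b) && odd 'C(n, k).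
Proof.
elim: n k b c => [|n IH] k b c; first by case: k b c => [|k] [] [].
have even m j : odd 'C((m.*2).+2, j.+2) = odd 'C(m.*2, j.+2) (+) odd 'C(m.*2, j).
  by rewrite !binS !oddD; case: odd; case: odd; case: odd.
have E0 (c' : bool) j : odd 'C(n.+1.*2, c' + j.*2) = ~~ c' && odd 'C(n.+1, j).
  rewrite doubleS; case: j c' => [|j] [].
  - by rewrite bin1 /= odd_double.
  - by rewrite !bin0.
  - rewrite doubleS addnC !addnS addn0 even.
    by have := IH j.+1 false true; have := IH j false true; rewrite !add0n !add1n doubleS => -> ->.
  rewrite add0n doubleS even binS oddD.
  by have := IH j.+1 false false; have := IH j false false; rewrite !add0n doubleS => -> ->.
case: b; last by rewrite add0n E0; case: c.
case: c; last first.
  rewrite add0n add1n; case: k => [|k]; first by rewrite !bin0.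
  have e1 := E0 true k; have e2 := E0 false k.+1.
  rewrite add0n [k.+1.*2]doubleS in e2; rewrite add1n in e1.
  by rewrite [k.+1.*2]doubleS binS oddD e1 e2 addbF.
have e1 := E0 true k; have e2 := E0 false k; rewrite add0n in e2; rewrite add1n in e1.
by rewrite !add1n binS oddD e1 e2.
Qed.

Lemma bin2E f n k : (n < f)%N -> bin2 f n k = odd 'C(n, k).
Proof.
elim: f n k => // f IH n k nf; rewrite [bin2 _ _ _]/=.
case: k => [|k]; first by rewrite bin0.
case: n nf => [|n] nf; first by rewrite bin0n.
have -> : 'C(n.+1, k.+1) = 'C(odd n.+1 + n.+1./2.*2, odd k.+1 + k.+1./2.*2).
  by rewrite !odd_double_half.
rewrite odd_bin_double IH //; move: nf; rewrite !ltnS => nf.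
by rewrite -divn2; lia.
Qed.

(** When the fuel runs out the product is returned unreduced, so [sq_mulE] holds for every fuel.
    Admissibility of the results is checked by evaluation in [homotopy_ok]. *)
Fixpoint sq_mul (fuel a : nat) (K : seq nat) : seq (seq nat) :=
  if a is 0 then [:: K] else
  if K is b :: K' then
    if (2 * b <= a)%N then [:: a :: K] else
    if fuel is f.+1 then
      foldr (fun j s => if bin2 (b - j) (b - 1 - j) (a - 2 * j) then
          foldr (fun L => add2 (sq_mul f (a + b - j) L)) s (sq_mul f j K') else s)
        [::] (iota 0 a./2.+1)
    else [:: a :: K]
  else [:: [:: a]].

Definition normal_form (w : seq nat) : seq (seq nat) :=
  foldr (fun a s => foldr (fun K => add2 (sq_mul 40 a K)) [::] s) [:: [::]] w.

Lemma words_add2 s t : words (add2 s t) = words s + words t.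
Proof. exact: sum_add2. Qed.

Lemma words_foldr_add2 (U : Type) (G : U -> seq (seq nat)) (r : seq U) t :
  words (foldr (fun u => add2 (G u)) t r) = \sum_(u <- r) words (G u) + words t.
Proof.
elim: r => [|u r IH]; first by rewrite big_nil add0r.
by rewrite [foldr _ _ _]/= words_add2 IH big_cons addrA.
Qed.

Lemma words1 w : words [:: w] = word w.
Proof. exact: big_seq1. Qed.

Lemma sq_mulS f a b K : (2 * b <= a.+1)%N = false -> sq_mul f.+1 a.+1 (b :: K) =
  foldr (fun j s => if bin2 (b - j) (b - 1 - j) (a.+1 - 2 * j) then
      foldr (fun L => add2 (sq_mul f (a.+1 + b - j) L)) s (sq_mul f j K) else s)
    [::] (iota 0 a.+1./2.+1).
Proof. by move=> /= ->. Qed.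

Lemma sq_mulE f a K : words (sq_mul f a K) = word (a :: K).
Proof.
case: a => [|a]; first by rewrite word_cons word0 mul1r; case: f => [|f]; exact: words1.
case: K => [|b K]; first by case: f => [|f]; exact: words1.
case ba: (2 * b <= a.+1)%N.
  by case: f => [|f]; rewrite [sq_mul _ _ _]/= ba; exact: words1.
elim: f a b K ba => [|f IHf] a b K ba; first by rewrite [sq_mul _ _ _]/= ba; exact: words1.
have IH i L : words (sq_mul f i L) = word (i :: L).
  case: i => [|i]; first by rewrite word_cons word0 mul1r; case: (f) => [|f']; exact: words1.
  case: L => [|c L]; first by case: (f) => [|f']; exact: words1.
  case bi: (2 * c <= i.+1)%N; last exact: IHf.
  by case: (f) => [|f']; rewrite [sq_mul _ _ _]/= bi; exact: words1.
rewrite (sq_mulS _ _ ba).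
rewrite (word_cat [:: a.+1; b] K) word_adem //; last by move/negbT: ba; rewrite -ltnNge.
rewrite mulr_suml -(big_mkord xpredT
  (fun j => word [:: (a.+1 + b - j)%N; j] *+ 'C(b - 1 - j, a.+1 - 2 * j) * word K)).
rewrite /index_iota subn0.
have : all (fun j => j < b)%N (iota 0 a.+1./2.+1).
  by apply/allP => j; rewrite mem_iota; move/negbT: ba; lia.
elim: (iota 0 a.+1./2.+1) => [|j r IHr]; first by rewrite /words !big_nil.
case/andP => jb /IHr {}IHr; rewrite big_cons -IHr mulrnAl mulrnF2 [foldr _ _ (j :: r)]/= bin2E; last by lia.
case: ifP => _; last by rewrite add0r.
rewrite words_foldr_add2; congr (_ + _).
under eq_bigr do rewrite IH word_cons.
by rewrite -mulr_sumr -/(words _) IH -word_cons -word_cat.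
Qed.

Lemma normal_form_cons a w :
  normal_form (a :: w) = foldr (fun K => add2 (sq_mul 40 a K)) [::] (normal_form w).
Proof. by []. Qed.

Lemma normal_formE w : words (normal_form w) = word w.
Proof.
elim: w => [|a w IH]; first exact: words1.
have w0 : words [::] = 0 by exact: big_nil.
rewrite normal_form_cons words_foldr_add2 w0 addr0.
have E K : words (sq_mul 40 a K) = word [:: a] * word K by rewrite sq_mulE word_cons.
rewrite (eq_bigr _ (fun K _ => E K)) -mulr_sumr -/(words _) IH.
exact/esym/word_cons.
Qed.

Fixpoint adm_words (fuel n h : nat) : seq (seq nat) :=
  if n is 0 then [:: [::]] else
  if fuel is f.+1 then
    flatten [seq [seq i :: w | w <- adm_words f (n - i) i./2] | i <- iota 1 (minn n h)]
  else [::].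

Lemma adm_words_complete f w h : admissible w -> (head 0 w <= h)%N -> (sumn w <= f)%N ->
  w \in adm_words f (sumn w) h.
Proof.
elim: f w h => [|f IH] [|i w] h // /and3P[i0 iw aw] ih; rewrite [sumn _]/= => wf.
  by case: i i0 wf {iw ih}.
have -> : (i + sumn w = (i + sumn w).-1.+1)%N by rewrite prednK // addn_gt0 i0.
rewrite [adm_words _ _ _]/= prednK ?addn_gt0 ?i0 //; apply/flatten_mapP; exists i.
  by rewrite mem_iota i0 add1n ltnS leq_min ih leq_addr.
apply/map_f; rewrite addKn; apply: IH => //; last by lia.
by move: ih iw; rewrite /= => *; lia.
Qed.

(** * The minimal resolution and its contracting homotopy *)

Definition element := seq (nat * seq nat).

(** Entry $q$ lists the boundaries of the generators of $F_q$, a pair [(g, w)] standing for $Sq^w$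
    times generator $g$ of $F_{q-1}$. The last generator of level 5 has degree 23; the summands
    $Sq^2$ and $Sq^1$ on generators 5 and 6, of degrees 21 and 22, show that it is dual to
    $h_1e_0=h_0f_0$. *)
Definition resolution : seq (seq (seq (nat * seq nat))) := [:: [:: [::]];
[:: [:: (0,[::1])];
   [:: (0,[::2])];
   [:: (0,[::4])];
   [:: (0,[::8])];
   [:: (0,[::16])]];
[:: [:: (0,[::1])];
   [:: (0,[::3]); (1,[::2])];
   [:: (0,[::4]); (1,[::2;1]); (2,[::1])];
   [:: (0,[::7]); (1,[::6]); (2,[::4])];
   [:: (0,[::6;2]); (0,[::8]); (1,[::4;2;1]); (1,[::7]); (3,[::1])];
   [:: (0,[::7;2]); (1,[::8]); (2,[::4;2]); (3,[::2])];
   [:: (0,[::15]); (1,[::14]); (2,[::12]); (3,[::8])];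
   [:: (0,[::10;4;2]); (0,[::12;4]); (0,[::13;3]); (0,[::14;2]); (0,[::16]); (1,[::8;4;2;1]); (1,[::11;4]); (1,[::15]); (2,[::13]); (4,[::1])];
   [:: (0,[::11;4;2]); (0,[::13;4]); (0,[::14;3]); (0,[::15;2]); (1,[::12;4]); (1,[::16]); (2,[::8;4;2]); (2,[::14]); (4,[::2])];
   [:: (0,[::15;4]); (1,[::14;4]); (2,[::16]); (3,[::8;4]); (4,[::4])]];
[:: [:: (0,[::1])];
   [:: (0,[::4]); (1,[::2]); (2,[::1])];
   [:: (0,[::6;2]); (0,[::8]); (1,[::4;2]); (4,[::1])];
   [:: (1,[::4;2;1]); (1,[::7]); (2,[::6]); (3,[::2;1])];
   [:: (1,[::8]); (2,[::7]); (3,[::4]); (4,[::3]); (5,[::2])];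
   [:: (0,[::10;5]); (0,[::11;4]); (0,[::12;3]); (0,[::13;2]); (0,[::15]); (2,[::8;4]); (2,[::12]); (3,[::6;3]); (3,[::9]); (4,[::6;2]); (4,[::8]); (5,[::4;2;1]); (5,[::7]); (6,[::1])];
   [:: (0,[::10;4;2]); (0,[::12;4]); (0,[::13;3]); (0,[::14;2]); (0,[::16]); (1,[::8;4;2]); (7,[::1])];
   [:: (0,[::14;4]); (0,[::15;3]); (1,[::12;4]); (1,[::14;2]); (1,[::16]); (2,[::11;4]); (2,[::12;3]); (2,[::13;2]); (3,[::8;4]); (7,[::3]); (8,[::2])];
   [:: (0,[::12;5;2]); (0,[::13;6]); (0,[::14;5]); (1,[::13;4]); (1,[::14;2;1]); (2,[::11;5]); (2,[::12;4]); (2,[::14;2]); (2,[::16]); (3,[::8;4;1]); (3,[::9;4]); (3,[::13]); (4,[::8;4]); (5,[::8;2;1]); (7,[::4]); (8,[::2;1]); (9,[::1])];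
   [:: (0,[::13;5;2]); (0,[::14;4;2]); (1,[::17;1]); (2,[::11;4;2]); (2,[::13;4]); (2,[::14;3]); (3,[::8;4;2]); (3,[::14]); (4,[::11;2]); (5,[::12]); (6,[::4;2])]];
[:: [:: (0,[::1])];
   [:: (0,[::8]); (1,[::4;1]); (2,[::1])];
   [:: (0,[::8;2]); (0,[::10]); (1,[::4;2;1]); (1,[::7]); (3,[::2])];
   [:: (0,[::10;5]); (0,[::11;4]); (1,[::9;2;1]); (1,[::10;2]); (1,[::11;1]); (3,[::4;2;1]); (3,[::7]); (4,[::5;1])];
   [:: (0,[::12;4]); (0,[::13;3]); (0,[::14;2]); (0,[::16]); (1,[::8;4;1]); (6,[::1])];
   [:: (0,[::12;4;2]); (0,[::12;6]); (0,[::14;4]); (0,[::16;2]); (0,[::18]); (1,[::8;4;2;1]); (1,[::12;2;1]); (1,[::15]); (2,[::11]); (3,[::9;1]); (3,[::10]); (4,[::6;2;1]); (4,[::8;1]); (4,[::9]); (5,[::3;1])];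
   [:: (0,[::14;5]); (1,[::11;4;1]); (1,[::11;5]); (1,[::12;4]); (1,[::13;3]); (1,[::14;2]); (1,[::15;1]); (2,[::12]); (3,[::8;2;1]); (3,[::10;1]); (4,[::6;3;1]); (4,[::7;3]); (5,[::4;1])];
   [:: (0,[::12;5;2]); (0,[::14;5]); (0,[::15;4]); (1,[::11;4;1]); (1,[::12;3;1]); (1,[::12;4]); (1,[::13;3]); (1,[::14;2]); (1,[::15;1]); (1,[::16]); (2,[::8;4]); (2,[::9;3]); (3,[::10;1]); (4,[::6;3;1]); (4,[::7;3]); (4,[::8;2]); (6,[::4]); (7,[::2]); (8,[::1])]];
[:: [:: (0,[::1])];
   [:: (0,[::10]); (1,[::2;1])];
   [:: (0,[::12]); (1,[::4;1]); (2,[::3])];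
   [:: (0,[::11;4]); (0,[::12;3]); (0,[::13;2]); (2,[::4;2]); (3,[::1])];
   [:: (0,[::16]); (1,[::8;1]); (4,[::1])];
   [:: (0,[::12;4]); (0,[::14;2]); (1,[::8;1]); (2,[::4;2;1]); (2,[::7]); (3,[::2])];
   [:: (0,[::12;6]); (0,[::15;3]); (2,[::7;2]); (2,[::9]); (3,[::4]); (5,[::1])];
   [:: (0,[::14;5]); (0,[::16;3]); (0,[::17;2]); (1,[::12]); (2,[::6;3;1]); (2,[::8;2]); (5,[::2]); (6,[::1])]]]%N.

Definition diff_of (D : seq element) (x : nat * seq nat) : element :=
  foldr (fun y s => add2 [seq (y.1, K) | K <- normal_form (x.2 ++ y.2)] s) [::] (nth [::] D x.1).

Definition gen_degree (ds : seq nat) (D : seq element) : seq nat :=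
  [seq (if x is y :: _ then nth 0 ds y.1 + sumn y.2 else 0) | x <- D]%N.
Definition degrees (q : nat) : seq nat :=
  foldl gen_degree [::] (take q.+1 resolution).

Definition basis (ds : seq nat) (n : nat) : element :=
  flatten [seq (if (nth 0 ds g <= n)%N then [seq (g, w) | w <- adm_words n (n - nth 0 ds g) n] else [::]) | g <- iota 0 (size ds)]%N.

Definition lead (bs v : element) := foldl (fun l x => if x \in v then Some x else l) None bs.

(** Gauss-Jordan elimination. An entry $(k,(v,t))$ has $v=d(t)$ and its pivot $k$ occurs in no other
    $v$, so $k\mapsto t$ is the partial inverse of $d$ wanted as a homotopy. *)
Definition elim_step (D : seq element) (bs : element) (tbl : seq ((nat * seq nat) * (element * element))) x :=
  let v0 := diff_of D x in
  let vt := foldl (fun (vt : element * element) (e : (nat * seq nat) * (element * element)) =>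
     if e.1 \in v0 then (add2 e.2.1 vt.1, add2 e.2.2 vt.2) else vt) (v0, [:: x]) tbl in
  if lead bs vt.1 is Some k then
    (k, vt) :: [seq (if k \in e.2.1 then (e.1, (add2 vt.1 e.2.1, add2 vt.2 e.2.2)) else e) | e <- tbl]
  else tbl.

(* contraction F_(q-1) -> F_q in degree n *)
Definition contraction q n : seq ((nat * seq nat) * element) :=
  if q is 0 then [::] else
  [seq (e.1, e.2.2) | e <- foldl (elim_step (nth [::] resolution q) (basis (degrees q.-1) n)) [::] (basis (degrees q) n)].

Definition lookup (tbl : seq ((nat * seq nat) * element)) x : element :=
  foldr (fun e r => if e.1 == x then e.2 else r) [::] tbl.

Definition homotopy_ok q n :=
  let t := contraction q n in let t' := contraction q.+1 n in
  let D := nth [::] resolution q in let D' := nth [::] resolution q.+1 in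
  all (fun x =>
    all (fun y => adm_list (normal_form (x.2 ++ y.2)) (sumn (x.2 ++ y.2))) (nth [::] D x.1) &&
    nilp (add2 [:: x] (add2
      (foldr (fun y => add2 (lookup t y)) [::] (diff_of D x))
      (foldr (fun y => add2 (diff_of D' y)) [::] (lookup t' x))))) (basis (degrees q) n).

Definition contraction_ok q n := let ds := degrees q in
  all (fun e => all (fun y => nth 0 ds y.1 + sumn y.2 == n) e.2)%N (contraction q n).

Definition resolution_ok q :=
  let D := nth [::] resolution q in let D' := nth [::] resolution q.+1 in
  let ds := degrees q in let ds' := degrees q.+1 in
  all (fun g => all (fun y => [&& y.1 < size ds, 0 < sumn y.2 &
      nth 0 ds y.1 + sumn y.2 == nth 0 ds' g]) (nth [::] D' g) &&
    nilp (foldr (fun y => add2 (diff_of D y)) [::] (nth [::] D' g)))%N (iota 0 (size D')).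

(** The homotopy is required from degree 1, degree 0 being the resolved ground field, up to the
    internal degree $23=5+18$ of the target. *)
Lemma resolution_check :
  all (fun q => [&& resolution_ok q, all (homotopy_ok q) (iota 1 23) &
    all (contraction_ok q.+1) (iota 0 24)]) (iota 0 5).
Proof. by vm_compute. Qed.

(** * The double complex of the bar construction and the resolution *)

Local Notation diff q := (nth [::] resolution q).
Local Notation deg q g := (nth 0%N (degrees q) g).
Local Notation family := (nat -> seq steenrod -> F2^o).

Lemma resolutionP q : (q < 5)%N -> [/\ resolution_ok q,
  forall n, (0 < n)%N -> (n <= 23)%N -> homotopy_ok q n &
  forall n, (n <= 23)%N -> contraction_ok q.+1 n].
Proof.
move=> q5; have := allP resolution_check q; rewrite mem_iota => /(_ q5) /and3P[H1 H2 H3].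
split=> // n; first by move=> n0 n23; apply: (allP H2); rewrite mem_iota; lia.
by move=> n23; apply: (allP H3); rewrite mem_iota; lia.
Qed.

Lemma size_degrees q : (q < 5)%N -> size (degrees q.+1) = size (diff q.+1).
Proof. by case: q => [|[|[|[|[|]]]]]. Qed.

Lemma resolution_degree q g y : (q < 5)%N -> y \in nth [::] (diff q.+1) g ->
  [/\ (y.1 < size (degrees q))%N, (0 < sumn y.2)%N & deg q y.1 + sumn y.2 = deg q.+1 g]%N.
Proof.
move=> q5 yg; have [R _ _] := resolutionP q5.
have gs : (g < size (diff q.+1))%N.
  by rewrite ltnNge; apply/negP => gs; rewrite nth_default in yg.
have := allP R g; rewrite mem_iota => /(_ gs) /andP[/allP/(_ y yg)/and3P[? ? /eqP ?] _].
by split.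
Qed.

(** A family with $p+1$ slots is a cochain on $p$ bar entries followed by an element of $F_q$:
    $z_g(a_1,\dots,a_p,a)$ is its value at $a\cdot g$. Pulling back along the differential of the
    resolution multiplies the last slot on the right. *)
Definition dstar q (z : family) : family := fun g l =>
  \sum_(y <- nth [::] (diff q) g) z y.1 (mul_last l (word y.2)).

Definition cochain q p (z : family) := [/\ forall g, multilin (z g) p.+1,
  forall g, word_degree (z g) p.+1 (deg q g) 23 &
  forall g l, (size (degrees q) <= g)%N -> size l = p.+1 -> z g l = 0].

Lemma rcons_linear q p z g s : cochain q p z -> size s = p ->
  linear (fun a => z g (rcons s a)).
Proof.
move=> [ml _ _] sp k x y; rewrite -!cats1.
by apply: (ml g s [::]); rewrite addn0 sp.
Qed.

Lemma multilin_mul_last (V : lmodType F2) (phi : seq steenrod -> V) n b : multilin phi n ->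
  multilin (fun l => phi (mul_last l b)) n.
Proof.
move=> ml s t k x y st; case/lastP: t st => [|t c] st.
  have E u : mul_last (s ++ [:: u]) b = s ++ [:: u * b] by rewrite !cats1 mul_last_rcons.
  by rewrite (E (k *: x + y)) (E x) (E y) mulrDl steenrod_scaleAl; apply: ml.
have E u : mul_last (s ++ u :: rcons t c) b = s ++ u :: rcons t (c * b).
  by rewrite -!rcons_cons -!rcons_cat mul_last_rcons.
rewrite (E (k *: x + y)) (E x) (E y).
by apply: ml; move: st; rewrite !size_rcons.
Qed.

Lemma word_degree_mul_last (V : lmodType F2) (phi : seq steenrod -> V) n e d J :
  word_degree phi n.+1 e d -> word_degree (fun l => phi (mul_last l (word J))) n.+1 (e + sumn J) d.
Proof.
move=> wd ws; case/lastP: ws => // ws w; rewrite size_rcons => -[wn] wsd.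
rewrite map_rcons mul_last_rcons -word_cat -map_rcons; apply: wd; first by rewrite size_rcons wn.
move=> E; apply: wsd; rewrite -E !map_rcons !sumn_rcons sumn_cat; lia.
Qed.

Lemma cochain_dstar q p z : (q < 5)%N -> cochain q p z -> cochain q.+1 p (dstar q.+1 z).
Proof.
move=> q5 [ml wd zg]; split=> g.
- move=> s t k x y st; rewrite /dstar scaler_sumr -big_split; apply: eq_bigr => u _.
  by have mu := multilin_mul_last (word u.2) (ml u.1); apply: mu.
- move=> ws wn wsd; rewrite /dstar big_seq big1 // => u ug.
  have [_ _ ud] := resolution_degree q5 ug; rewrite -ud in wsd.
  exact: (word_degree_mul_last (wd u.1) wn wsd).
by move=> l gs _; rewrite /dstar nth_default ?big_nil // -size_degrees.
Qed.

(** Since $F_q$ is free, inserting $1$ in the last slot contracts [bar_left]; see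
    [bar_left_contract]. *)
Definition contract (z : family) : family := fun g l => z g (rcons l 1).
Definition bar_left_family (z : family) : family := fun g => bar_left (z g).

Lemma cochain_contract q p z : cochain q p.+1 z -> cochain q p (contract z).
Proof.
move=> [ml wd zg]; split=> g.
- move=> s t k x y st; rewrite /contract !rcons_cat !rcons_cons.
  by apply: ml; rewrite size_rcons addnS st.
- move=> ws wn wsd; rewrite /contract -word_nil -map_rcons; apply: wd.
    by rewrite size_rcons wn.
  by rewrite map_rcons sumn_rcons addn0.
by move=> l gs ls; apply: zg => //; rewrite size_rcons ls.
Qed.

Lemma cochain_bar_left q p z : cochain q p z -> cochain q p.+1 (bar_left_family z).
Proof.
move=> [ml wd zg]; split=> g; first exact: multilin_bar_left.
  exact: word_degree_bar_left.
move=> l gs ls; rewrite /bar_left_family -[RHS](@bar_left0 F2^o l).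
by apply: eq_bar_left => s; rewrite ls => -[sp]; apply: zg.
Qed.

Lemma cochainD q p z z' : cochain q p z -> cochain q p z' ->
  cochain q p (fun g l => z g l + z' g l).
Proof.
move=> [ml wd zg] [ml' wd' zg']; split=> g.
- by move=> s t k x y st; rewrite (ml _ _ _ _ _ _ st) (ml' _ _ _ _ _ _ st) scalerDr addrACA.
- by move=> ws wn wsd; rewrite (wd _ _ wn wsd) (wd' _ _ wn wsd) addr0.
by move=> l gs ls; rewrite (zg _ _ gs ls) (zg' _ _ gs ls) addr0.
Qed.

Lemma dstar_rcons q z g s a :
  dstar q z g (rcons s a) = \sum_(y <- nth [::] (diff q) g) z y.1 (rcons s (a * word y.2)).
Proof. by apply: eq_bigr => y _; rewrite mul_last_rcons. Qed.

Lemma sum_diff_of (V : lmodType F2) (F : nat * seq nat -> V) D x :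
  \sum_(y <- diff_of D x) F y =
  \sum_(y <- nth [::] D x.1) \sum_(K <- normal_form (x.2 ++ y.2)) F (y.1, K).
Proof.
rewrite [LHS](sum_foldr_add2 F (fun y => [seq (y.1, K) | K <- normal_form (x.2 ++ y.2)])).
by apply: eq_bigr => y _; rewrite big_map.
Qed.

Lemma words_linear (W : lmodType F2) (f : steenrod -> W) s : linear f ->
  \sum_(K <- s) f (word K) = f (words s).
Proof. by move=> fl; rewrite /words (lin_sum fl). Qed.

Lemma mul_linear_r (a : steenrod) : linear (fun b : steenrod => a * b : steenrod).
Proof. by move=> k x y; rewrite mulrDr steenrod_scaleAr. Qed.

Lemma rcons_mul_linear q p z g s (a : steenrod) : cochain q p z -> size s = p ->
  linear (fun b : steenrod => z g (rcons s (a * b))).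
Proof. by move=> zc sp k x y; rewrite (mul_linear_r a k x y) (rcons_linear g zc sp). Qed.

Lemma sum_diff_of_dstar q' q p z x s a : cochain q' p z -> size s = p ->
  \sum_(y <- diff_of (diff q) x) z y.1 (rcons s (a * word y.2)) =
  dstar q z x.1 (rcons s (a * word x.2)).
Proof.
move=> zc sp; rewrite sum_diff_of dstar_rcons; apply: eq_bigr => y _.
rewrite (words_linear _ (rcons_mul_linear y.1 a zc sp)) normal_formE word_cat.
by rewrite (mulrA a).
Qed.

Lemma dstar_dstar q p z g s a : (0 < q < 5)%N -> cochain q.-1 p z -> size s = p ->
  dstar q.+1 (dstar q z) g (rcons s a) = 0.
Proof.
case: q => // q q5 zc sp.
have dc : cochain q.+1 p (dstar q.+1 z) by apply: cochain_dstar => //; apply: ltnW.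
have ddc := cochain_dstar q5 dc.
have [gs|gs] := leqP (size (degrees q.+2)) g.
  by case: ddc => _ _; apply; rewrite ?size_rcons ?sp.
have [R _ _] := resolutionP q5.
have := allP R g; rewrite mem_iota -size_degrees // => /(_ gs) /andP[_ /nilP E].
have := sum_foldr_add2 (fun y : nat * seq nat => z y.1 (rcons s (a * word y.2)))
  (diff_of (diff q.+1)) (nth [::] (diff q.+2) g).
rewrite E big_nil dstar_rcons => E0; rewrite [RHS]E0; apply: eq_bigr => y _.
exact/esym/(sum_diff_of_dstar _ _ _ zc sp).
Qed.

Lemma homotopyP (V : lmodType F2) (F : nat * seq nat -> V) q n x : (q < 5)%N -> (0 < n <= 23)%N ->
  x \in basis (degrees q) n ->
  F x = \sum_(y <- diff_of (diff q) x) \sum_(u <- lookup (contraction q n) y) F u +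
        \sum_(y <- lookup (contraction q.+1 n) x) \sum_(u <- diff_of (diff q.+1) y) F u.
Proof.
move=> q5 /andP[n0 n23] xb; have [_ H _] := resolutionP q5.
have := allP (H n n0 n23) x xb => /andP[_ /nilP E].
have := sum_add2 F [:: x] (add2
      (foldr (fun y => add2 (lookup (contraction q n) y)) [::] (diff_of (diff q) x))
      (foldr (fun y => add2 (diff_of (diff q.+1) y)) [::] (lookup (contraction q.+1 n) x))).
rewrite E big_nil big_seq1 sum_add2 !sum_foldr_add2 => /eqP.
by rewrite eq_sym addr_eq0 oppF2 => /eqP.
Qed.

Lemma homotopy_admissible q n x y : (q < 5)%N -> (0 < n <= 23)%N ->
  x \in basis (degrees q) n -> y \in nth [::] (diff q) x.1 ->
  adm_list (normal_form (x.2 ++ y.2)) (sumn (x.2 ++ y.2)).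
Proof.
move=> q5 /andP[n0 n23] xb yx; have [_ H _] := resolutionP q5.
by have := allP (H n n0 n23) x xb => /andP[/allP/(_ y yx)].
Qed.

Lemma mem_basis ds n g I : (g < size ds)%N -> admissible I -> (nth 0 ds g + sumn I = n)%N ->
  (g, I) \in basis ds n.
Proof.
move=> gs aI <-; apply/flatten_mapP; exists g; first by rewrite mem_iota.
rewrite leq_addr addKn; apply/map_f; apply: adm_words_complete => //; last exact: leq_addl.
by apply: leq_trans (leq_addl _ _); case: (I) => //= i J; apply: leq_addr.
Qed.

Lemma lookup_degree q n x y : (q < 5)%N -> (n <= 23)%N ->
  y \in lookup (contraction q.+1 n) x -> (deg q.+1 y.1 + sumn y.2 = n)%N.
Proof.
move=> q5 n23; have [_ _ /(_ n n23)] := resolutionP q5; rewrite /contraction_ok /lookup.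
elim: (contraction q.+1 n) => //= e t IH /andP[He Ht].
by case: ifP => _; [move=> /(allP He)/eqP | apply: IH].
Qed.

Lemma high_degree q p z s g I : cochain q p z -> size s = p -> (23 < deg q g + sumn I)%N ->
  z g (rcons s (word I)) = 0.
Proof.
move=> [ml wd _] sp hI.
apply: (multilin_words (P := fun i w => if i == p then w = I else True) (ml g)).
- move=> ws wn wP; apply: wd => //; have := wP p (ltnSn p); rewrite eqxx => wI.
  case/lastP: ws wn wI {wP} => // ws w; rewrite size_rcons nth_rcons => -[->].
  by rewrite ltnn eqxx map_rcons sumn_rcons => ->; lia.
- by rewrite size_rcons sp.
move=> i; rewrite ltnS leq_eqVlt nth_rcons sp => /orP[/eqP ->|ip].
  by rewrite ltnn !eqxx; exists [:: I]; rewrite ?words1 // => w; rewrite inE => /eqP.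
by rewrite ip ltn_eqF //; apply: word_sumT.
Qed.


(** * Exactness in the direction of the resolution *)

Definition section_terms q g K := let n := (deg q g + sumn K)%N in
  if (n <= 23)%N then lookup (contraction q.+1 n) (g, K) else [::].

Definition pullback_value q (z : family) g s K : F2^o :=
  \sum_(x <- section_terms q g K) z x.1 (rcons s (word x.2)).

(** The transpose of the contracting homotopy. That homotopy is linear over $\mathbb F_2$ but not
    over $\mathscr A$, so it is applied to the admissible coordinates of the last slot. *)
Definition pullback q (z : family) : family := fun g l =>
  if (g < size (degrees q))%N
  then \sum_(K <- coords (last 0 l)) pullback_value q z g (take (size l).-1 l) K else 0.

Lemma take_rcons_last T (s : seq T) a : take (size (rcons s a)).-1 (rcons s a) = s.
Proof. by rewrite size_rcons -cats1 take_size_cat. Qed.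

Lemma pullback_rcons q z g s a : (g < size (degrees q))%N ->
  pullback q z g (rcons s a) = \sum_(K <- coords a) pullback_value q z g s K.
Proof. by move=> gs; rewrite /pullback gs last_rcons take_rcons_last. Qed.

Lemma section_terms_degree q g K x : (q < 5)%N -> x \in section_terms q g K ->
  (deg q.+1 x.1 + sumn x.2 = deg q g + sumn K)%N.
Proof.
by move=> q5; rewrite /section_terms; case: leqP => // n23; apply: lookup_degree.
Qed.

Lemma cochain_pullback q p z : (q < 5)%N -> cochain q.+1 p z -> cochain q p (pullback q z).
Proof.
move=> q5 [ml wd _]; split=> g.
- move=> s t k x y; case/lastP: t => [|t c] st; rewrite /pullback;
    case: (ltnP g) => _; rewrite ?scaler0 ?addr0 //.
    rewrite !cats1 !last_rcons !take_rcons_last.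
    exact: (coords_linear (pullback_value q z g s) k x y).
  have E u : s ++ u :: rcons t c = rcons (s ++ u :: t) c by rewrite -rcons_cons -rcons_cat.
  rewrite (E (k *: x + y)) (E x) (E y) !last_rcons !take_rcons_last.
  rewrite scaler_sumr -big_split; apply: eq_bigr => K _ /=.
  rewrite /pullback_value scaler_sumr -big_split; apply: eq_bigr => v _ /=.
  rewrite !rcons_cat !rcons_cons; apply: (ml v.1).
  by move: st; rewrite !size_rcons.
- move=> ws; case/lastP: ws => // ws w; rewrite size_rcons => -[wn] wsd.
  rewrite map_rcons /pullback; case: ltnP => // gs.
  have [s sa sE] := word_span w; rewrite last_rcons take_rcons_last sE coords_words; last first.
    by apply/allP => K /(allP sa)/andP[].
  rewrite big_seq big1 // => K /(allP sa)/andP[_ /eqP Kw].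
  rewrite /pullback_value big_seq big1 // => x xK.
  have xd := section_terms_degree q5 xK.
  rewrite -map_rcons; apply: (wd x.1); first by rewrite size_rcons wn.
  move=> xs; apply: wsd; move: xs; rewrite !map_rcons !sumn_rcons.
  by rewrite addnCA xd Kw addnCA.
by move=> l gs _; rewrite /pullback ltnNge gs.
Qed.

Lemma deg_gt0 q g : (q < 5)%N -> (g < size (degrees q.+1))%N -> (0 < deg q.+1 g)%N.
Proof.
move=> q5 gs; have : all (leq 1) (degrees q.+1) by case: q q5 {gs} => [|[|[|[|[|]]]]].
by move/allP; apply; apply: mem_nth.
Qed.

Lemma admissible_ext q p z z' g s : cochain q p z -> cochain q p z' -> size s = p ->
  (forall I, admissible I -> z g (rcons s (word I)) = z' g (rcons s (word I))) ->
  forall a, z g (rcons s a) = z' g (rcons s a).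
Proof.
move=> zc zc' sp E a; rewrite -[a]coordsK.
rewrite -(words_linear _ (rcons_linear g zc sp)) -(words_linear _ (rcons_linear g zc' sp)).
by apply: eq_big_seq => I /(allP (coords_admissible a))/E.
Qed.

Lemma dstar_lookup q q' n p z s x : cochain q p z -> size s = p ->
  (forall g a, dstar q.+1 z g (rcons s a) = 0) ->
  \sum_(y <- lookup (contraction q' n) x) \sum_(u <- diff_of (diff q.+1) y) z u.1 (rcons s (word u.2))
    = 0.
Proof.
move=> zc sp dz; apply: big1 => y _.
under eq_bigr do rewrite -[word _]mul1r.
by rewrite (sum_diff_of_dstar _ _ _ zc sp) dz.
Qed.

(** Evaluate [z] on $x=s(dx)+d(sx)$: the second summand gives [dstar] of [z], which is zero, and the
    first is the pullback applied to $dx$. *)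
Lemma exact_pos q p z : (q.+1 < 5)%N -> cochain q.+1 p z ->
  (forall g s a, size s = p -> dstar q.+2 z g (rcons s a) = 0) ->
  forall g s a, size s = p -> z g (rcons s a) = dstar q.+1 (pullback q z) g (rcons s a).
Proof.
move=> q5 zc dz g s a sp.
have pc := cochain_pullback (ltnW q5) zc; have dc := cochain_dstar (ltnW q5) pc.
have [gs|gs] := leqP (size (degrees q.+1)) g.
  by case: zc dc => _ _ z0 [_ _ d0]; rewrite z0 ?d0 // size_rcons sp.
apply: (admissible_ext zc dc sp) => I aI.
have [n23|n23] := leqP (deg q.+1 g + sumn I) 23; last first.
  by rewrite (high_degree zc sp n23) (high_degree dc sp n23).
set n := (deg q.+1 g + sumn I)%N in n23.
have n0 : (0 < n <= 23)%N by rewrite n23 andbT addn_gt0 deg_gt0 // ltnW.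
have gb : (g, I) \in basis (degrees q.+1) n by apply: mem_basis.
have := homotopyP (fun y : nat * seq nat => z y.1 (rcons s (word y.2))) q5 n0 gb.
have -> := @dstar_lookup q.+1 q.+2 n p z s (g, I) zc sp (fun g a => dz g s a sp).
rewrite addr0 => ->; rewrite sum_diff_of dstar_rcons big_seq [RHS]big_seq.
apply: eq_bigr => y yg; have [ys _ yd] := resolution_degree (ltnW q5) yg.
have ya := homotopy_admissible q5 n0 gb yg.
rewrite pullback_rcons // -word_cat -(normal_formE (I ++ y.2)) coords_words; last first.
  by apply/allP => K /(allP ya)/andP[].
rewrite big_seq [RHS]big_seq; apply: eq_bigr => K /(allP ya)/andP[_ /eqP Kd].
have Kn : (deg q y.1 + sumn K = n)%N by rewrite Kd sumn_cat addnCA yd addnC.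
by rewrite /pullback_value /section_terms Kn n23.
Qed.

(** In level 0 and positive degree the homotopy reads $x=d(sx)$, so a closed family sees only the
    augmentation. *)
Lemma exact_zero p z : cochain 0 p z ->
  (forall g s a, size s = p -> dstar 1 z g (rcons s a) = 0) ->
  forall s a, size s = p -> z 0%N (rcons s a) = augmentation a *: z 0%N (rcons s 1).
Proof.
move=> zc dz s a sp; rewrite -[a]coordsK.
have al : linear (fun b => augmentation b *: z 0%N (rcons s 1)).
  by move=> k x y; rewrite augmentation_linear scalerDl scalerA.
rewrite -(words_linear _ (rcons_linear 0 zc sp)) -(words_linear _ al).
apply: eq_big_seq => I /(allP (coords_admissible a)) aI.
rewrite augmentation_word; case: eqP => [I0|/eqP I0].
  have -> : I = [::] by case: (I) aI I0 => //= i J; case: i.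
  by rewrite word_nil scale1r.
rewrite scale0r; have [n23|n23] := leqP (deg 0%N 0%N + sumn I) 23; last exact: (high_degree zc sp n23).
have n0 : (0 < deg 0%N 0%N + sumn I <= 23)%N by rewrite n23 andbT addn_gt0 orbC lt0n I0.
have gb : (0%N, I) \in basis (degrees 0) (deg 0%N 0%N + sumn I) by apply: mem_basis.
have := homotopyP (fun y : nat * seq nat => z y.1 (rcons s (word y.2))) (isT : 0 < 5)%N n0 gb.
have -> := @dstar_lookup 0 1 (deg 0%N 0%N + sumn I) p z s (0%N, I) zc sp (fun g a => dz g s a sp).
by rewrite addr0 sum_diff_of big_nil.
Qed.

(** * The zigzag from bar cocycles to the resolution *)

Lemma bar_left_contract (V : lmodType F2) (phi : seq steenrod -> V) s a :
  bar_left phi (rcons (rcons s a) 1) =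
  bar_left (fun t => phi (rcons t 1)) (rcons s a) + phi (rcons s a).
Proof. by rewrite bar_left_rcons mulr1. Qed.

Lemma bar_left1 (V : lmodType F2) (phi : seq steenrod -> V) a :
  bar_left phi [:: a] = augmentation a *: phi [::].
Proof. by rewrite /= merges1 addr0. Qed.

Lemma bar_leftZ (V : lmodType F2) (phi : seq steenrod -> V) (k : F2) l :
  bar_left (fun t => k *: phi t) l = k *: bar_left phi l.
Proof.
have [->|->] := F2_case k.
  by rewrite scale0r -[RHS](@bar_left0 V l); apply: eq_bar_left => t _; rewrite scale0r.
by rewrite scale1r; apply: eq_bar_left => t _; rewrite scale1r.
Qed.

Definition augmented (c : seq steenrod -> F2^o) : family := fun g l =>
  if g == 0%N then augmentation (last 0 l) *: c (take (size l).-1 l) else 0.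

Lemma augmented_rcons c s a : augmented c 0 (rcons s a) = augmentation a *: c s.
Proof. by rewrite /augmented last_rcons take_rcons_last. Qed.

Lemma bar_diff_rcons (c : seq steenrod -> F2^o) s a :
  bar_diff c (rcons s a) = bar_left c (rcons s a) + augmentation a *: c s.
Proof. by rewrite /bar_diff last_rcons take_rcons_last. Qed.

Lemma bar_left_augmented c s a b :
  bar_left (augmented c 0) (rcons (rcons s a) b) = augmentation b *: bar_diff c (rcons s a).
Proof.
rewrite bar_left_rcons bar_diff_rcons augmented_rcons augmentationM scalerDr scalerA.
rewrite -bar_leftZ [augmentation a * _]mulrC; congr (_ + _).
by apply: eq_bar_left => t _; rewrite augmented_rcons.
Qed.

Lemma bar_left_dstar q z g s a b :
  bar_left (dstar q z g) (rcons (rcons s a) b) =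
  dstar q (bar_left_family z) g (rcons (rcons s a) b).
Proof.
rewrite (bar_left_sum (nth [::] (diff q) g) (fun y l => z y.1 (mul_last l (word y.2)))) dstar_rcons.
by apply: eq_bigr => y _; exact/esym/bar_left_mul_last.
Qed.

Lemma eq_dstar q z z' g s a : (forall g' b, z g' (rcons s b) = z' g' (rcons s b)) ->
  dstar q z g (rcons s a) = dstar q z' g (rcons s a).
Proof. by move=> E; rewrite !dstar_rcons; apply: eq_bigr => y _. Qed.

Lemma dstarD q z z' g l : dstar q (fun g l => z g l + z' g l) g l = dstar q z g l + dstar q z' g l.
Proof. exact: big_split. Qed.

Lemma dstar_augmented c g l : dstar 1 (augmented c) g l = 0.
Proof.
rewrite /dstar big_seq big1 // => y yg; have [_ y0 _] := resolution_degree (isT : 0 < 5)%N yg.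
rewrite /augmented; case: eqP => // _; rewrite /mul_last last_rcons augmentationM augmentation_word.
by rewrite eqn0Ngt y0 mulr0 scale0r.
Qed.

Lemma cochain_augmented n c : multilin c n -> word_degree c n 0 23 -> cochain 0 n (augmented c).
Proof.
move=> ml wd; split=> g.
- move=> s t k x y st; rewrite /augmented; case: eqP => _; last by rewrite scaler0 addr0.
  case/lastP: t st => [|t b] st.
    rewrite !cats1 !last_rcons !take_rcons_last augmentation_linear scalerDl scalerA.
    by [].
  have E u : s ++ u :: rcons t b = rcons (s ++ u :: t) b by rewrite -rcons_cons -rcons_cat.
  rewrite (E (k *: x + y)) (E x) (E y) !last_rcons !take_rcons_last.
  rewrite ml; last by move: st; rewrite size_rcons addnS => -[].
  by rewrite scalerDr !scalerA [_ * k]mulrC.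
- move=> ws; case/lastP: ws => // ws w; rewrite size_rcons => -[wn] wsd.
  rewrite map_rcons /augmented; case: eqP => // g0; rewrite last_rcons take_rcons_last.
  rewrite augmentation_word; case: eqP => w0; last by rewrite scale0r.
  rewrite (wd ws wn) ?scaler0 // => wd0; apply: wsd.
  by rewrite map_rcons sumn_rcons w0 addn0 g0.
by move=> l gs _; rewrite /augmented; case: eqP gs => // ->.
Qed.

Section Zigzag.
Variable c : seq steenrod -> F2^o.
Hypotheses (cml : multilin c 5) (cwd : word_degree c 5 0 23).

(** The staircase of the double complex: start with $c$ composed with $F_0\to\mathbb F_2$, then
    alternately undo the bar differential and apply that of the resolution. *)
Fixpoint zigzag k : family :=
  if k is j.+1 then dstar j.+1 (contract (zigzag j)) else augmented c.

Lemma cochain_zigzag k : (k <= 5)%N -> cochain k (5 - k) (zigzag k).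
Proof.
elim: k => [|k IH] k5; first exact: cochain_augmented.
by apply: cochain_dstar => //; apply: cochain_contract; rewrite -subSn //; apply/IH/ltnW.
Qed.

(** Generator 7 is the only one of level 5 in internal degree 23. *)
Definition ext_class : F2^o := zigzag 5 7 [:: 1].

Hypothesis cz : forall s, size s = 6%N -> bar_diff c s = 0.

Lemma dstar_zigzag k g s a : (k < 5)%N -> size s = (5 - k)%N ->
  dstar k.+1 (zigzag k) g (rcons s a) = 0.
Proof.
case: k => [|k] k5 sk; first exact: dstar_augmented.
apply: (dstar_dstar g a _ _ sk); first by rewrite k5.
apply: cochain_contract; have -> : (5 - k.+1).+1 = (5 - k)%N by lia.
by apply: cochain_zigzag; apply/ltnW/ltnW.
Qed.

Lemma bar_left_zigzag k g s a b : (k <= 5)%N -> size s = (5 - k)%N ->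
  bar_left (zigzag k g) (rcons (rcons s a) b) = 0.
Proof.
elim: k g s a b => [|k IH] g s a b k5 sk.
  have [->|g0] := eqVneq g 0%N; first by rewrite bar_left_augmented cz ?scaler0 // size_rcons sk.
  rewrite -[RHS](@bar_left0 F2^o (rcons (rcons s a) b)); apply: eq_bar_left => t _.
  by rewrite [zigzag _ _]/= /augmented (negbTE g0).
rewrite [zigzag _]/= bar_left_dstar (@eq_dstar _ _ (zigzag k)); last first.
  move=> g' b'; have := IH g' (rcons s a) b' 1; rewrite size_rcons sk -subSn // subSS.
  by move=> /(_ (ltnW k5) (erefl _)); rewrite bar_left_contract => /eqP; rewrite addr_eq0 oppF2 => /eqP.
by apply: dstar_zigzag => //; rewrite size_rcons sk -subSn.
Qed.

Lemma bar_left_contract_zigzag k g s a : (k < 5)%N -> size s = (5 - k)%N ->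
  bar_left (contract (zigzag k) g) (rcons s a) = zigzag k g (rcons s a).
Proof.
move=> k5 sk; have := bar_left_zigzag g a 1 (ltnW k5) sk.
by rewrite bar_left_contract => /eqP; rewrite addr_eq0 oppF2 => /eqP.
Qed.
End Zigzag.

Section Vanishing.
Variable c : seq steenrod -> F2^o.
Hypotheses (cml : multilin c 5) (cwd : word_degree c 5 0 23).
Hypothesis cz : forall s, size s = 6%N -> bar_diff c s = 0.
Local Notation zig := (zigzag c).

(** With one slot left, closedness under [bar_left] reduces to the value at $1$, which for degree
    reasons is nonzero on generator 7 only. *)
Lemma zigzag_last_eq0 g a : ext_class c = 0 -> zig 5 g [:: a] = 0.
Proof.
move=> c0; have zc := cochain_zigzag cml cwd (leqnn 5).
have H : augmentation a *: zig 5 g [:: 1] + zig 5 g [:: a] = 0.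
  have := bar_left_zigzag cml cwd cz g a 1 (leqnn 5) (erefl (size [::])).
  rewrite bar_left_contract => <-; congr (_ + _).
  exact/esym/(bar_left1 (fun t => zig 5 g (rcons t 1)) a).
move/eqP: H; rewrite addr_eq0 oppF2 => /eqP <-.
suff -> : zig 5 g [:: 1] = 0 by rewrite scaler0.
have [g8|g8] := ltnP g 8; last by case: zc => _ _; apply.
have [-> //|g7] := eqVneq g 7%N.
case: zc => _ /(_ g)/(_ [:: [::]] (erefl _)) + _; rewrite [map word _]/= word_nil; apply.
by rewrite addn0; case: g g8 g7 => [|[|[|[|[|[|[|[|]]]]]]]].
Qed.

(** The way back down the staircase: [w] is [contract (zigzag k)] changed by a bar coboundary so as
    to be closed under [dstar]. For $k=4$ no change is made and closedness is the vanishing of the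
    number. *)
Lemma zigzag_descent k : (k <= 4)%N -> ext_class c = 0 -> exists w,
  [/\ cochain k (4 - k) w,
    forall g s a, size s = (4 - k)%N -> dstar k.+1 w g (rcons s a) = 0 &
    forall g s a, size s = (5 - k)%N -> bar_left (w g) (rcons s a) = zig k g (rcons s a)].
Proof.
move=> k4 c0; have -> : k = (4 - (4 - k))%N by rewrite subKn.
elim: (4 - k)%N (leq_subr k 4) => [|j IH] j4.
  rewrite subn0; exists (contract (zig 4)); split.
  - exact/cochain_contract/(cochain_zigzag cml cwd).
  - by move=> g s a /size0nil ->; apply: zigzag_last_eq0.
  by move=> g s a sk; apply: bar_left_contract_zigzag.
have [w [wc dw bw]] := IH (ltnW j4).
have E : (4 - j = (4 - j.+1).+1)%N by rewrite -subSn.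
move: wc dw bw; rewrite E; set i := (4 - j.+1)%N => wc dw bw.
have i3 : (i < 4)%N by rewrite -ltnS -E ltnS leq_subr.
have i4 : (4 - i = (4 - i.+1).+1)%N by rewrite -subSn.
have i5 : (5 - i = (4 - i.+1).+2)%N by rewrite subSn -?i4 // ltnW.
have ex : forall g s a, size s = (4 - i.+1)%N -> w g (rcons s a) = dstar i.+1 (pullback i w) g (rcons s a).
  exact: exact_pos wc dw.
pose y := pullback i w.
have yc : cochain i (4 - i.+1) y by apply: cochain_pullback => //; apply: ltnW.
have zc : cochain i (5 - i) (zig i) by apply: (cochain_zigzag cml cwd); do 2 apply: ltnW.
(* Exactness gives [w = dstar y]. Applying [dstar] to the correction [bar_left y] yields
   [bar_left w], which is exactly [dstar] of the first summand. *)
exists (fun g l => contract (zig i) g l + bar_left_family y g l); split.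
- apply: cochainD; last by rewrite i4; apply: cochain_bar_left.
  by apply: cochain_contract; rewrite i4 -i5.
- move=> g s a; rewrite i4; case/lastP: s => // s b; rewrite size_rcons => -[sp].
  rewrite dstarD -bar_left_dstar.
  have -> : bar_left (dstar i.+1 y g) (rcons (rcons s b) a) = bar_left (w g) (rcons (rcons s b) a).
    apply: eq_bar_left => t; case/lastP: t => [|t d]; rewrite !size_rcons => -[] // st.
    by rewrite ex // st sp.
  rewrite bw; last by rewrite size_rcons sp; lia.
  exact: addF2.
move=> g s a sk; rewrite bar_leftD bar_left_left ?addr0; last by rewrite size_rcons sk i5.
apply: (bar_left_contract_zigzag cml cwd cz) => //; exact: ltnW.
Qed.

(** At level 0 the closed family factors through the augmentation, hence comes from a bar cochain,
    and that cochain bounds [c]. *)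
Lemma ext_class_vanishing : ext_class c = 0 -> exists b,
  [/\ multilin b 4, word_degree b 4 0 23 & forall s, size s = 5%N -> c s = bar_diff b s].
Proof.
move=> /(zigzag_descent (leq0n 4))[w [wc dw bw]]; pose b s := w 0%N (rcons s 1).
have e0 := exact_zero wc dw; exists b; split.
- move=> s t k x y st; rewrite /b !rcons_cat !rcons_cons; case: wc => ml _ _.
  by apply: ml; rewrite size_rcons addnS st.
- move=> ws wn wsd; rewrite /b -word_nil -map_rcons; case: wc => _ wd _; apply: wd.
    by rewrite size_rcons wn.
  by rewrite map_rcons sumn_rcons addn0.
move=> s; case/lastP: s => // s a; rewrite size_rcons => -[s4].
have := bw 0%N (rcons s a) 1; rewrite size_rcons s4 => /(_ (erefl _)).
rewrite [zigzag _ _]/= augmented_rcons bar_left_contract (e0 s a s4) bar_diff_rcons => ->.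
by rewrite -word_nil augmentation_word eqxx scale1r.
Qed.
End Vanishing.

Section CoboundaryClass.
Variable b : seq steenrod -> F2^o.
Hypotheses (bml : multilin b 4) (bwd : word_degree b 4 0 23).

Fixpoint zigzag_primitive k : family :=
  if k is j.+1 then dstar j.+1 (contract (zigzag_primitive j)) else augmented b.

Lemma cochain_zigzag_primitive k : (k <= 4)%N -> cochain k (4 - k) (zigzag_primitive k).
Proof.
elim: k => [|k IH] k4; first exact: cochain_augmented.
apply: cochain_dstar; first exact: ltnW.
by apply: cochain_contract; rewrite -subSn //; apply/IH/ltnW.
Qed.

Lemma dstar_zigzag_primitive k g s a : (k < 5)%N -> size s = (4 - k)%N ->
  dstar k.+1 (zigzag_primitive k) g (rcons s a) = 0.
Proof.
case: k => [|k] k5 sk; first exact: dstar_augmented.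
apply: (dstar_dstar g a _ _ sk); first by rewrite k5.
apply: cochain_contract; have -> : (4 - k.+1).+1 = (4 - k)%N by lia.
by apply: cochain_zigzag_primitive; apply/ltnW.
Qed.

Lemma zigzag_coboundary k g s a : (k <= 4)%N -> size s = (5 - k)%N ->
  zigzag (bar_diff b) k g (rcons s a) = bar_left (zigzag_primitive k g) (rcons s a).
Proof.
elim: k g s a => [|k IH] g s a k4 sk.
  case/lastP: s sk => // s d _; have [->|g0] := eqVneq g 0%N.
    by rewrite [zigzag _ _]/= augmented_rcons bar_left_augmented.
  rewrite [zigzag _ _]/= {1}/augmented (negbTE g0).
  rewrite -(@bar_left0 F2^o (rcons (rcons s d) a)); apply: eq_bar_left => t _.
  by rewrite [zigzag_primitive _ _]/= /augmented (negbTE g0).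
have k5 : (5 - k = (5 - k.+1).+1)%N by rewrite -subSn // ltnW.
case/lastP: s sk => [|s d] sk; first by move: sk; case: (k) k4 => [|[|[|[|]]]].
rewrite [zigzag_primitive _]/= bar_left_dstar [zigzag _ _]/=.
rewrite (@eq_dstar _ _ (fun g' l => bar_left_family (contract (zigzag_primitive k)) g' l +
   zigzag_primitive k g' l)) => [|g' b'].
  have sk' : size (rcons s d) = (4 - k)%N by rewrite sk; lia.
  by rewrite dstarD (dstar_zigzag_primitive g a (ltnW k4) sk') addr0.
rewrite /contract IH ?size_rcons ?(ltnW k4) //; last by rewrite k5 -sk size_rcons.
by rewrite bar_left_contract.
Qed.

(** The zigzag of a coboundary is [bar_left] of the zigzag of the bounding cochain. In the last step
    the surplus terms carry augmentations of coefficients of $d$, and these vanish because the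
    resolution is minimal. *)
Lemma ext_class_coboundary : ext_class (bar_diff b) = 0.
Proof.
have d4 := @dstar_zigzag_primitive 4 7 [::] 1 isT erefl.
rewrite -[RHS]d4 /ext_class.
rewrite -[LHS]/(dstar 5 (contract (zigzag (bar_diff b) 4)) 7 (rcons [::] 1)) !dstar_rcons.
rewrite big_seq [RHS]big_seq; apply: eq_bigr => y yg.
rewrite -[LHS]/(zigzag (bar_diff b) 4 y.1 (rcons (rcons [::] (1 * word y.2)) 1)).
rewrite zigzag_coboundary // bar_left_contract mul1r.
rewrite (bar_left1 (fun t => zigzag_primitive 4 y.1 (rcons t 1)) (word y.2)).
have [_ y0 _] := resolution_degree (isT : 4 < 5)%N yg.
by rewrite augmentation_word eqn0Ngt y0 scale0r add0r.
Qed.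
End CoboundaryClass.


(* The chain map from the resolution to the modules [P_k] lifting the iterated
   extension: the values on the generators. *)
Fixpoint transfer_poly k (g : nat) : Pol k :=
  if k is j.+1 return Pol k then
    \sum_(y <- nth [::] (diff j.+1) g) e1_cocycle (word y.2) (transfer_poly j y.1)
  else if g == 0%N then 1 else 0.

(** * The number attached to a transfer cocycle *)

Lemma zigzag_step k (L : Pol k.+1 -> F2^o) z g s : linear L ->
  (forall g' b, z g' (rcons (rcons s b) 1) = L (e1_cocycle b (transfer_poly k g'))) ->
  dstar k.+1 (contract z) g (rcons s 1) = L (transfer_poly k.+1 g).
Proof.
move=> Ll zE; rewrite dstar_rcons [transfer_poly _ _]/= (lin_sum Ll); apply: eq_bigr => y _.
by rewrite /contract zE mul1r.
Qed.

(** [L1] to [L4] keep the outer factors of the iterated cocycle, while each step of the zigzag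
    absorbs the innermost factor into the polynomial of a generator. *)
Lemma ext_class_transfer f : linear f ->
  ext_class (fun l => f (e_seq 5 l)) = f (transfer_poly 5 7).
Proof.
move=> fl; pose c l := f (e_seq 5 l); rewrite -/c.
have l1 (k : nat) (L : Pol k.+1 -> F2^o) a : linear L -> linear (fun p => L (e1_cocycle a p)).
  by move=> Ll u p q; rewrite (e1_cocycle_linear a u p q) Ll.
pose L1 a1 p := f (e1_cocycle a1 p); pose L2 a1 a2 p := L1 a1 (e1_cocycle a2 p).
pose L3 a1 a2 a3 p := L2 a1 a2 (e1_cocycle a3 p).
pose L4 a1 a2 a3 a4 p := L3 a1 a2 a3 (e1_cocycle a4 p).
have H0 a1 a2 a3 a4 g b : zigzag c 0 g (rcons (rcons [:: a1; a2; a3; a4] b) 1) =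
    L4 a1 a2 a3 a4 (e1_cocycle b (transfer_poly 0 g)).
  rewrite [zigzag _ _]/=; case: (eqVneq g 0%N) => [->|g0].
    rewrite augmented_rcons -word_nil augmentation_word eqxx scale1r.
    by rewrite /L4 /L3 /L2 /L1 /c /transfer_poly eqxx.
  rewrite /augmented (negbTE g0) /transfer_poly (negbTE g0) (lin0 (e1_cocycle_linear b)).
  exact/esym/(lin0 (l1 _ _ a4 (l1 _ _ a3 (l1 _ _ a2 (l1 _ _ a1 fl))))).
have H1 a1 a2 a3 g b : zigzag c 1 g (rcons (rcons [:: a1; a2; a3] b) 1) =
    L3 a1 a2 a3 (e1_cocycle b (transfer_poly 1 g)).
  apply: (@zigzag_step 0 (L4 a1 a2 a3 b) (zigzag c 0) g [:: a1; a2; a3; b]); last exact: H0.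
  exact: l1 (l1 _ _ a3 (l1 _ _ a2 (l1 _ _ a1 fl))).
have H2 a1 a2 g b : zigzag c 2 g (rcons (rcons [:: a1; a2] b) 1) =
    L2 a1 a2 (e1_cocycle b (transfer_poly 2 g)).
  apply: (@zigzag_step 1 (L3 a1 a2 b) (zigzag c 1) g [:: a1; a2; b]); last exact: H1.
  exact: l1 (l1 _ _ a2 (l1 _ _ a1 fl)).
have H3 a1 g b : zigzag c 3 g (rcons (rcons [:: a1] b) 1) =
    L1 a1 (e1_cocycle b (transfer_poly 3 g)).
  apply: (@zigzag_step 2 (L2 a1 b) (zigzag c 2) g [:: a1; b]); last exact: H2.
  exact: l1 (l1 _ _ a1 fl).
have H4 g b : zigzag c 4 g (rcons (rcons [::] b) 1) = f (e1_cocycle b (transfer_poly 4 g)).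
  apply: (@zigzag_step 3 (L1 b) (zigzag c 3) g [:: b]); last exact: H3.
  exact: l1 fl.
exact: (@zigzag_step 4 f (zigzag c 4) 7 [::] fl H4).
Qed.

(** * Setting the first variable to zero *)

Section DropFirst.

Definition drop_first k (p : Pol k.+1) : Pol k :=
  p \mPo [tuple if unlift ord0 i is Some j then 'X_j else 0 | i < k.+1].

Lemma drop_firstC k c : @drop_first k c%:MP_[k.+1] = c%:MP_[k].
Proof. exact: comp_mpolyC. Qed.

Lemma drop_firstX0 k : @drop_first k 'X_ord0 = 0.
Proof. by rewrite /drop_first comp_mpolyXU -tnth_nth tnth_mktuple unlift_none. Qed.

Lemma drop_firstX k j : @drop_first k 'X_(lift ord0 j) = 'X_j.
Proof. by rewrite /drop_first comp_mpolyXU -tnth_nth tnth_mktuple liftK. Qed.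

Lemma drop_firstM k p q : @drop_first k (p * q) = drop_first p * drop_first q.
Proof. by rewrite /drop_first rmorphM. Qed.
Lemma drop_firstD k p q : @drop_first k (p + q) = drop_first p + drop_first q.
Proof. exact: comp_mpolyD. Qed.
Lemma drop_firstZ k c p : @drop_first k (c *: p) = c *: drop_first p.
Proof. exact: comp_mpolyZ. Qed.
Lemma drop_first_linear k : linear (@drop_first k).
Proof. by move=> c p q; rewrite drop_firstD drop_firstZ. Qed.
Lemma drop_first1 k : @drop_first k 1 = 1.
Proof. exact: drop_firstC. Qed.
Lemma drop_firstXn k p n : @drop_first k (p ^+ n) = drop_first p ^+ n.
Proof. by elim: n => [|n IH]; rewrite ?expr0 ?drop_first1 // !exprS drop_firstM IH. Qed.

Lemma drop_first_max k : @drop_first k.+1 'X_ord_max = 'X_ord_max.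
Proof.
rewrite -(drop_firstX (@ord_max k)); congr (drop_first 'X_[U_(_)]).
exact/val_inj.
Qed.

Lemma drop_first_Sq k i p : @drop_first k (Sq i p) = Sq i (drop_first p).
Proof.
rewrite /Sq !total_SqE.
rewrite (@total_square_subst F2 k.+1 k (comp_mpoly _ : {rmorphism Pol k.+1 -> Pol k})) /=.
- by rewrite coef_map.
- exact: drop_firstC.
move=> j; rewrite -/(drop_first _); case: (unliftP ord0 j) => [j' ->|->].
  by rewrite drop_firstX total_squareX.
by rewrite drop_firstX0 raddf0 expr0n /= mul0r addr0.
Qed.

Lemma drop_first_mwiden k p : @drop_first k.+1 (mwiden p) = mwiden (drop_first p).
Proof.
elim/mpoly_mulX_ind: p => [p q IHp IHq|c p IH||l p IH].
- by rewrite mwidenD !drop_firstD mwidenD; congr (_ + _); [exact: IHp | exact: IHq].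
- by rewrite mwidenZ !drop_firstZ mwidenZ; congr (_ *: _); exact: IH.
- by rewrite mwiden1 !drop_first1 mwiden1.
rewrite mwidenM (drop_firstM (mwiden _)) (drop_firstM 'X_l) mwidenM; congr (_ * _); last exact: IH.
rewrite mwiden_var; case: (unliftP ord0 l) => [l' ->|->].
  have -> : widen_ord (leqnSn k.+1) (lift ord0 l') = lift ord0 (widen_ord (leqnSn k) l') by apply/val_inj.
  by rewrite !drop_firstX mwiden_var.
have -> : widen_ord (leqnSn k.+1) ord0 = ord0 by apply/val_inj.
by rewrite !drop_firstX0 mwiden0.
Qed.

(** The cocycle adjoins a last variable and leaves the first alone; this lets $f_0(u)$ be computed
    in four variables. *)
Lemma drop_first_e1 k a p : drop_first (e1_cocycle a p) = e1_cocycle a (@drop_first k p).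
Proof.
pose phi (u : hatP k.+1) : hatP k := (drop_first u.1, drop_first u.2).
have phil : linear phi by move=> c u v; congr (_, _); exact: drop_first_linear.
have phi2 u : (phi u).2 = drop_first u.2 by [].
have E i u : phi (hat_Sq i u) = hat_Sq i (phi u).
  rewrite /phi !hat_SqE; congr (_, _); first by rewrite drop_first_Sq.
  rewrite /fst /snd drop_firstD drop_first_Sq; congr (_ + _).
  rewrite (lin_sum (@drop_first_linear _)); apply: eq_bigr => l _.
  by rewrite drop_firstM drop_firstXn drop_first_max drop_first_mwiden drop_first_Sq.
have := congr1 snd (act_equivariant phil a (p, 0) E); rewrite phi2 => ->.
by rewrite /e1_cocycle /phi /fst /snd (lin0 (@drop_first_linear _)).
Qed.

Lemma act_drop_first k a p : act (@Sq k) a (drop_first p) = drop_first (act (@Sq k.+1) a p).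
Proof.
by apply/esym/(act_equivariant (@drop_first_linear k)) => i q; rewrite drop_first_Sq.
Qed.
End DropFirst.


(** The monomials of $\mathcal P_4$ in degree 18 on which the form takes the value $1$;
    [primitive_support_check] certifies that it is primitive. *)
Definition primitive_support : seq (seq nat) := [::
  [::9;3;3;3]; [::7;3;5;3]; [::5;5;5;3]; [::5;5;3;5]; [::5;3;5;5]; [::4;6;5;3];
  [::4;6;3;5]; [::4;5;6;3]; [::4;5;3;6]; [::4;3;6;5]; [::4;3;5;6]; [::3;6;6;3];
  [::3;6;3;6]; [::3;3;6;6]; [::2;8;5;3]; [::2;8;3;5]; [::2;7;6;3]; [::2;7;3;6];
  [::2;5;6;5]; [::2;5;5;6]; [::2;4;9;3]; [::2;4;7;5]; [::2;4;5;7]; [::2;4;3;9];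
  [::2;3;10;3]; [::2;3;7;6]; [::2;3;6;7]; [::2;3;3;10]; [::2;2;11;3]; [::2;2;9;5];
  [::2;2;7;7]; [::2;2;5;9]; [::2;2;3;11]; [::2;1;12;3]; [::2;1;10;5]; [::2;1;8;7];
  [::2;1;6;9]; [::2;1;4;11]; [::2;1;2;13]; [::2;1;1;14]; [::1;11;3;3]; [::1;8;6;3];
  [::1;8;3;6]; [::1;7;5;5]; [::1;6;6;5]; [::1;6;5;6]; [::1;4;10;3]; [::1;4;7;6];
  [::1;4;6;7]; [::1;4;3;10]; [::1;3;11;3]; [::1;3;9;5]; [::1;3;5;9]; [::1;3;3;11];
  [::1;2;12;3]; [::1;2;9;6]; [::1;2;8;7]; [::1;2;5;10]; [::1;2;4;11]; [::1;2;2;13];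
  [::1;2;1;14]; [::1;1;13;3]; [::1;1;10;6]; [::1;1;9;7]; [::1;1;6;10]; [::1;1;5;11]]%N.

(** * Computing with lists of exponents *)

Section Monomials.

Definition exponents k (w : seq nat) : 'X_{1..k} := [multinom nth 0%N w i | i < k].

(** The Cartan formula one variable at a time, with $Sq^l x^e=\binom{e}{l}x^{e+l}$ for the last
    one. *)
Fixpoint sq_mon k (w : seq nat) i : seq (seq nat) :=
  if k is j.+1 then
    flatten [seq [seq rcons u (nth 0 w j + l) | u <- sq_mon j w (i - l)] |
      l <- [seq l <- iota 0 i.+1 | bin2 (nth 0 w j).+1 (nth 0 w j) l]]%N
  else if i == 0%N then [:: [::]] else [::].

Lemma exponents_rcons k u a : size u = k ->
  'X_[exponents k.+1 (rcons u a)] = mwiden 'X_[exponents k u] * 'X_ord_max ^+ a :> Pol k.+1.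
Proof.
move=> uk; rewrite mwidenX mpolyXn -mpolyXD; congr 'X_[_]; apply/mnmP => i.
rewrite mnmDE mulmnE mnm1E mnmE nth_rcons uk.
have [ik|ik] := ltnP i k.
  have -> : i = widen_ord (leqnSn k) (Ordinal ik) by apply/val_inj.
  by rewrite mnmwiden_widen mnmE -val_eqE /= gtn_eqF ?addn0.
have -> : i = ord_max by apply/val_inj/anti_leq; rewrite ik -ltnS ltn_ord.
by rewrite mnmwiden_ordmax eqxx /= eqxx mul1n.
Qed.

Lemma exponents_last k w :
  'X_[exponents k.+1 w] = mwiden 'X_[exponents k w] * 'X_ord_max ^+ nth 0%N w k :> Pol k.+1.
Proof.
have E : exponents k w = exponents k (mkseq (nth 0%N w) k).
  by apply/mnmP => i; rewrite !mnmE nth_mkseq.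
rewrite E -exponents_rcons ?size_mkseq //; congr 'X_[_]; apply/mnmP => i.
rewrite !mnmE nth_rcons size_mkseq; have := ltn_ord i; rewrite ltnS leq_eqVlt.
by case/orP => [/eqP ->|ik]; rewrite ?ltnn ?eqxx // ik nth_mkseq.
Qed.

Lemma sq_monS k w i : sq_mon k.+1 w i =
  flatten [seq [seq rcons u (nth 0 w k + l) | u <- sq_mon k w (i - l)] |
      l <- [seq l <- iota 0 i.+1 | bin2 (nth 0 w k).+1 (nth 0 w k) l]]%N.
Proof. by []. Qed.

Lemma size_sq_mon k w i u : u \in sq_mon k w i -> size u = k.
Proof.
elim: k i u => [|k IH] i u; first by rewrite /sq_mon; case: ifP => // _; rewrite inE => /eqP ->.
by rewrite sq_monS => /flatten_mapP[l _ /mapP[v /IH vk ->]]; rewrite size_rcons vk.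
Qed.

Lemma Sq_mwiden_exp k i a (p : Pol k) : Sq i (mwiden p * 'X_ord_max ^+ a) =
  \sum_(l < i.+1) (mwiden (Sq (i - l) p) * 'X_ord_max ^+ (a + l)) *+ 'C(a, l).
Proof.
have H l : (total_square ('X_ord_max ^+ a : Pol k.+1))`_l = 'X_ord_max ^+ (a + l) *+ 'C(a, l).
  rewrite rmorphXn /= total_squareX exprDn coef_sum.
  have E (j : 'I_a.+1) : ((('X_ord_max : Pol k.+1)%:P ^+ (a - j) * (('X_ord_max ^+ 2)%:P * 'X) ^+ j) *+
      'C(a, j))`_l = if j == l :> nat then 'X_ord_max ^+ (a + l) *+ 'C(a, l) else 0.
    rewrite exprMn -!polyC_exp mulrA -polyCM coefMn coefCM coefXn eq_sym.
    case: eqP => [<-|_]; last by rewrite mulr0 mul0rn.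
    rewrite mulr1 -exprM -exprD; congr (_ ^+ _ *+ _).
    by have := ltn_ord j; lia.
  rewrite (eq_bigr _ (fun j _ => E j)) -big_mkcond /=.
  have [la|la] := ltnP l a.+1; first by rewrite (big_pred1 (Ordinal la)).
  rewrite bin_small // big1 // => j /eqP jl; have := ltn_ord j; lia.
rewrite /Sq total_SqE rmorphM coefMr; apply: eq_bigr => l _.
have E : (total_square (mwiden p))`_(i - l) = mwiden (Sq (i - l) p).
  exact: etrans (congr1 (fun q : {poly (Pol k.+1)} => q`_(i - l)) (esym (total_SqE (mwiden p))))
    (Sq_mwiden (i - l) p).
exact: etrans (congr2 *%R E (H l)) (mulrnAr _ _ _).
Qed.

Lemma Sq_exponents k w i :
  Sq i ('X_[exponents k w] : Pol k) = \sum_(u <- sq_mon k w i) 'X_[exponents k u].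
Proof.
elim: k w i => [|k IH] w i.
  have E v : 'X_[exponents 0 v] = 1 :> Pol 0.
    by rewrite -mpolyX0; congr 'X_[_]; apply/mnmP => -[].
  by rewrite E Sq1 /=; case: eqP => _; rewrite ?big_seq1 ?E ?big_nil.
rewrite exponents_last Sq_mwiden_exp sq_monS big_flatten big_map big_filter.
rewrite -(big_mkord xpredT (fun l => (mwiden (Sq (i - l) 'X_[exponents k w]) *
  'X_ord_max ^+ (nth 0%N w k + l)) *+ 'C(nth 0%N w k, l))) /index_iota subn0 [RHS]big_mkcond.
apply: eq_bigr => l _; rewrite mulrnF2 bin2E //; case: ifP => // _.
rewrite IH (big_morph _ (@mwidenD _ _) (@mwiden0 _ _)) mulr_suml big_map.
rewrite big_seq [RHS]big_seq; apply: eq_bigr => u /size_sq_mon uk.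
by rewrite exponents_rcons.
Qed.

Definition sq_poly k i X := foldr (fun w => add2 (sq_mon k w i)) [::] X.

Definition cocycle_letter k i X :=
  foldr (fun j => add2 [seq rcons u j | u <- sq_poly k (i - j.+1)%N X]) [::] (iota 0 i).

Fixpoint cocycle_word k J X :=
  if J is i :: J' then
    add2 (cocycle_letter k i (foldr (sq_poly k) X J')) (sq_poly k.+1 i (cocycle_word k J' X))
  else [::].

Definition poly_of k X : Pol k := \sum_(u <- X) 'X_[exponents k u].

Lemma poly_of_add2 k X Y : poly_of k (add2 X Y) = poly_of k X + poly_of k Y.
Proof. exact: sum_add2. Qed.

Lemma size_sq_poly k i X u : u \in sq_poly k i X -> size u = k.
Proof.
elim: X => //= w X IH /mem_add2/orP[|/IH //]; exact: size_sq_mon.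
Qed.

Lemma sq_polyE k i X : Sq i (poly_of k X) = poly_of k (sq_poly k i X).
Proof.
rewrite /poly_of /sq_poly (sum_foldr_add2 _ (fun w => sq_mon k w i)) Sq_sum.
by apply: eq_bigr => w _; apply: Sq_exponents.
Qed.

Lemma cocycle_letterE k i X :
  e1_cocycle (word [:: i]) (poly_of k X) = poly_of k.+1 (cocycle_letter k i X).
Proof.
rewrite e1_letter [RHS]/poly_of /cocycle_letter sum_foldr_add2 /index_iota subn0.
apply: eq_bigr => j _; rewrite sq_polyE /poly_of big_map.
rewrite (big_morph _ (@mwidenD _ _) (@mwiden0 _ _)) mulr_suml big_seq [RHS]big_seq.
by apply: eq_bigr => u /size_sq_poly uk; rewrite exponents_rcons.
Qed.

Lemma cocycle_wordE k J X :
  e1_cocycle (word J) (poly_of k X) = poly_of k.+1 (cocycle_word k J X).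
Proof.
elim: J => [|i J IH].
  by rewrite /e1_cocycle (act_word (@hat_adem k)) /poly_of big_nil.
rewrite word_cons e1_cocycleM [cocycle_word _ _ _]/= poly_of_add2; congr (_ + _).
  rewrite (act_word (Pol_adem k)) -cocycle_letterE; congr e1_cocycle.
  by elim: (J) => //= j J' ->; rewrite sq_polyE.
by rewrite (act_word (Pol_adem k.+1)) [foldr _ (e1_cocycle _ _) _]/= -sq_polyE IH.
Qed.

Fixpoint monomials (k d : nat) : seq (seq nat) :=
  if k is j.+1 then flatten [seq [seq rcons v a | v <- monomials j (d - a)%N] | a <- iota 0 d.+1]
  else if d == 0%N then [:: [::]] else [::].

Lemma mem_monomials v : v \in monomials (size v) (sumn v).
Proof.
elim/last_ind: v => // v a IH; rewrite size_rcons sumn_rcons; apply/flatten_mapP; exists a.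
  by rewrite mem_iota add0n ltnS leq_addl.
by apply/map_f; rewrite addnK.
Qed.

Lemma mdeg_exponents k v : size v = k -> mdeg (exponents k v) = sumn v.
Proof.
move=> vk; rewrite mdegE sumnE (big_nth 0%N) big_mkord vk.
by apply: eq_bigr => i _; rewrite mnmE.
Qed.

Lemma monomials_complete k (m : 'X_{1..k}) :
  exists2 v, v \in monomials k (mdeg m) & m = exponents k v.
Proof.
pose v : seq nat := codom m; have vk : size v = k by rewrite size_codom card_ord.
have mE : m = exponents k v.
  apply/mnmP => i; rewrite mnmE /v /codom /image_mem (nth_map i) ?size_enum_ord //.
  by rewrite nth_ord_enum.
exists v => //; rewrite mE mdeg_exponents // -{1}vk.
exact: mem_monomials.
Qed.

Lemma exponents_inj k u v : size u = k -> size v = k -> exponents k u = exponents k v -> u = v.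
Proof.
move=> uk vk /mnmP E; apply: (@eq_from_nth _ 0%N) => [|i]; rewrite ?uk ?vk // => ik.
by have := E (Ordinal ik); rewrite !mnmE.
Qed.

End Monomials.

(** * Forms given by a set of monomials *)

Section MonomialSupport.
Variables (k n : nat) (S : seq (seq nat)).
Hypothesis S_size : all (fun u => (size u == k) && (sumn u == n)) S.
Hypothesis S_uniq : uniq S.

Definition support_form (p : Pol k) : F2^o := \sum_(u <- S) p@_(exponents k u).

Lemma support_form_linear : linear support_form.
Proof.
move=> c p q; rewrite /support_form scaler_sumr -big_split; apply: eq_bigr => u _.
by rewrite mcoeffD mcoeffZ.
Qed.

Lemma support_form_monomial v : size v = k -> support_form 'X_[exponents k v] = (v \in S)%:R.
Proof.
move=> vk; rewrite /support_form big_seq.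
have E u : u \in S -> ('X_[exponents k v] : Pol k)@_(exponents k u) = if u == v then 1 else 0.
  move=> /(allP S_size)/andP[/eqP uk _]; rewrite mcoeffX.
  have [->|uv] := eqVneq u v; first by rewrite eqxx.
  by case: eqP => // /exponents_inj E; rewrite E ?eqxx in uv.
rewrite (eq_bigr _ E) -big_seq -big_mkcond /=.
have [vS|vS] := boolP (v \in S); last first.
  by rewrite big_seq_cond big1 // => u /andP[uS /eqP uv]; rewrite -uv uS in vS.
by rewrite -big_filter (filter_pred1_uniq S_uniq vS) big_seq1.
Qed.

Lemma support_form_poly X : all (fun u => size u == k) X ->
  support_form (poly_of k X) = (odd (count (mem S) X))%:R.
Proof.
elim: X => [|u X IH] /=; first by rewrite /poly_of big_nil (lin0 support_form_linear).
move=> /andP[/eqP uk /IH {}IH].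
rewrite /poly_of big_cons (linD support_form_linear) support_form_monomial // [X in _ + X]IH oddD.
by case: (u \in S); case: odd; apply/val_inj.
Qed.

Definition primitive_ok := all (fun d => all (fun v =>
  ~~ odd (count (mem S) (sq_mon k v (n - d)%N))) (monomials k d)) (iota 0 n).

Hypothesis S_ok : primitive_ok.

Lemma size_monomials j d v : v \in monomials j d -> size v = j.
Proof.
elim: j d v => [|j IH] d v; first by rewrite /monomials; case: ifP => // _; rewrite inE => /eqP ->.
by move=> /flatten_mapP[a _ /mapP[u /IH uj ->]]; rewrite size_rcons uj.
Qed.

Lemma support_form_degree (w : 'X_{1..k}) : mdeg w <> n -> support_form 'X_[w] = 0.
Proof.
have [v vm ->] := monomials_complete w; have vk := size_monomials vm.
rewrite mdeg_exponents // support_form_monomial // => vn.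
by case: (boolP (v \in S)) => // /(allP S_size)/andP[_ /eqP].
Qed.

Lemma support_form_Sq i (p : Pol k) : (0 < i)%N -> support_form (Sq i p) = 0.
Proof.
move=> i0; rewrite [p]mpolyE Sq_sum (lin_sum support_form_linear); apply: big1 => w _.
rewrite SqZ (linZ support_form_linear); suff -> : support_form (Sq i 'X_[w]) = 0 by rewrite scaler0.
have [wi|wi] := eqVneq (mdeg w + i)%N n; last first.
  have /dhomog_mf hp := Sq_mon_homog i w.
  rewrite [Sq i _]mpolyE (lin_sum support_form_linear) big_seq big1 // => u /hp ui.
  by rewrite (linZ support_form_linear) support_form_degree ?scaler0 // ui; apply/eqP.
have [v vm wE] := monomials_complete w.
rewrite wE Sq_exponents -/(poly_of k _) support_form_poly; last first.
  by apply/allP => u /size_sq_mon ->.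
have dn : (mdeg w < n)%N by rewrite -wi -addn1 leq_add2l.
have := allP S_ok (mdeg w); rewrite mem_iota add0n => /(_ dn)/allP/(_ v vm).
have -> : (n - mdeg w = i)%N by rewrite -wi addKn.
by move=> /negbTE ->.
Qed.

(** Single squares are enough: in a word of positive degree the first nonzero letter is applied
    last, up to identities. *)
Lemma support_form_primitive : support_form \in @primitive k n.
Proof.
have sl := support_form_linear; apply/asboolP; split=> //; first exact: support_form_degree.
move=> d a p d0 /word_sum_homogeneous[s sd ->].
rewrite /words (act_suml (Pol_adem k)) (lin_sum sl) big_seq big1 // => w /sd wd.
rewrite (act_word (Pol_adem k)).
suff H v : (0 < sumn v)%N -> support_form (foldr (@Sq k) p v) = 0 by apply: H; rewrite wd.
elim: v => //= i v IH; case: i => [|i] iv; last exact: support_form_Sq.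
by rewrite Sq0; apply: IH.
Qed.
End MonomialSupport.

(** The polynomials [transfer_poly] at $x_1=0$, hence with one variable fewer. At the start only the
    generator with boundary $Sq^1$ survives, as the cocycle sends $Sq^{i+1}$ and $1$ to $x^i$. *)
Fixpoint transfer_lists k : seq (seq (seq nat)) :=
  if k is j.+1 then let prev := transfer_lists j in
    [seq foldr (fun y => add2 (cocycle_word j y.2 (nth [::] prev y.1))) [::] x | x <- diff j.+2]
  else [:: [:: [::]]].

Lemma transfer_listsE k g : (k < 5)%N ->
  drop_first (transfer_poly k.+1 g) = poly_of k (nth [::] (transfer_lists k) g).
Proof.
have E0 i : drop_first (e1_cocycle (word [:: i.+1]) (1 : Pol 0)) = (i == 0%N)%:R.
  rewrite e1_letter (lin_sum (@drop_first_linear 0)) big_nat_recl //= big1 ?addr0 => [|j _].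
    rewrite drop_firstM drop_firstXn expr0 mulr1 Sq1; case: i => [|i] /=.
      by rewrite mwiden1 drop_first1.
    by rewrite mwiden0 (lin0 (@drop_first_linear 0)).
  rewrite drop_firstM drop_firstXn exprS.
  have -> : ord_max = ord0 :> 'I_1 by apply/val_inj.
  by rewrite drop_firstX0 mul0r mulr0.
elim: k g => [|k IH] g k5.
  have P0 : poly_of 0 [:: [::]] = 1.
    by rewrite /poly_of big_seq1 -mpolyX0; congr 'X_[_]; apply/mnmP => -[].
  rewrite [transfer_poly _ _]/=; case: g => [|[|[|[|[|g]]]]] /=; rewrite ?big_seq1 ?nth_nil.
  - by rewrite E0 P0.
  - by rewrite E0 /poly_of big_nil.
  - by rewrite E0 /poly_of big_nil.
  - by rewrite E0 /poly_of big_nil.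
  - by rewrite E0 /poly_of big_nil.
  by rewrite big_nil (lin0 (@drop_first_linear 0)) /poly_of big_nil.
have -> : transfer_poly k.+2 g = \sum_(y <- nth [::] (diff k.+2) g)
    e1_cocycle (word y.2) (transfer_poly k.+1 y.1) by [].
rewrite (lin_sum (@drop_first_linear _)).
have -> : transfer_lists k.+1 = [seq foldr (fun y => add2 (cocycle_word k y.2
    (nth [::] (transfer_lists k) y.1))) [::] x | x <- diff k.+2] by [].
have [gs|gs] := ltnP g (size (diff k.+2)); last first.
  have e1 : nth [::] (diff k.+2) g = [::] by apply: nth_default.
  have e2 f : nth [::] [seq f x | x <- diff k.+2] g = [::] :> seq (seq nat).
    by apply: nth_default; rewrite size_map.
  by rewrite e1 e2 /poly_of [LHS]big_nil [RHS]big_nil.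
rewrite (nth_map [::]) // /poly_of sum_foldr_add2; apply: eq_bigr => y _.
by rewrite drop_first_e1 IH ?cocycle_wordE // ltnW.
Qed.

Lemma primitive_support_check : [&& uniq primitive_support,
  all (fun u => (size u == 4) && (sumn u == 18)) primitive_support, primitive_ok 4 18 primitive_support &
  all (fun u => size u == 4) (nth [::] (transfer_lists 4) 7) &&
    odd (count (mem primitive_support) (nth [::] (transfer_lists 4) 7))].
Proof. by vm_compute. Qed.

(** The product of the form dual to $1$ in the first variable, whose transfer is $h_0$, with a
    primitive form on $\mathcal P_4$. It mirrors the factorization $h_0f_0$ of the target class. *)
Definition base_form (p : Pol 5) : F2^o :=
  @support_form 4 primitive_support (drop_first p).

Lemma drop_first_monomial k (w : 'X_{1..k.+1}) :
  (exists2 w', drop_first 'X_[w] = 'X_[w'] & mdeg w' = mdeg w) \/ drop_first ('X_[w] : Pol k.+1) = 0.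
Proof.
elim/mnm_ind: w => [|i w [[w' E dw]|E]].
- by left; exists 0%MM; rewrite ?mpolyX0 ?drop_first1 // !mdeg0.
- rewrite mpolyXD drop_firstM E; case: (unliftP ord0 i) => [j ->|->].
    by left; exists (U_(j) + w')%MM; rewrite ?drop_firstX ?mpolyXD // !mdegD !mdeg1 dw.
  by right; rewrite drop_firstX0 mul0r.
by right; rewrite mpolyXD drop_firstM E mulr0.
Qed.

Lemma base_form_primitive : base_form \in @primitive 5 18.
Proof.
have /and4P[Su Ss So _] := primitive_support_check.
have sP := support_form_primitive Ss Su So; have sl := primitive_linear sP.
apply/asboolP; split=> [c p q|w wn|d a p d0 ad].
- by rewrite /base_form drop_first_linear sl.
- rewrite /base_form; have [[w' -> dw]|->] := drop_first_monomial w; last exact: lin0 sl.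
  by case/asboolP: sP => _ sd _; apply: sd; rewrite dw.
by rewrite /base_form -act_drop_first; case/asboolP: sP => _ _ /(_ d a _ d0 ad).
Qed.

Lemma base_form_transfer : base_form (transfer_poly 5 7) = 1.
Proof.
have /and4P[Su Ss So /andP[Xs Xo]] := primitive_support_check.
have Q X : drop_first (transfer_poly 5 7) = poly_of 4 X -> all (fun u => size u == 4) X ->
    odd (count (mem primitive_support) X) -> base_form (transfer_poly 5 7) = 1.
  by move=> E Ys Yo; rewrite /base_form E (support_form_poly Ss Su Ys) Yo.
exact: Q (@transfer_listsE 4 7 isT) Xs Xo.
Qed.

(** * Tables for monomials in the eigenvectors of a Singer cycle *)

Lemma closure_F2 : exists (K : closedFieldType) (iota : {rmorphism F2 -> K}) (om : K),
  om ^+ 5 = om ^+ 2 + 1.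
Proof.
have [K [iota _]] := countable_algebraic_closure 'F_2.
have [om omE] := @solve_monicpoly K 5 (fun i => if (i == 0)%N || (i == 2)%N then 1 else 0) isT.
exists K, iota, om; rewrite omE !big_ord_recl big_ord0 /=.
by rewrite /bump /= !mul0r !mul1r !addr0 !add0r expr0 addrC.
Qed.

Definition rotate (v : seq nat) : seq nat := [:: nth 0 v 4; nth 0 v 0; nth 0 v 1; nth 0 v 2; nth 0 v 3]%N.
(** The Singer cycle multiplies $y^v$ by $\omega$ to this power. *)
Definition weight (v : seq nat) : nat := foldr (fun i n => nth 0 v i * 2 ^ i + n)%N 0%N (iota 0 5).

Fixpoint lexlt (u v : seq nat) : bool :=
  if u is a :: u' then if v is b :: v' then (a < b)%N || ((a == b) && lexlt u' v') else false else true.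
Definition canonical (v : seq nat) : seq nat :=
  foldr (fun r m => if lexlt r m then r else m) v (traject rotate v 5).

(** Multiplication by $(y_i+y_{i-1}^2t)^{b_i}$; the index $i-1$ is written $(i+4)\bmod 5$. *)
Definition twist_step (b : seq nat) i (L : seq (seq nat * nat)) : seq (seq nat * nat) :=
  flatten [seq [seq (mkseq (fun l => nth 0 p.1 l + (l == i) * (nth 0 b i - j) + (l == (i + 4) %% 5) * (2 * j)) 5,
                     p.2 + j)%N
    | j <- [seq j <- iota 0 (nth 0%N b i).+1 | bin2 (nth 0 b i).+1 (nth 0 b i) j]] | p <- L].

(* The expansion of the total square of y^b, where y_i |-> y_i + y_(i-1)^2 t. *)
Definition twist (b : seq nat) : seq (seq nat * nat) :=
  foldr (twist_step b) [:: (nseq 5 0, 0)]%N (iota 0 5).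
Definition hits (b : seq nat) k : seq (seq nat) := [seq p.1 | p <- twist b & p.2 == k].

(** The squares $Sq^{2^i}$ generate the Steenrod algebra, whence the values of [k]. They preserve
    weight mod 31, because $y_i$ and $y_{i-1}^2$ have the same weight. *)
Definition hit_rows : seq (seq (seq nat)) :=
  flatten [seq [seq foldr (fun v => add2 [:: canonical v]) [::] (hits b k) |
      b <- [seq b <- monomials 5 (18 - k) | (weight b %% 31 == 0) && (canonical b == b)]]
    | k <- [:: 1; 2; 4; 8; 16]]%N.

Definition reduce_row (table : seq (seq nat * seq (seq nat))) r :=
  foldl (fun r e => if e.1 \in r then add2 e.2 r else r) r table.

(** The pivot of a row is its lexicographically largest entry and is removed from the earlier rows,
    so one pass of [reduce_row] is a complete reduction. *)
Definition eliminate (rows : seq (seq (seq nat))) : seq (seq nat * seq (seq nat)) :=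
  foldl (fun table r => let r' := reduce_row table r in
    if r' is v :: _ then
      let lead := foldr (fun u m => if lexlt u m then m else u) v r' in
      (lead, r') :: [seq (if lead \in e.2 then (e.1, add2 r' e.2) else e) | e <- table]
    else table) [::] rows.

(** The rotation classes of weight 0 mod 31 at which reduction modulo hits ends; [hits_check]
    confirms that no others occur. *)
Definition orbit_reps : seq (seq nat) :=
  [:: [:: 0;0;7;10;1]; [:: 0;0;9;7;2]; [:: 0;3;3;3;9]; [:: 1;3;3;5;6]; [:: 1;3;5;2;7]]%N.

Definition hits_ok : bool := let table := eliminate hit_rows in
  all (fun v => (weight v %% 31 == 0)%N ==>
      all (fun u => canonical u \in map canonical orbit_reps) (reduce_row table [:: canonical v]))
    (monomials 5 18).

(* Coefficient of x^c in a product of forms sum_l om^(u_l 2^s) x_l^e, as a list of exponents of om. *)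
Fixpoint coefficient (u : seq nat) (fs : seq (nat * nat)) (c : seq nat) : seq nat :=
  if fs is f :: fs' then
    flatten [seq [seq (nth 0 u l * 2 ^ f.1 + n) %% 31 |
        n <- coefficient u fs' (mkseq (fun i => nth 0 c i - (i == l) * f.2) 5)]
      | l <- [seq l <- iota 0 5 | f.2 <= nth 0 c l]]%N
  else if all (pred1 0%N) c then [:: 0%N] else [::].

(** Splits $y_i^{a_i}$ into factors $y_i^{2^j}=\sum_l\omega^{l2^{i+j}}x_l^{2^j}$, one for each
    binary digit; $i+j$ counts mod 5 since $\omega^{31}=1$. *)
Definition binary_factors (a : seq nat) : seq (nat * nat) :=
  flatten [seq [seq ((i + j) %% 5, 2 ^ j) | j <- [seq j <- iota 0 5 | odd (nth 0 a i %/ 2 ^ j)]]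
    | i <- iota 0 5]%N.

Fixpoint omega_power n : seq nat :=
  if n is m.+1 then foldr (fun j => add2 (if j == 4 then [:: 0; 2] else [:: j.+1])) [::] (omega_power m)
  else [:: 0]%N.

Definition spike_value (u c a : seq nat) : seq nat :=
  foldr (fun v => add2 (foldr (fun n => add2 (omega_power n)) [::] (coefficient u (binary_factors v) c)))
    [::] (traject rotate a 5).

Definition spike15 := [:: 0; 0; 0; 15; 3]%N.
Definition spike7 := [:: 0; 7; 7; 3; 1]%N.

Lemma hits_check : hits_ok.
Proof. by vm_compute. Qed.

(** A value is a list of exponents of $\omega$, so [[::]] is $0$ and [[:: 0]] is $1$. Sums of rows
    with the same spike produce four independent vectors. *)
Lemma spike_check :
  [/\ [seq spike_value [:: 2; 3; 4; 0; 1] spike15 a | a <- orbit_reps]%N =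
        [:: [:: 0]; [::]; [:: 0]; [:: 0]; [:: 0]]%N,
      [seq spike_value [:: 1; 2; 4; 3; 0] spike15 a | a <- orbit_reps]%N =
        [:: [::]; [:: 0]; [:: 0]; [::]; [::]]%N &
      [seq spike_value [:: 1; 2; 4; 0; 3] spike15 a | a <- orbit_reps]%N =
        [:: [:: 0]; [:: 0]; [::]; [:: 0]; [:: 0]]%N] /\
  [/\ [seq spike_value [:: 3; 0; 4; 2; 1] spike7 a | a <- orbit_reps]%N =
        [:: [::]; [::]; [::]; [::]; [::]],
      [seq spike_value [:: 3; 0; 1; 2; 4] spike7 a | a <- orbit_reps]%N =
        [:: [::]; [::]; [::]; [::]; [:: 0]]%N &
      [seq spike_value [:: 4; 0; 1; 3; 2] spike7 a | a <- orbit_reps]%N =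
        [:: [::]; [::]; [::]; [:: 0]; [::]]%N].
Proof. by vm_compute. Qed.

(** * Eigenvectors and the total square over $K$ *)

Section Torus.
Variables (K : closedFieldType) (iota : {rmorphism F2 -> K}) (om : K).
Hypothesis om5 : om ^+ 5 = om ^+ 2 + 1.
Local Notation PK := (mpoly.mpoly 5 K).

Lemma K_char2 (x : K) : x + x = 0.
Proof.
have E : (1 + 1 : K) = 0 by rewrite -(rmorph1 iota) -rmorphD addFF rmorph0.
by rewrite -[x]mul1r -mulrDl E mul0r.
Qed.

Lemma PK_char2 (p : PK) : p + p = 0.
Proof. by rewrite -[p]scale1r -scalerDl K_char2 scale0r. Qed.

Lemma K_sqrD (x y : K) : (x + y) ^+ 2 = x ^+ 2 + y ^+ 2.
Proof. by rewrite sqrrD mulr2n K_char2 addr0. Qed.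

Lemma PK_sqrD (x y : PK) : (x + y) ^+ 2 = x ^+ 2 + y ^+ 2.
Proof. by rewrite sqrrD mulr2n PK_char2 addr0. Qed.

Lemma omega_powerE n : om ^+ n = \sum_(j <- omega_power n) om ^+ j.
Proof.
elim: n => [|n IH]; first by rewrite big_seq1.
rewrite exprS IH mulr_sumr [omega_power _]/=.
rewrite (sum_foldr_add2_char2 K_char2 (fun j => om ^+ j)
  (fun j => if j == 4%N then [:: 0; 2]%N else [:: j.+1])).
apply: eq_bigr => j _; rewrite -exprS; case: eqP => [->|_]; last by rewrite big_seq1.
by rewrite om5 !big_cons big_nil addr0 expr0 addrC.
Qed.

Lemma om31 : om ^+ 31 = 1.
Proof.
have E : omega_power 31 = [:: 0%N] by vm_compute.
by rewrite omega_powerE E big_seq1.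
Qed.

(** 31 is prime, and $\omega=1$ would turn the quintic equation into $1=0$. *)
Lemma om_prim : 31.-primitive_root om.
Proof.
have [m om_m] := prim_order_exists (isT : 0 < 31)%N om31.
move=> m31; have : m \in [:: 1; 31]%N by rewrite -(_ : divisors 31 = [:: 1; 31]%N) // -dvdn_divisors.
rewrite !inE => /orP[/eqP m1|/eqP <- //]; exfalso.
have om1 : om = 1 by rewrite -[LHS]expr1 -m1 (prim_expr_order om_m).
by move: om5; rewrite om1 !expr1n K_char2 => /eqP; rewrite oner_eq0.
Qed.

Lemma om_mod n : om ^+ (n %% 31) = om ^+ n.
Proof. exact: prim_expr_mod om_prim n. Qed.

Lemma om_eq0 n : (om ^+ n == 1) = (31 %| n)%N.
Proof. by rewrite (prim_order_dvd om_prim). Qed.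

Definition yform i : PK := \sum_(l < 5) om ^+ (l * 2 ^ i) *: 'X_l.

Lemma yform5 i : yform (i + 5) = yform i.
Proof.
apply: eq_bigr => l _; congr (_ *: _); rewrite -om_mod -[RHS]om_mod; congr (_ ^+ _).
by rewrite expnD mulnA -modnMmr muln1.
Qed.

Lemma yform_sqr i : yform i ^+ 2 = \sum_(l < 5) om ^+ (l * 2 ^ i.+1) *: 'X_l ^+ 2.
Proof.
rewrite /yform (big_morph (fun p : PK => p ^+ 2) PK_sqrD (expr0n _ 2)); apply: eq_bigr => l _.
by rewrite exprZn -exprM -mulnA expnSr.
Qed.

Lemma yform_sqr_pred i : (i < 5)%N ->
  yform ((i + 4) %% 5) ^+ 2 = \sum_(l < 5) om ^+ (l * 2 ^ i) *: 'X_l ^+ 2.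
Proof.
move=> i5; rewrite yform_sqr; apply: eq_bigr => l _; congr (_ *: _).
rewrite -om_mod -[RHS]om_mod; congr (_ ^+ _); rewrite -modnMmr -[RHS]modnMmr; congr (_ * _ %% _)%N.
by case: i i5 => [|[|[|[|[|]]]]].
Qed.

(** The $K$-linear total square squares the variables and not the coefficients;
    $\sum_l\omega^{l2^i}x_l^2$ is the square of the form with index $i-1$. *)
Lemma total_yform i : (i < 5)%N ->
  total_square (yform i) = (yform i)%:P + (yform ((i + 4) %% 5) ^+ 2)%:P * 'X.
Proof.
move=> i5; rewrite yform_sqr_pred // /yform raddf_sum /= !rmorph_sum /= mulr_suml -big_split /=.
apply: eq_bigr => l _; rewrite total_squareZ total_squareX mulrDr mulrA -!polyCM !mul_mpolyC //.
Qed.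

Definition Ymon v : PK := \prod_(i <- seq.iota 0 5) yform i ^+ nth 0%N v i.

Lemma prod_single i (x : nat) : (i < 5)%N ->
  \prod_(l <- seq.iota 0 5) yform l ^+ ((l == i) * x) = yform i ^+ x.
Proof.
move=> i5; rewrite (bigD1_seq i) ?iota_uniq ?mem_iota // eqxx mul1n big1 => [|l /negbTE ->]; first exact: mulr1.
by rewrite mul0n expr0.
Qed.

Lemma Ymon_bump v i i' (x z : nat) : (i < 5)%N -> (i' < 5)%N ->
  Ymon (mkseq (fun l => nth 0 v l + (l == i) * x + (l == i') * z)%N 5) =
  Ymon v * (yform i ^+ x * yform i' ^+ z).
Proof.
move=> i5 i5'; rewrite -(prod_single x i5) -(prod_single z i5') -!big_split /=.
apply: eq_big_seq => l; rewrite mem_iota => l5; rewrite nth_mkseq // !exprD mulrA.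
by [].
Qed.

Definition twist_eval (L : seq (seq nat * nat)) : {poly PK} :=
  \sum_(p <- L) (Ymon p.1)%:P * 'X^(p.2).

Lemma twist_stepE b i L : (i < 5)%N ->
  twist_eval (twist_step b i L) = twist_eval L * total_square (yform i) ^+ nth 0%N b i.
Proof.
move=> i5; have i5' : ((i + 4) %% 5 < 5)%N by rewrite ltn_mod.
rewrite /twist_eval /twist_step big_flatten big_map mulr_suml; apply: eq_bigr => p _.
rewrite big_map big_filter total_yform // exprDn mulr_sumr [LHS]big_mkcond.
rewrite -(big_mkord xpredT (fun j => (Ymon p.1)%:P * 'X^(p.2) * (((yform i)%:P ^+ (nth 0%N b i - j) *
  ((yform ((i + 4) %% 5) ^+ 2)%:P * 'X) ^+ j) *+ 'C(nth 0%N b i, j)))) /index_iota subn0.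
apply: eq_bigr => j _; rewrite bin2E //.
have R2 (q : {poly PK}) n : q *+ n = if odd n then q else 0.
  rewrite -[n in LHS]odd_double_half mulrnDr -muln2 mulnC mulrnA mulr2n.
  have -> : q + q = 0 by apply/polyP => k; rewrite coefD PK_char2 coef0.
  by rewrite mul0rn addr0; case: (odd n).
rewrite [RHS]mulrnAr R2; case: (odd 'C(nth 0%N b i, j)) => //.
rewrite Ymon_bump // exprMn -!polyC_exp -exprM !polyCM [X in 'X^X]/= (exprD 'X p.2 j).
by rewrite mulrACA -!mulrA.
Qed.

Lemma twistE b : twist_eval (twist b) = total_square (Ymon b).
Proof.
rewrite /twist /Ymon rmorph_prod.
have H r L : all (fun i => i < 5)%N r -> twist_eval (foldr (twist_step b) L r) =
    (\prod_(i <- r) total_square (yform i) ^+ nth 0%N b i) * twist_eval L.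
  elim: r => [|i r IH] /=; first by rewrite big_nil mul1r.
  by move=> /andP[i5 /IH {}IH]; rewrite twist_stepE // IH big_cons mulrC mulrA.
have Y0 : Ymon (nseq 5 0%N) = 1.
  by rewrite /Ymon big1_seq // => i _; rewrite nth_nseq if_same expr0.
have E0 : twist_eval [:: (nseq 5 0%N, 0%N)] = 1.
  by rewrite /twist_eval big_seq1 [Ymon _]Y0 expr0 mulr1.
rewrite (H (seq.iota 0 5)) // E0 mulr1; apply: eq_bigr => i _; exact/esym/rmorphXn.
Qed.

Lemma hitsE b k : (total_square (Ymon b))`_k = \sum_(v <- hits b k) Ymon v.
Proof.
rewrite -twistE /twist_eval coef_sum big_map big_filter [RHS]big_mkcond /=.
apply: eq_bigr => p _; rewrite coefCM coefXn eq_sym.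
by case: eqP; rewrite ?mulr1 ?mulr0.
Qed.
End Torus.

(** * From lists back to cocycles and $\mathrm{Ext}$ *)

Section Assembly.

Lemma multilinear_seq n (c : bar n -> F2^o) : multilinear c ->
  multilin (fun l => c (bar_of_seq n l)) n.
Proof.
move=> ml s t k x y st; have i5 : (size s < n)%N by rewrite -st ltnS leq_addr.
have E u : bar_of_seq n (s ++ u :: t) = bar_set (bar_of_seq n (s ++ 0 :: t)) (Ordinal i5) u.
  apply/ffunP => j; rewrite !ffunE -val_eqE /= !nth_cat.
  have [js|js|->] := ltngtP j (size s); rewrite ?ltnn ?subnn //.
  by have -> : (j - size s = (j - size s).-1.+1)%N by lia.
by rewrite (E (k *: x + y)) (E x) (E y) ml.
Qed.

Lemma seq_multilinear n (b : seq steenrod -> F2^o) : multilin b n ->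
  multilinear (fun a : bar n => b (seq_of_bar a)).
Proof.
move=> ml a i k x y; rewrite !seq_of_bar_set; apply: ml.
rewrite size_take size_drop size_seq_of_bar ltn_ord; have := ltn_ord i; lia.
Qed.

Lemma internal_degree_seq n t (c : bar n -> F2^o) : has_internal_degree t c ->
  word_degree (fun l => c (bar_of_seq n l)) n 0 t.
Proof.
move=> hd ws wn wt; apply: (hd _ (fun i => sumn (nth [::] ws i))).
  by move=> i; rewrite ffunE (nth_map [::]) ?wn //; apply: word_homogeneous.
move=> E; apply: wt; rewrite -E add0n sumnE big_map (big_nth [::]) big_mkord wn //.
Qed.

Lemma seq_internal_degree n t (b : seq steenrod -> F2^o) : multilin b n ->
  word_degree b n 0 t -> has_internal_degree t (fun a : bar n => b (seq_of_bar a)).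
Proof.
move=> ml wd a d ad dt.
apply: (multilin_words (P := fun i w => forall j : 'I_n, i = j :> nat -> sumn w = d j) ml).
- move=> ws wn wP; apply: wd => // E; apply: dt; rewrite -E add0n sumnE big_map.
  by rewrite (big_nth [::]) big_mkord wn; apply: eq_bigr => i _; rewrite (wP i (ltn_ord i) i).
- exact: size_seq_of_bar.
move=> i ni; rewrite (nth_seq_of_bar a (Ordinal ni)).
have [s sd ->] := word_sum_homogeneous (ad (Ordinal ni)).
by exists s => // w /sd wd' j ij; rewrite wd'; congr d; apply/val_inj.
Qed.

Lemma has_degree_internal n t (b : seq steenrod -> F2^o) : has_degree b n t ->
  has_internal_degree t (fun a : bar n => b (seq_of_bar a)).
Proof.
move=> hd a d ad dt; apply: (hd _ (mkseq (fun i => if insub i is Some j then d j else 0%N) n)).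
- exact: size_seq_of_bar.
- exact: size_mkseq.
- by move=> i ni; rewrite nth_mkseq // insubT (nth_seq_of_bar a (Ordinal ni)).
rewrite sumnE big_map => E; apply: dt; rewrite -E.
have -> : iota 0 n = index_iota 0 n by rewrite /index_iota subn0.
by rewrite big_mkord; apply: eq_bigr => i _; rewrite valK.
Qed.

Definition transfer_cochain (f : Pol 5 -> F2^o) (a : bar 5) : F2^o := f (e_seq 5 (seq_of_bar a)).

Lemma transfer_cocycle (f : Pol 5 -> F2^o) : f \in @primitive 5 18 ->
  transfer_cochain f \in @cocycle 5 (5 + 18).
Proof.
move=> fP; have fl := primitive_linear fP; apply/asboolP; split; first split.
- apply: (@seq_multilinear 5 (fun l => f (e_seq 5 l))) => s t k x y st.
  by rewrite (e_seq_multilin _ _ _ st) fl.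
- apply: (@has_degree_internal 5 _ (fun l => f (e_seq 5 l))) => l e l5 e5 he et.
  exact: primitive_degree fP (e_seq_homogeneous l5 e5 he) et.
move=> a; rewrite coboundary_mapE; have sz := size_seq_of_bar a.
case: (seq_of_bar a) sz => // x r [r5].
rewrite (@eq_bar_diff _ _ (fun l => f (e_seq 5 l))) => [|s [sr]]; last first.
  by rewrite /transfer_cochain bar_of_seqK // sr r5.
by rewrite (bar_diff_primitive _ _ _ fP) module_bar_diff_e_seq // (lin0 fl).
Qed.

Definition transfer_class (f : primitives 5 18) : cocycles 5 (5 + 18) :=
  exist _ (transfer_cochain (val f)) (transfer_cocycle (valP f)).

Lemma transfer_class_linear : linear transfer_class.
Proof. by move=> k f g; apply/val_inj. Qed.

Definition class_form (c : bar 5 -> F2^o) : F2^o := ext_class (fun l => c (bar_of_seq 5 l)).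

Lemma zigzagD c c' k g l : zigzag (fun s => c s + c' s) k g l = zigzag c k g l + zigzag c' k g l.
Proof.
elim: k g l => [|k IH] g l /=.
  by rewrite /augmented; case: ifP => _; rewrite ?addr0 // scalerDr.
by rewrite -dstarD; apply: eq_bigr => y _; rewrite /contract IH.
Qed.

Lemma class_formD c c' : class_form (c + c') = class_form c + class_form c'.
Proof. exact: zigzagD. Qed.

Lemma eq_zigzag c c' k g s a : (k <= 5)%N -> size s = (5 - k)%N ->
  (forall l, size l = 5%N -> c l = c' l) -> zigzag c k g (rcons s a) = zigzag c' k g (rcons s a).
Proof.
move=> k5 sk E; elim: k g s a k5 sk => [|k IH] g s a k5 sk.
  by rewrite /= /augmented take_rcons_last E.
rewrite [zigzag c _]/= [zigzag c' _]/=; apply: eq_dstar => g' b; rewrite /contract.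
by apply: IH; [apply: ltnW | rewrite size_rcons sk; lia].
Qed.

Lemma coboundaryP (z : cocycles 5 (5 + 18)) : class_form (val z) = 0 <-> coboundary z.
Proof.
case/asboolP: (valP z) => -[ml hd] zc; split=> [z0|[b [bml bhd] zb]].
  have cz s : size s = 6%N -> bar_diff (fun l => val z (bar_of_seq 5 l)) s = 0.
    by move=> s6; rewrite -[s](bar_of_seqK s6) -coboundary_mapE zc.
  have [b [bml bd bE]] := ext_class_vanishing (multilinear_seq ml) (internal_degree_seq hd) cz z0.
  exists (fun a => b (seq_of_bar a)).
    by split; [apply: seq_multilinear | apply: seq_internal_degree].
  apply/funext => a; rewrite coboundary_mapE -[in LHS](seq_of_barK a) bE ?size_seq_of_bar //.
  apply: eq_bar_diff => s; rewrite size_seq_of_bar => -[s4].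
  by rewrite bar_of_seqK.
have mb := multilinear_seq bml.
have /= := ext_class_coboundary mb (internal_degree_seq bhd).
rewrite /class_form /ext_class => <-; apply: (@eq_zigzag _ _ 5 7 [::] 1) => // l l5.
by rewrite zb coboundary_mapE bar_of_seqK.
Qed.

Lemma class_form_transfer f : class_form (val (transfer_class f)) = val f (transfer_poly 5 7).
Proof.
have fl := primitive_linear (valP f).
have E l : size l = 5%N -> val (transfer_class f) (bar_of_seq 5 l) = val f (e_seq 5 l).
  move=> l5; rewrite -[LHS]/(val f (e_seq 5 (seq_of_bar (bar_of_seq 5 l)))).
  by rewrite bar_of_seqK.
transitivity (ext_class (fun l => val f (e_seq 5 l))); last exact: ext_class_transfer fl.
exact: (@eq_zigzag (fun l => val (transfer_class f) (bar_of_seq 5 l)) (fun l => val f (e_seq 5 l))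
  5 7 [::] 1 isT erefl E).
Qed.

(** Here the invariance of the class of $e_5$ makes the transfer well defined on coinvariants. *)
Lemma transfer_relation f : GL_relation f -> coboundary (transfer_class f).
Proof.
case=> g [h [gu fE]].
have [b [bml bhd] bE] := @class_invariant_GL 4 18 g gu _ (valP h).
exists (fun a => b (seq_of_bar a)).
  by split; [apply: seq_multilinear | apply: has_degree_internal].
apply/funext => a; rewrite coboundary_mapE /= /transfer_cochain fE linear_substitutionE.
rewrite oppF2; have sz := size_seq_of_bar a; case: (seq_of_bar a) sz => // x r [r4].
rewrite bE //; apply: eq_bar_diff => s; rewrite /= r4 => -[s4].
by rewrite bar_of_seqK.
Qed.
End Assembly.

(** * Matrices of the Singer cycle, its Frobenius and permutations *)

Definition boolmx (L : seq (seq bool)) : 'M[F2]_5 :=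
  \matrix_(i, j) (nth false (nth [::] L i) j)%:R.

(** Row $l$ holds the coordinates of $\omega^{l+1}$ in the basis $1,\dots,\omega^4$, with
    $\omega^5=1+\omega^2$. *)
Definition singer_cycle := boolmx [:: [:: false; true; false; false; false];
  [:: false; false; true; false; false]; [:: false; false; false; true; false];
  [:: false; false; false; false; true]; [:: true; false; true; false; false]].

(** Row $l$ holds the coordinates of $\omega^{2l}$, with $\omega^6=\omega+\omega^3$ and
    $\omega^8=1+\omega^2+\omega^3$. *)
Definition frobenius_mx := boolmx [:: [:: true; false; false; false; false];
  [:: false; false; true; false; false]; [:: false; false; false; false; true];
  [:: false; true; false; true; false]; [:: true; false; true; true; false]].

Lemma ord5_ind (P : 'I_5 -> Prop) : (forall i (i5 : (i < 5)%N), P (Ordinal i5)) -> forall i, P i.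
Proof. by move=> H [i i5]; apply: H. Qed.

Lemma singer_cycle_unit : singer_cycle \in unitmx.
Proof.
pose B := boolmx [:: [:: false; true; false; false; true]; [:: true; false; false; false; false];
  [:: false; true; false; false; false]; [:: false; false; true; false; false];
  [:: false; false; false; true; false]].
suff E : singer_cycle *m B = 1%:M by exact: (mulmx1_unit E).1.
apply/matrixP; apply: ord5_ind => i i5; apply: ord5_ind => j j5.
rewrite !mxE !big_ord_recl big_ord0 !mxE.
by case: i i5 => [|[|[|[|[|]]]]] i5; case: j j5 => [|[|[|[|[|]]]]] j5 //; apply/val_inj.
Qed.

Lemma frobenius_mx_unit : frobenius_mx \in unitmx.
Proof.
pose B := boolmx [:: [:: true; false; false; false; false]; [:: true; true; false; true; true]; [:: false; true; false; false; false]; [:: true; true; false; false; true]; [:: false; false; true; false; false]].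
suff E : frobenius_mx *m B = 1%:M by exact: (mulmx1_unit E).1.
apply/matrixP; apply: ord5_ind => i i5; apply: ord5_ind => j j5.
rewrite !mxE !big_ord_recl big_ord0 !mxE.
by case: i i5 => [|[|[|[|[|]]]]] i5; case: j j5 => [|[|[|[|[|]]]]] j5 //; apply/val_inj.
Qed.

Definition list_perm_mx (u : seq nat) : 'M[F2]_5 := \matrix_(l, j) (nth 0%N u l == j)%:R.

Lemma list_perm_mx_unit u : perm_eq u (iota 0 5) -> list_perm_mx u \in unitmx.
Proof.
move=> pu; have u5 : size u = 5%N by rewrite (perm_size pu) size_iota.
have uu : uniq u by rewrite (perm_uniq pu) iota_uniq.
suff E : list_perm_mx u *m (list_perm_mx u)^T = 1%:M by exact: (mulmx1_unit E).1.
apply/matrixP => i j; rewrite !mxE.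
have ui : (nth 0%N u i < 5)%N.
  by have := mem_nth 0%N (_ : (i < size u)%N); rewrite u5 (perm_mem pu) mem_iota => /(_ (ltn_ord i)).
rewrite (bigD1 (Ordinal ui)) //= big1 => [|l /eqP li]; rewrite !mxE /=.
  by rewrite eqxx mul1r addr0 nth_uniq ?u5 // eq_sym -val_eqE.
case: eqP => [il|_]; last by rewrite mul0r.
by case: li; apply/val_inj; rewrite /= il.
Qed.

Lemma map_poly_affine (A B : nzRingType) (phi : {rmorphism A -> B}) x z :
  map_poly phi (x%:P + z%:P * 'X) = (phi x)%:P + (phi z)%:P * 'X.
Proof. by rewrite rmorphD rmorphM /= !map_polyC map_polyX. Qed.

(** * Extension of a primitive form to $K$ *)

Section TorusAction.
Variables (K : closedFieldType) (iota : {rmorphism F2 -> K}) (om : K).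
Hypothesis om5 : om ^+ 5 = om ^+ 2 + 1.
Local Notation PK := (mpoly.mpoly 5 K).
Local Notation y := (yform om).
Local Notation Y := (Ymon om).
Local Notation mapP := (@map_mpoly 5 _ _ iota).

Lemma map_F2_ind (P : Pol 5 -> Prop) :
  (forall p q, P p -> P q -> P (p + q)) -> P 0 -> (forall w, P 'X_[w]) -> forall p, P p.
Proof.
move=> PD P0 PX p; rewrite [p]mpolyE; apply: big_ind => // w _.
by have [->|->] := F2_case (p@_w); rewrite ?scale0r ?scale1r.
Qed.

Lemma mapP_total p : total_square (mapP p) = map_poly mapP (total_square p).
Proof.
have D (q r : Pol 5) : total_square (mapP q) = map_poly mapP (total_square q) ->
    total_square (mapP r) = map_poly mapP (total_square r) ->
    total_square (mapP (q + r)) = map_poly mapP (total_square (q + r)).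
  by move=> Hq Hr; rewrite raddfD /= !rmorphD /= Hq Hr.
have H1 : total_square (mapP 1) = map_poly mapP (total_square 1) by rewrite !rmorph1.
have H0 : total_square (mapP 0) = map_poly mapP (total_square 0).
  by rewrite -(addF2 (1 : Pol 5)); exact: D.
elim/mpoly_mulX_ind: p => [q r|c q IH||l q IH].
- exact: D.
- by have [->|->] := F2_case c; [rewrite scale0r; exact: H0 | rewrite scale1r; exact: IH].
- exact: H1.
have Xl : total_square (mapP 'X_l) = map_poly mapP (total_square 'X_l).
  have mX : mapP 'X_l = 'X_l by exact: map_mpolyX.
  have mX2 : mapP ('X_l ^+ 2) = 'X_l ^+ 2 by rewrite -mX -rmorphXn.
  rewrite mX !total_squareX; apply: etrans (esym (map_poly_affine _ 'X_l ('X_l ^+ 2))).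
  by congr (_%:P + _%:P * 'X); apply/esym; [exact: mX | exact: mX2].
by rewrite rmorphM /= !rmorphM /= IH Xl.
Qed.

Lemma mapP_subst g p : mx_subst (map_mx iota g) (mapP p) = mapP (mx_subst g p).
Proof.
elim/mpoly_mulX_ind: p => [p q IHp IHq|c p IH||l p IH].
- by rewrite raddfD /= !mx_substD raddfD IHp IHq.
- have [->|->] := F2_case c; rewrite ?scale1r // scale0r raddf0 !mx_subst0 raddf0 //.
- by rewrite rmorph1 !mx_subst1 rmorph1.
rewrite rmorphM /= !mx_substM rmorphM IH /= map_mpolyX !mx_substX raddf_sum; congr (_ * _).
by apply: eq_bigr => j _; rewrite mxE /= map_mpolyZ map_mpolyX.
Qed.

(** The $K$-linear extension of [f]. Bounding the degree by 19 makes the sum finite and loses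
    nothing for forms concentrated in degree 18. *)
Definition fK (f : Pol 5 -> F2^o) (p : PK) : K :=
  \sum_(m : 'X_{1..5 < 19}) p@_m * iota (f 'X_[m]).

Lemma fKD f p q : fK f (p + q) = fK f p + fK f q.
Proof. by rewrite -big_split; apply: eq_bigr => m _; rewrite mcoeffD mulrDl. Qed.
Lemma fK0 f : fK f 0 = 0.
Proof. by apply: big1 => m _; rewrite mcoeff0 mul0r. Qed.
Lemma fKZ f c p : fK f (c *: p) = c * fK f p.
Proof. by rewrite /fK mulr_sumr; apply: eq_bigr => m _; rewrite mcoeffZ mulrA. Qed.
Lemma fK_sum f I (r : seq I) (P : pred I) F :
  fK f (\sum_(i <- r | P i) F i) = \sum_(i <- r | P i) fK f (F i).
Proof. exact: (big_morph _ (fKD f) (fK0 f)). Qed.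

Lemma fKDl f h p : fK (fun q => f q + h q) p = fK f p + fK h p.
Proof. by rewrite -big_split; apply: eq_bigr => m _; rewrite rmorphD mulrDr. Qed.

Lemma fK_suml I (r : seq I) (F : I -> Pol 5 -> F2^o) p :
  fK (fun q => \sum_(i <- r) F i q) p = \sum_(i <- r) fK (F i) p.
Proof.
rewrite /fK exchange_big; apply: eq_bigr => m _.
by rewrite rmorph_sum mulr_sumr.
Qed.

Section Form.
Variable f : Pol 5 -> F2^o.
Hypothesis fP : f \in @primitive 5 18.
Let fl := primitive_linear fP.

Lemma fK_monomial w : fK f 'X_[w] = iota (f 'X_[w]).
Proof.
have [w19|w19] := ltnP (mdeg w) 19.
  rewrite /fK (bigD1 (BMultinom w19)) //= mcoeffX eqxx mul1r big1 ?addr0 // => m mw.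
  rewrite mcoeffX; case: eqP => [E|_]; last by rewrite mul0r.
  by case/eqP: mw; apply/val_inj; rewrite /= E.
have -> : f 'X_[w] = 0.
  by case/asboolP: fP => _ + _; apply => w18; rewrite w18 in w19.
rewrite rmorph0; apply: big1 => m _; rewrite mcoeffX; case: eqP => [E|_]; last by rewrite mul0r.
by move: w19; rewrite E leqNgt bmdeg.
Qed.

Lemma fK_map p : fK f (mapP p) = iota (f p).
Proof.
elim/map_F2_ind: p => [p q IHp IHq||w].
- by rewrite raddfD fKD IHp IHq (linD fl) rmorphD.
- by rewrite raddf0 fK0 (lin0 fl) rmorph0.
by rewrite map_mpolyX fK_monomial.
Qed.

Lemma fK_total k p : (0 < k)%N -> fK f (total_square p)`_k = 0.
Proof.
move=> k0; rewrite [p]mpolyE raddf_sum /= coef_sum fK_sum big1 // => w _.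
rewrite total_squareZ coefCM mul_mpolyC fKZ -(map_mpolyX iota) mapP_total coef_map /= fK_map.
have -> : (total_square 'X_[w])`_k = act (@Sq 5) (word [:: k]) 'X_[w].
  by rewrite (act_word (Pol_adem 5)) /= /Sq total_SqE.
rewrite (primitive_act _ _ fP) augmentation_word /= addn0 eqn0Ngt k0 mul0r rmorph0 mulr0 //.
Qed.

Lemma fK_subst g p : fK f (mx_subst (map_mx iota g) p) = fK (f \o mx_subst g) p.
Proof.
rewrite [p]mpolyE (big_morph _ (mx_substD _) (mx_subst0 _)) !fK_sum; apply: eq_bigr => w _.
rewrite mx_substZ !fKZ -(map_mpolyX iota) mapP_subst fK_map map_mpolyX; congr (_ * _).
have [w19|w19] := ltnP (mdeg w) 19.
  rewrite /fK (bigD1 (BMultinom w19)) //= mcoeffX eqxx mul1r big1 ?addr0 // => m mw.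
  rewrite mcoeffX; case: eqP => [E|_]; last by rewrite mul0r.
  by case/eqP: mw; apply/val_inj; rewrite /= E.
have -> : f (mx_subst g 'X_[w]) = 0.
  have := primitive_subst g fP; case/asboolP => _ + _; apply => w18; by rewrite w18 in w19.
rewrite rmorph0; apply/esym/big1 => m _; rewrite mcoeffX; case: eqP => [E|_]; last by rewrite mul0r.
by move: w19; rewrite E leqNgt bmdeg.
Qed.

Lemma fK_hits b k : (0 < k)%N -> \sum_(v <- hits b k) fK f (Y v) = 0.
Proof. by move=> k0; rewrite -fK_sum -(hitsE iota om5) fK_total. Qed.

Lemma vandermonde_unit : \matrix_(l < 5, i < 5) om ^+ (l * 2 ^ i) \in unitmx.
Proof.
have -> : \matrix_(l < 5, i < 5) om ^+ (l * 2 ^ i) = Vandermonde 5 (\row_(i < 5) om ^+ (2 ^ i)).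
  by apply/matrixP => l i; rewrite !mxE -exprM mulnC.
rewrite unitmxE det_Vandermonde unitfE; apply/prodf_neq0 => i _; apply/prodf_neq0 => j ij.
rewrite !mxE subr_eq0 (eq_prim_root_expr (om_prim iota om5)).
by move: ij; case: i => [[|[|[|[|[|i]]]]] i5] //; case: j => [[|[|[|[|[|j]]]]] j5].
Qed.

(** A Vandermonde matrix takes the $x_l$ to the $y_i$ and is invertible, so the monomials in the
    $y_i$ span. *)
Lemma Y_spans : (forall v, size v = 5%N -> sumn v = 18%N -> fK f (Y v) = 0) -> f = 0.
Proof.
move=> Y0; set M := \matrix_(l < 5, i < 5) om ^+ (l * 2 ^ i).
have MY m : mx_subst M 'X_[m] = Y (codom m).
  rewrite mpolyXE_id (big_morph _ (mx_substM M) (mx_subst1 M)) /Ymon.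
  rewrite -[seq.iota 0 5]/(index_iota 0 5) big_mkord; apply: eq_bigr => i _.
  rewrite mx_substXn mx_substX /yform; congr (_ ^+ _).
    by apply: eq_bigr => l _; rewrite mxE.
  by rewrite /codom /image_mem (nth_map i) ?size_enum_ord // nth_ord_enum.
apply/funext => p; elim/map_F2_ind: p => [p q IHp IHq||w]; rewrite ?fct_zeroE.
- by rewrite (linD fl) IHp IHq fct_zeroE addr0.
- exact: lin0 fl.
have [w18|w18] := eqVneq (mdeg w) 18%N; last by case/asboolP: fP => _ + _; apply; apply/eqP.
apply: (fmorph_inj iota); rewrite rmorph0 -fK_monomial.
have -> : 'X_[w] = mx_subst M (mx_subst (invmx M) 'X_[w]) :> PK.
  by rewrite -mx_subst_comp mulmxV ?mx_subst_id // vandermonde_unit.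
have /dhomog_mf hq : mx_subst (invmx M) 'X_[w] \is (mdeg w).-homog.
  by apply: mx_subst_homog; rewrite dhomogX.
rewrite [mx_subst (invmx M) _]mpolyE (big_morph _ (mx_substD M) (mx_subst0 M)) fK_sum.
rewrite big_seq big1 // => m /hq mw; rewrite mx_substZ fKZ MY Y0 ?mulr0 //.
  by rewrite size_codom card_ord.
have mE : m = exponents 5 (codom m).
  apply/mnmP => i; rewrite mnmE /codom /image_mem (nth_map i) ?size_enum_ord //.
  by rewrite nth_ord_enum.
have -> : sumn (codom m) = mdeg m; last by rewrite mw.
by rewrite [in RHS]mE mdeg_exponents // size_codom card_ord.
Qed.
End Form.

Lemma subst_yform g i : mx_subst (map_mx iota g) (y i) =
  \sum_l (\sum_j iota (g l j) * om ^+ (j * 2 ^ i)) *: 'X_l.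
Proof.
rewrite /yform (big_morph _ (mx_substD _) (mx_subst0 _)).
under eq_bigr do rewrite mx_substZ mx_substX scaler_sumr.
rewrite exchange_big; apply: eq_bigr => l _; rewrite scaler_suml; apply: eq_bigr => j _.
by rewrite scalerA mxE mulrC.
Qed.

Lemma om_root i : (om ^+ (2 ^ i)) ^+ 5 = (om ^+ (2 ^ i)) ^+ 2 + 1.
Proof.
elim: i => [|i IH]; first by rewrite expr1 om5.
by rewrite expnSr exprM [LHS]exprAC IH (K_sqrD iota) expr1n -!exprM mulnC.
Qed.

Lemma singer_cycle_yform i : mx_subst (map_mx iota singer_cycle) (y i) = om ^+ (2 ^ i) *: y i.
Proof.
rewrite subst_yform /yform scaler_sumr; apply: eq_bigr => l _; rewrite scalerA; congr (_ *: _).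
under eq_bigr do rewrite mxE mulnC exprM.
rewrite mulnC exprM; have := om_root i; move: (om ^+ (2 ^ i)) => z z5.
rewrite !big_ord_recl big_ord0 /=.
case: l => [[|[|[|[|[|]]]]] l5] //=; rewrite ?rmorph0 ?rmorph1 ?mul0r ?mul1r ?addr0 ?add0r -?exprS //.
by rewrite z5 expr0 addrC.
Qed.

Lemma frobenius_mx_yform i : mx_subst (map_mx iota frobenius_mx) (y i) = y i.+1.
Proof.
rewrite subst_yform /yform; apply: eq_bigr => l _; congr (_ *: _).
under eq_bigr do rewrite mxE mulnC exprM.
rewrite expnSr mulnCA exprM; have := om_root i; move: (om ^+ (2 ^ i)) => z z5.
have z6 : z ^+ 6 = z ^+ 3 + z by rewrite exprS z5 mulrDr mulr1 -exprS.
have z8 : z ^+ 8 = z ^+ 3 + z ^+ 2 + 1.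
  by rewrite (exprD z 2 6) z6 mulrDr -exprD -exprSr z5 addrC addrA.
rewrite !big_ord_recl big_ord0 /=.
case: l => [[|[|[|[|[|]]]]] l5] //=; rewrite ?rmorph0 ?rmorph1 ?mul0r ?mul1r ?addr0 ?add0r //.
- by rewrite -[RHS]/(z ^+ 6) z6 expr1 addrC.
by rewrite -[RHS]/(z ^+ 8) z8 expr0 addrC (addrC (z ^+ 2)).
Qed.

Lemma Y_subst_scale g (c : nat -> K) v : (forall i, mx_subst (map_mx iota g) (y i) = c i *: y i) ->
  mx_subst (map_mx iota g) (Y v) = (\prod_(i <- seq.iota 0 5) c i ^+ nth 0%N v i) *: Y v.
Proof.
move=> E; rewrite /Ymon (big_morph _ (mx_substM _) (mx_subst1 _)).
under eq_bigr do rewrite mx_substXn E exprZn.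
by rewrite scaler_prod.
Qed.

Lemma singer_cycle_Y v :
  mx_subst (map_mx iota singer_cycle) (Y v) = om ^+ weight v *: Y v.
Proof.
rewrite (Y_subst_scale v singer_cycle_yform); congr (_ *: _).
rewrite /weight; elim: (seq.iota 0 5) => [|i r IH]; first by rewrite big_nil.
by rewrite big_cons IH -exprM mulnC -exprD.
Qed.

Lemma Y_rotate v : Y (rotate v) = \prod_(i <- seq.iota 0 5) y i.+1 ^+ nth 0%N v i.
Proof.
rewrite /Ymon /= !big_cons !big_nil /= !mulr1.
have y5 : y 5 = y 0 := yform5 iota om5 0.
by rewrite y5 mulrC -!mulrA.
Qed.

Lemma frobenius_mx_Y v : mx_subst (map_mx iota frobenius_mx) (Y v) = Y (rotate v).
Proof.
rewrite Y_rotate /Ymon (big_morph _ (mx_substM _) (mx_subst1 _)).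
by apply: eq_bigr => i _; rewrite mx_substXn frobenius_mx_yform.
Qed.
End TorusAction.

(** * Averaging over the normalizer of the Singer cycle *)

Section CoinvariantBound.
Variables (K : closedFieldType) (iota : {rmorphism F2 -> K}) (om : K).
Hypothesis om5 : om ^+ 5 = om ^+ 2 + 1.
Local Notation PK := (mpoly.mpoly 5 K).
Local Notation y := (yform om).
Local Notation Y := (Ymon om).

Definition is_relation (f : Pol 5 -> F2^o) := exists2 r : primitives 5 18,
  r \in span (@GL_relation 5 18) & val r = f.

Lemma is_relationD f h : is_relation f -> is_relation h -> is_relation (f + h).
Proof. by move=> [r rR <-] [s sR <-]; exists (r + s); rewrite ?rpredD. Qed.

Lemma is_relation0 : is_relation 0.
Proof. by exists 0; rewrite ?rpred0. Qed.

Lemma is_relation_sum I (r : seq I) (F : I -> Pol 5 -> F2^o) :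
  (forall i, is_relation (F i)) -> is_relation (\sum_(i <- r) F i).
Proof. by move=> H; apply: big_ind => //; [exact: is_relation0 | exact: is_relationD]. Qed.

Lemma is_relation_GL f g : f \in @primitive 5 18 -> g \in unitmx ->
  is_relation ((f \o mx_subst g) + f).
Proof.
move=> fP gu; pose h : primitives 5 18 := exist _ f fP.
have hP : (f \o mx_subst g) + f \in @primitive 5 18 by rewrite rpredD // primitive_subst.
pose h2 : primitives 5 18 := @exist _ (fun f => f \in @primitive 5 18) _ hP.
exists h2 => //.
apply/asboolP; exists [:: (1, h2)]; last by rewrite big_seq1 scale1r.
move=> _ /[!inE] /eqP -> /=; exists g, h; split=> // p.
by rewrite linear_substitutionE oppF2.
Qed.

Definition rotation_sum f v : K := \sum_(r <- traject rotate v 5) fK iota f (Y r).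

Lemma rotation_sumD f h v : rotation_sum (f + h) v = rotation_sum f v + rotation_sum h v.
Proof. by rewrite /rotation_sum -big_split; apply: eq_bigr => r _; apply: fKDl. Qed.

Definition average (f : Pol 5 -> F2^o) : Pol 5 -> F2^o :=
  \sum_(i <- seq.iota 0 31) \sum_(j <- seq.iota 0 5) (f \o mx_subst (singer_cycle ^+ i *m frobenius_mx ^+ j)).

Lemma unit_pow (g : 'M[F2]_5) i : g \in unitmx -> g ^+ i \in unitmx.
Proof.
by move=> gu; elim: i => [|i IH]; rewrite ?expr0 ?unitmx1 // exprS -mulmxE unitmx_mul gu.
Qed.

(** Each of the $31\cdot5$ terms is congruent to $f$, and their number is odd. *)
Lemma average_relation f : f \in @primitive 5 18 -> is_relation (average f + f).
Proof.
move=> fP; pose g i j := singer_cycle ^+ i *m frobenius_mx ^+ j.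
have gu i j : g i j \in unitmx.
  by rewrite unitmx_mul !unit_pow ?singer_cycle_unit ?frobenius_mx_unit.
have -> : average f + f =
    \sum_(i <- seq.iota 0 31) \sum_(j <- seq.iota 0 5) ((f \o mx_subst (g i j)) + f).
  have S (r : seq nat) : odd (size r) -> \sum_(j <- r) f = f.
    move=> ro; rewrite big_const_seq count_predT iter_addr_0 mulrnF2 ro //.
  under [RHS]eq_bigr do rewrite big_split /= (S (seq.iota 0 5)) //.
  by rewrite big_split /= (S (seq.iota 0 31)).
by apply: is_relation_sum => i; apply: is_relation_sum => j; apply: is_relation_GL.
Qed.

Lemma average_primitive f : f \in @primitive 5 18 -> average f \in @primitive 5 18.
Proof. by move=> fP; apply: rpred_sum => i _; apply: rpred_sum => j _; apply: primitive_subst. Qed.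

Lemma singer_pow_Y i v :
  mx_subst (map_mx iota (singer_cycle ^+ i)) (Y v) = om ^+ (weight v * i) *: Y v.
Proof.
elim: i => [|i IH]; first by rewrite map_mx1 mx_subst_id muln0 expr0 scale1r.
rewrite exprSr -mulmxE map_mxM mx_subst_comp (singer_cycle_Y iota om5) mx_substZ IH scalerA.
by rewrite -exprD mulnS.
Qed.

Lemma frobenius_pow_Y j v :
  mx_subst (map_mx iota (frobenius_mx ^+ j)) (Y v) = Y (iter j rotate v).
Proof.
elim: j v => [|j IH] v; first by rewrite map_mx1 mx_subst_id.
by rewrite exprSr -mulmxE map_mxM mx_subst_comp (frobenius_mx_Y iota om5) IH -iterSr.
Qed.

Lemma weight_rotate v : (31 %| weight (rotate v))%N = (31 %| weight v)%N.
Proof.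
have E : (weight (rotate v) + 31 * nth 0 v 4 = 2 * weight v)%N by rewrite /weight /=; lia.
by rewrite -(dvdn_addl _ (dvdn_mulr (nth 0 v 4)%N (dvdnn 31))) E Gauss_dvdr.
Qed.

(** The Singer cycle contributes a geometric sum of 31 powers of $\omega^{\mathrm{weight}}$: it is
    $31=1$ if 31 divides the weight and $0$ otherwise. *)
Lemma average_value f v : f \in @primitive 5 18 ->
  fK iota (average f) (Y v) = if (31 %| weight v)%N then rotation_sum f v else 0.
Proof.
move=> fP; have -> : fK iota (average f) (Y v) = \sum_(i <- seq.iota 0 31) \sum_(j <- seq.iota 0 5)
    fK iota (f \o mx_subst (singer_cycle ^+ i *m frobenius_mx ^+ j)) (Y v).
  have E p : average f p = \sum_(i <- seq.iota 0 31) \sum_(j <- seq.iota 0 5)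
      f (mx_subst (singer_cycle ^+ i *m frobenius_mx ^+ j) p).
    rewrite /average fct_sumE; apply: eq_bigr => i _; rewrite fct_sumE //.
  rewrite (_ : average f = fun p => \sum_(i <- seq.iota 0 31) \sum_(j <- seq.iota 0 5)
      f (mx_subst (singer_cycle ^+ i *m frobenius_mx ^+ j) p)); last exact/funext.
  by rewrite fK_suml; apply: eq_bigr => i _; rewrite fK_suml.
have wt j : (31 %| weight (iter j rotate v))%N = (31 %| weight v)%N.
  by elim: j => //= j IH; rewrite weight_rotate.
rewrite exchange_big /= /rotation_sum.
have -> : traject rotate v 5 = [seq iter j rotate v | j <- seq.iota 0 5] by [].
rewrite big_map; have [wv|wv] := boolP (31 %| weight v)%N.
  apply: eq_bigr => j _.
  under eq_bigr => i _.
    rewrite -(fK_subst iota fP) map_mxM mx_subst_comp frobenius_pow_Y singer_pow_Y fKZ.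
    have -> : om ^+ (weight (iter j rotate v) * i) = 1.
      by apply/eqP; rewrite (om_eq0 iota om5) dvdn_mulr // wt.
    rewrite mul1r; over.
  rewrite big_const_seq count_predT iter_addr_0.
  by rewrite (mulrSr _ 30) (mulrnA _ 2 15) mulr2n (K_char2 iota) mul0rn add0r.
apply: big1 => j _.
under eq_bigr => i _ do rewrite -(fK_subst iota fP) map_mxM mx_subst_comp frobenius_pow_Y
  singer_pow_Y fKZ exprM.
rewrite -mulr_suml -[X in \sum_(i <- X) _]/(index_iota 0 31) big_mkord.
have z1 : om ^+ weight (iter j rotate v) != 1 by rewrite (om_eq0 iota om5) wt.
have : (om ^+ weight (iter j rotate v)) ^+ 31 - 1 = 0.
  by rewrite -exprM mulnC exprM (om31 iota om5) expr1n subrr.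
rewrite subrX1 => /eqP; rewrite mulf_eq0 subr_eq0 (negbTE z1) /= => /eqP.
by move=> S0; rewrite S0 mul0r.
Qed.

(** The Frobenius of $K$ carries $y_i$ to $y_{i+1}$ on coefficients, and [f] has values in $\mathbb
    F_2$; squaring therefore permutes the summands. *)
Lemma rotation_sum_sqr f v : f \in @primitive 5 18 -> size v = 5%N ->
  rotation_sum f v ^+ 2 = rotation_sum f v.
Proof.
move=> fP v5.
have ch2 : 2%N \in [pchar K] by rewrite inE /= mulr2n (K_char2 iota) eqxx.
pose s : {rmorphism K -> K} := pFrobenius_aut ch2.
have sE x : s x = x ^+ 2 by rewrite /s /= pFrobenius_autE.
have sY w : map_mpoly s (Y w) = Y (rotate w).
  rewrite (Y_rotate iota om5) /Ymon rmorph_prod; apply: eq_bigr => i _ /=.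
  rewrite rmorphXn /=; congr (_ ^+ _); rewrite /yform raddf_sum; apply: eq_bigr => l _ /=.
  by rewrite map_mpolyZ map_mpolyX sE -exprM -mulnA expnSr.
have sf p : fK iota f (map_mpoly s p) = (fK iota f p) ^+ 2.
  rewrite /fK (big_morph _ (K_sqrD iota) (expr0n _ 2)); apply: eq_bigr => m _.
  have -> : (map_mpoly s p)@_m = p@_m ^+ 2 by rewrite mcoeff_map_mpoly; exact: sE.
  rewrite exprMn; congr (_ * _).
  by rewrite -rmorphXn F2_sqr.
rewrite /rotation_sum (big_morph _ (K_sqrD iota) (expr0n _ 2)).
under eq_bigr do rewrite -sf sY.
have rot5 : rotate (rotate (rotate (rotate (rotate v)))) = v.
  by case: v v5 => [|a [|b [|c [|d [|e [|]]]]]].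
by rewrite /= !big_cons !big_nil rot5 !addr0 [RHS]addrC -!addrA.
Qed.
End CoinvariantBound.

(** * Reduction to five parameters *)

Section AverageVanishing.
Variables (K : closedFieldType) (iota : {rmorphism F2 -> K}) (om : K).
Hypothesis om5 : om ^+ 5 = om ^+ 2 + 1.
Local Notation Y := (Ymon om).

Lemma Y_rotate5 v : Y (rotate (rotate (rotate (rotate (rotate v))))) = Y v.
Proof. by rewrite /Ymon !big_cons !big_nil. Qed.

Lemma rotation_sum_rotate f v : rotation_sum iota om f (rotate v) = rotation_sum iota om f v.
Proof.
by rewrite /rotation_sum [traject _ _ _]/= [traject _ v _]/= !big_cons !big_nil Y_rotate5 !addr0
  [RHS]addrC -!addrA.
Qed.

Lemma canonical_ind (P : seq nat -> Prop) v :
  P v -> (forall r, P r -> P (rotate r)) -> P (canonical v).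
Proof.
move=> Pv Pr; have H s : (forall r, r \in s -> P r) ->
    P (foldr (fun r m => if lexlt r m then r else m) v s).
  elim: s => //= r s IH rs; case: ifP => _; first by apply: rs; rewrite mem_head.
  by apply: IH => w ws; apply: rs; rewrite inE ws orbT.
apply: H => r /trajectP[i _ ->]; elim: i => //= i IH; exact: Pr.
Qed.

Lemma hits_okE v : hits_ok -> v \in monomials 5 18 -> (31 %| weight v)%N ->
  all (fun u => canonical u \in map canonical orbit_reps) (reduce_row (eliminate hit_rows) [:: canonical v]).
Proof. by move=> H /(allP H) /implyP; apply. Qed.

Section RowSums.
Variable psi : seq nat -> K.
Let null r := \sum_(v <- r) psi v = 0.

Lemma sum_reduce_row table r : (forall e, e \in table -> null e.2) ->
  \sum_(v <- reduce_row table r) psi v = \sum_(v <- r) psi v.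
Proof.
rewrite /reduce_row; elim: table r => //= e T IH r H; rewrite IH => [|e' e'T].
  case: ifP => // _; rewrite (sum_add2_char2 (K_char2 iota)) H ?add0r //; exact: mem_head.
by apply: H; rewrite inE e'T orbT.
Qed.

Lemma eliminate_null rows : (forall r, r \in rows -> null r) ->
  forall e, e \in eliminate rows -> null e.2.
Proof.
rewrite /eliminate; have : forall e : seq nat * seq (seq nat), e \in [::] -> null e.2 by [].
move: [::] => T; elim: rows T => //= r rows IH T HT Hr.
apply: IH => [|r' r'r]; last by apply: Hr; rewrite inE r'r orbT.
have : null (reduce_row T r) by rewrite /null sum_reduce_row //; apply: Hr; exact: mem_head.
case: (reduce_row T r) => // v s; move: (foldr _ v _) => lead r0 e; rewrite inE.
case/orP => [/eqP -> //|/mapP[e' e'T ->]]; case: ifP => _; last exact: HT.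
by rewrite /null (sum_add2_char2 (K_char2 iota)) r0 add0r; apply: HT.
Qed.
End RowSums.

(** The average kills hits and is constant on rotations, so the table expresses all its values
    through those at the five representatives. It vanishes, and $f$ is congruent to it. *)
Lemma vanishing_relation f : f \in @primitive 5 18 ->
  (forall a, a \in orbit_reps -> rotation_sum iota om f a = 0) -> is_relation f.
Proof.
move=> fP f0; have aP := average_primitive fP; pose psi v := fK iota (average f) (Y v).
have psiE v : psi v = if (31 %| weight v)%N then rotation_sum iota om f v else 0.
  by rewrite /psi (average_value iota om5).
have psi_rot v : psi (rotate v) = psi v by rewrite !psiE weight_rotate rotation_sum_rotate.
have psi_can v : psi (canonical v) = psi v.
  by apply: (canonical_ind (P := fun r => psi r = psi v)) => // r <-.
have rows0 r : r \in hit_rows -> \sum_(v <- r) psi v = 0.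
  move=> /flatten_mapP[k kin /mapP[b _ ->]].
  rewrite (sum_foldr_add2_char2 (K_char2 iota) psi (fun v => [:: canonical v])).
  under eq_bigr do rewrite big_seq1 psi_can.
  by apply: (fK_hits iota om5 aP); case: k kin.
suff a0 : average f = 0 by have := average_relation fP; rewrite a0 add0r.
apply: (@Y_spans K iota om om5 _ aP) => v v5 v18; rewrite -/(psi v).
have [wv|wv] := boolP (31 %| weight v)%N; last by rewrite psiE (negbTE wv).
have vm : v \in monomials 5 18 by have := mem_monomials v; rewrite v5 v18.
have := hits_okE hits_check vm wv; have := sum_reduce_row [:: canonical v] (eliminate_null rows0).
move: (reduce_row _ _) => R; rewrite big_seq1 psi_can => <- /allP ok.
rewrite big_seq big1 // => u /ok /mapP[a aR ua].
by rewrite -psi_can ua psi_can psiE f0 // if_same.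
Qed.
End AverageVanishing.

(** * Spike forms and their values *)

Lemma sq_mon_spike k w i u :
  u \in sq_mon k w i -> all (fun e => e \in [:: 0; 1; 3; 7; 15]%N) u -> i = 0%N.
Proof.
elim: k i u => [|k IH] i u; first by rewrite /sq_mon; case: eqP.
rewrite sq_monS => /flatten_mapP[l lin /mapP[u' u'in ->]]; rewrite all_rcons => /andP[e e'].
suff l0 : l = 0%N by move: u'in; rewrite l0 subn0 => u'in; apply: IH u'in e'.
move: lin; rewrite mem_filter => /andP[b _].
have C : all (fun e => all (fun l => bin2 (e - l).+1 (e - l) l ==> (l == 0))%N (seq.iota 0 e.+1))
  [:: 0; 1; 3; 7; 15]%N by [].
have := allP (allP C _ e) l; rewrite mem_iota leq0n add0n ltnS leq_addl => /(_ isT).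
by rewrite addnK b => /eqP.
Qed.

Definition spike c := [&& size c == 5, sumn c == 18 & all (fun e => e \in [:: 0; 1; 3; 7; 15]) c]%N.
Definition spike_form c : Pol 5 -> F2^o := @support_form 5 [:: c].

(** For $e=2^a-1$ the digits of $l$ and $e-l$ are disjoint, so $\binom{e-l}{l}$ is even for $l>0$: a
    spike occurs in no positive square. *)
Lemma spike_form_primitive c : spike c -> spike_form c \in @primitive 5 18.
Proof.
move=> /and3P[c5 c18 cs]; apply: support_form_primitive; [by rewrite /= c5 c18 | by [] |].
rewrite /primitive_ok; apply/allP => d; rewrite mem_iota => d18; apply/allP => v _.
rewrite (_ : count _ _ = 0%N) //; apply/eqP; rewrite -leqn0 leqNgt -has_count.
apply/hasPn => u uin; apply/negP; rewrite /= inE => /eqP uc; rewrite uc in uin.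
have := sq_mon_spike uin cs; move: d18; lia.
Qed.

Lemma mcoeff_mulX_exponents (R : comNzRingType) (p : mpoly.mpoly 5 R) (l : 'I_5) e c :
  ('X_l ^+ e * p)@_(exponents 5 c) = if (e <= nth 0%N c l)%N
    then p@_(exponents 5 (mkseq (fun i => nth 0 c i - (i == l) * e)%N 5)) else 0.
Proof.
rewrite mulrC mpolyXn; case: ifP => el.
  have -> : exponents 5 c =
      (U_(l) *+ e + exponents 5 (mkseq (fun i => nth 0 c i - (i == l) * e)%N 5))%MM.
    apply/mnmP => i; rewrite mnmDE mulmnE mnm1E !mnmE nth_mkseq //.
    rewrite -[(l == i)]val_eqE [val l == val i]eq_sym /=; case: eqP => [il|_]; last by lia.
    by rewrite il; lia.
  exact: mcoeffMX.
apply: memN_msupp_eq0; rewrite (perm_mem (msuppMX _ _)); apply/mapP => -[m _ /mnmP /(_ l)].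
by rewrite mnmDE mulmnE mnm1E !mnmE eqxx; move: el; lia.
Qed.

Lemma binary_power (R : comNzRingType) (z : R) a : (a < 32)%N ->
  z ^+ a = \prod_(j <- [seq j <- iota 0 5 | odd (a %/ 2 ^ j)]) z ^+ (2 ^ j).
Proof.
move=> a32; have E : all (fun a => a == sumn [seq 2 ^ j | j <- [seq j <- iota 0 5 | odd (a %/ 2 ^ j)]])%N
  (iota 0 32) by [].
have /eqP aE : a == sumn [seq 2 ^ j | j <- [seq j <- iota 0 5 | odd (a %/ 2 ^ j)]]%N.
  by apply: (allP E); rewrite mem_iota.
by rewrite [in LHS]aE sumnE big_map expr_sum.
Qed.

Lemma coefficient_cons u f fs c : coefficient u (f :: fs) c =
  flatten [seq [seq (nth 0 u l * 2 ^ f.1 + n) %% 31 |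
      n <- coefficient u fs (mkseq (fun i => nth 0 c i - (i == l) * f.2) 5)]
    | l <- [seq l <- iota 0 5 | f.2 <= nth 0 c l]]%N.
Proof. by []. Qed.

Section SpikeValues.
Variables (K : closedFieldType) (iota : {rmorphism F2 -> K}) (om : K).
Hypothesis om5 : om ^+ 5 = om ^+ 2 + 1.
Local Notation PK := (mpoly.mpoly 5 K).
Local Notation Y := (Ymon om).

Lemma fK_spike c q : spike c -> fK iota (spike_form c) q = q@_(exponents 5 c).
Proof.
move=> /spike_form_primitive cP.
rewrite {1}[q]mpolyE [in RHS](mpolyE q) fK_sum (big_morph _ (mcoeffD _) (mcoeff0 _ _)).
apply: eq_bigr => m _; rewrite fKZ (fK_monomial iota cP) mcoeffZ; congr (_ * _).
by rewrite /spike_form /support_form big_seq1 !mcoeffX rmorph_nat.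
Qed.

Variable u : seq nat.
Hypothesis u_perm : perm_eq u (seq.iota 0 5).

(** With arguments $s+j$ and $2^j$ this is the $2^j$-th power of the image of $y_s$ under the
    permutation. *)
Definition permuted_form s e : PK := \sum_(l < 5) om ^+ (nth 0 u l * 2 ^ s)%N *: 'X_l ^+ e.

Lemma permuted_form_sqr s e : permuted_form s e ^+ 2 = permuted_form s.+1 (e * 2).
Proof.
rewrite /permuted_form (big_morph (fun p : PK => p ^+ 2) (PK_sqrD iota) (expr0n _ 2)).
by apply: eq_bigr => l _; rewrite exprZn -!exprM -mulnA expnSr.
Qed.

Lemma permuted_form_pow s j : permuted_form s 1 ^+ (2 ^ j) = permuted_form (s + j) (2 ^ j).
Proof.
elim: j => [|j IH]; first by rewrite addn0.
by rewrite expnSr exprM IH permuted_form_sqr addnS.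
Qed.

Lemma permuted_form_mod s e : permuted_form (s %% 5) e = permuted_form s e.
Proof.
have E : (2 ^ s = 2 ^ (s %% 5) %[mod 31])%N.
  rewrite {1}(divn_eq s 5) expnD [(s %/ 5 * 5)%N]mulnC expnM -modnMml -modnXm.
  by rewrite (_ : 2 ^ 5 %% 31 = 1)%N // exp1n mul1n.
apply: eq_bigr => l _; congr (_ *: _); rewrite -(om_mod iota om5) -[RHS](om_mod iota om5).
by rewrite -modnMmr -[in RHS]modnMmr E.
Qed.

Lemma permuted_yform i :
  mx_subst (map_mx iota (list_perm_mx u)) (yform om i) = permuted_form i 1.
Proof.
rewrite subst_yform; apply: eq_bigr => l _; rewrite expr1; congr (_ *: _).
have u5 : size u = 5%N by rewrite (perm_size u_perm) size_iota.
have ul : (nth 0%N u l < 5)%N.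
  by have := mem_nth 0%N (_ : (l < size u)%N); rewrite u5 (perm_mem u_perm) mem_iota => /(_ (ltn_ord l)).
rewrite (bigD1 (Ordinal ul)) //= big1 => [|j jl]; rewrite mxE.
  by rewrite eqxx rmorph1 mul1r addr0.
by move: jl; rewrite -val_eqE /= eq_sym => /negbTE ->; rewrite rmorph0 mul0r.
Qed.

Lemma permuted_Y v : all (fun a => a < 32)%N v ->
  mx_subst (map_mx iota (list_perm_mx u)) (Y v) = \prod_(f <- binary_factors v) permuted_form f.1 f.2.
Proof.
move=> v32; rewrite /Ymon (big_morph _ (mx_substM _) (mx_subst1 _)) big_flatten big_map.
apply: eq_bigr => i _; rewrite mx_substXn permuted_yform.
have vi : (nth 0%N v i < 32)%N.
  by have [iv|iv] := ltnP i (size v); [apply: (allP v32); apply: mem_nth | rewrite nth_default].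
rewrite binary_power // big_map; apply: eq_bigr => j _.
by rewrite permuted_form_pow permuted_form_mod.
Qed.

Lemma coefficientE fs c : size c = 5%N ->
  (\prod_(f <- fs) permuted_form f.1 f.2)@_(exponents 5 c) = \sum_(n <- coefficient u fs c) om ^+ n.
Proof.
elim: fs c => [|f fs IH] c c5.
  rewrite big_nil mcoeff1 [coefficient _ _ _]/=.
  have -> : (exponents 5 c == 0%MM) = all (pred1 0%N) c.
    apply/eqP/(all_nthP 0%N) => [/mnmP E i|E]; rewrite ?c5.
      by move=> i5; have := E (Ordinal i5); rewrite mnmE mnm0E => /eqP.
    by apply/mnmP => i; rewrite mnmE mnm0E; apply/eqP/E; rewrite c5.
  by case: ifP => _; rewrite ?big_seq1 ?big_nil.
rewrite big_cons [permuted_form _ _]/permuted_form mulr_suml (big_morph _ (mcoeffD _) (mcoeff0 _ _)).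
rewrite coefficient_cons -[seq.iota 0 5]/(index_iota 0 5) big_flatten big_map big_filter big_mkcond big_mkord.
apply: eq_bigr => l _; rewrite -scalerAl mcoeffZ mcoeff_mulX_exponents.
case: ifP => _; last by rewrite mulr0.
rewrite IH ?size_mkseq // mulr_sumr big_map; apply: eq_bigr => n _.
by rewrite (om_mod iota om5) exprD.
Qed.

Lemma spike_valueE c a : spike c -> all (all (fun x => x < 32)%N) (traject rotate a 5) ->
  rotation_sum iota om (spike_form c \o mx_subst (list_perm_mx u)) a =
  \sum_(n <- spike_value u c a) om ^+ n.
Proof.
move=> cs a32; have cP := spike_form_primitive cs; have /andP[/eqP c5 _] := cs.
rewrite (sum_foldr_add2_char2 (K_char2 iota) (fun n => om ^+ n)
  (fun v => foldr (fun n => add2 (omega_power n)) [::] (coefficient u (binary_factors v) c))).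
apply: eq_big_seq => v /(allP a32) v32.
rewrite (sum_foldr_add2_char2 (K_char2 iota) (fun n => om ^+ n) omega_power).
rewrite -(fK_subst iota cP) fK_spike // permuted_Y // coefficientE //.
by apply: eq_bigr => n _; apply: omega_powerE.
Qed.

Lemma spike_values c : spike c ->
  [seq rotation_sum iota om (spike_form c \o mx_subst (list_perm_mx u)) a | a <- orbit_reps] =
  [seq \sum_(n <- r) om ^+ n | r <- [seq spike_value u c a | a <- orbit_reps]].
Proof.
move=> cs; rewrite -map_comp; apply/eq_in_map => a aR; apply: spike_valueE => //.
have H : all (fun a => all (all (fun x => x < 32)%N) (traject rotate a 5)) orbit_reps by [].
exact: (allP H).
Qed.
End SpikeValues.

(** * Four relations among the five parameters *)

Section OneDimensional.
Variables (K : closedFieldType) (iota : {rmorphism F2 -> K}) (om : K).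
Hypothesis om5 : om ^+ 5 = om ^+ 2 + 1.
Local Notation kappa f := [seq rotation_sum iota om f a | a <- orbit_reps].
Local Notation k i f := (nth 0 (kappa f) i).

Lemma kappaE f i : (i < 5)%N -> k i f = rotation_sum iota om f (nth [::] orbit_reps i).
Proof. by move=> i5; rewrite (nth_map [::]). Qed.

Lemma kappaD i f h : (i < 5)%N -> k i (f + h) = k i f + k i h.
Proof. by move=> i5; rewrite !kappaE // rotation_sumD. Qed.

Lemma kappa_bit i f : (i < 5)%N -> f \in @primitive 5 18 -> k i f = 0 \/ k i f = 1.
Proof.
move=> i5 fP; rewrite kappaE //; set x := rotation_sum _ _ _ _.
have : x ^+ 2 = x by apply: rotation_sum_sqr => //; case: i i5 {x} => [|[|[|[|[|]]]]].
move/eqP; rewrite -subr_eq0 -{2}[x]mulr1 expr2 -mulrBr mulf_eq0 subr_eq0.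
by case/orP => /eqP ->; [left | right].
Qed.

Lemma map_add_zip T (F G : T -> K) r :
  [seq F a + G a | a <- r] = [seq p.1 + p.2 | p <- zip (map F r) (map G r)].
Proof. by elim: r => //= a r ->. Qed.

Lemma is_relation_pair f h z : is_relation (f + z) -> is_relation (h + z) -> is_relation (f + h).
Proof. by move=> /is_relationD H /H; rewrite addrACA addF2 addr0. Qed.

(** Two permutations of one spike form are congruent to it, hence their sum is a relation whose
    parameters are computed. *)
Lemma spike_difference c u u' L L' : spike c ->
  [seq spike_value u c a | a <- orbit_reps] = L -> [seq spike_value u' c a | a <- orbit_reps] = L' ->
  perm_eq u (seq.iota 0 5) -> perm_eq u' (seq.iota 0 5) ->
  exists h, [/\ is_relation h, h \in @primitive 5 18 & kappa h =
    [seq p.1 + p.2 | p <- zip [seq \sum_(n <- r) om ^+ n | r <- L] [seq \sum_(n <- r) om ^+ n | r <- L']]].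
Proof.
move=> cs <- <- pu pu'; have cP := spike_form_primitive cs.
exists ((spike_form c \o mx_subst (list_perm_mx u)) + (spike_form c \o mx_subst (list_perm_mx u'))); split.
- exact: is_relation_pair (is_relation_GL cP (list_perm_mx_unit pu)) (is_relation_GL cP (list_perm_mx_unit pu')).
- exact: rpredD (primitive_subst _ cP) (primitive_subst _ cP).
exact: etrans (eq_map (fun a => rotation_sumD iota om _ _ a) orbit_reps) (etrans (map_add_zip _ _ _)
  (congr2 (fun X X' => [seq p.1 + p.2 | p <- zip X X'])
    (spike_values iota om5 pu cs) (spike_values iota om5 pu' cs))).
Qed.

Lemma reduce_by h f : is_relation h -> is_relation (f + h) -> is_relation f.
Proof. by move=> hR /is_relationD/(_ hR); rewrite -addrA addF2 addr0. Qed.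

Lemma small_relations : exists r1 r2 r3 r4,
  [/\ [/\ is_relation r1, is_relation r2, is_relation r3 & is_relation r4],
      [/\ r1 \in @primitive 5 18, r2 \in @primitive 5 18, r3 \in @primitive 5 18 & r4 \in @primitive 5 18] &
      [/\ kappa r1 = [:: 1; 0; 1; 1; 1], kappa r2 = [:: 0; 1; 1; 0; 0],
          kappa r3 = [:: 0; 0; 0; 0; 1] & kappa r4 = [:: 0; 0; 0; 1; 0]]].
Proof.
have [[A B C] [Z D E]] := spike_check; have dd : (1 + 1 : K) = 0 by apply: K_char2 iota _.
have s15 : spike spike15 by [].
have s7 : spike spike7 by [].
have [r1 [R1 P1 E1]] := spike_difference s15 B C isT isT.
have [r2 [R2 P2 E2]] := spike_difference s15 A C isT isT.
have [r3 [R3 P3 E3]] := spike_difference s7 D Z isT isT.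
have [r4 [R4 P4 E4]] := spike_difference s7 E Z isT isT.
exists r1, r2, r3, r4; split; [by split | by split | split].
- by apply: etrans E1 _; rewrite /= !(big_seq1, big_nil, expr0, addr0, add0r, dd).
- by apply: etrans E2 _; rewrite /= !(big_seq1, big_nil, expr0, addr0, add0r, dd).
- by apply: etrans E3 _; rewrite /= !(big_seq1, big_nil, expr0, addr0, add0r, dd).
by apply: etrans E4 _; rewrite /= !(big_seq1, big_nil, expr0, addr0, add0r, dd).
Qed.

(** The linear form on the five parameters that vanishes on [r1] to [r4] of [small_relations]. *)
Definition kappa_trace f : K := k 0%N f + k 1%N f + k 2 f.

(** Parameters are cleared one after another: [r1] removes the first, [r2] the second and third,
    [r4] the fourth and [r3] the fifth. *)
Lemma kappa_trace_relation f : f \in @primitive 5 18 -> kappa_trace f = 0 -> is_relation f.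
Proof.
have [r1 [r2 [r3 [r4 [[R1 R2 R3 R4] [P1 P2 P3 P4] [E1 E2 E3 E4]]]]]] := small_relations.
have dd : (1 + 1 : K) = 0 by apply: K_char2 iota _.
have S0 f' : f' \in @primitive 5 18 -> (forall i, (i < 5)%N -> k i f' = 0) -> is_relation f'.
  move=> f'P f'0; apply: (@vanishing_relation K iota om om5 f' f'P) => a aR.
  have aS : (index a orbit_reps < 5)%N by rewrite (index_mem a orbit_reps).
  rewrite -[a](nth_index [::] aR) -(kappaE f' aS); exact: f'0 aS.
have S4 f' : f' \in @primitive 5 18 -> (forall i, (i < 4)%N -> k i f' = 0) -> is_relation f'.
  move=> f'P f'0; have [k4|k4] := @kappa_bit 4 f' isT f'P.
    by apply: S0 => // i; rewrite ltnS leq_eqVlt => /orP[/eqP ->|/f'0].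
  apply: (reduce_by R3); apply: S0 => [|i i5]; first exact: rpredD.
  rewrite kappaD // E3; case: i i5 => [|[|[|[|[|]]]]] // _; rewrite ?k4 ?f'0 //= ?addr0 ?dd //.
have S3 f' : f' \in @primitive 5 18 -> (forall i, (i < 3)%N -> k i f' = 0) -> is_relation f'.
  move=> f'P f'0; have [k3|k3] := @kappa_bit 3 f' isT f'P.
    by apply: S4 => // i; rewrite ltnS leq_eqVlt => /orP[/eqP ->|/f'0].
  apply: (reduce_by R4); apply: S4 => [|i i5]; first exact: rpredD.
  rewrite kappaD ?(ltnW i5) //; last exact: ltnW.
  by rewrite E4; case: i i5 => [|[|[|[|]]]] // _; rewrite ?k3 ?f'0 //= ?addr0 ?dd.
have S2 f' : f' \in @primitive 5 18 -> k 0%N f' = 0 -> kappa_trace f' = 0 -> is_relation f'.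
  move=> f'P k0; rewrite /kappa_trace k0 add0r => k12.
  (* With the first parameter zero, a zero trace makes the second and third equal, so [r2] clears
     both. *)
  have [k1|k1] := @kappa_bit 1 f' isT f'P.
    by rewrite k1 add0r in k12; apply: S3 => // i; case: i => [|[|[|]]].
  have k2 : k 2 f' = 1.
    by have [k2|//] := @kappa_bit 2 f' isT f'P; move: k12 => /eqP; rewrite k1 k2 addr0 oner_eq0.
  apply: (reduce_by R2); apply: S3 => [|i i5]; first exact: rpredD.
  rewrite kappaD; last exact: leq_trans i5 _.
  by rewrite E2; case: i i5 => [|[|[|]]] // _; rewrite ?k0 ?k1 ?k2 //= ?addr0 ?dd.
move=> fP f0; have [k0|k0] := @kappa_bit 0%N f isT fP; first exact: S2.
apply: (reduce_by R1); apply: S2; [exact: rpredD | by rewrite kappaD // k0 E1 /= dd |].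
rewrite /kappa_trace !kappaD // E1 /= -[RHS]f0 /kappa_trace addr0.
have R (a b c : K) : a + 1 + b + (c + 1) = a + b + c + (1 + 1) by ring.
by rewrite R dd addr0.
Qed.

Lemma relation_dichotomy base : base \in @primitive 5 18 -> ~ is_relation base ->
  forall f, f \in @primitive 5 18 -> is_relation f \/ is_relation (f + base).
Proof.
move=> bP bN f fP; have dd : (1 + 1 : K) = 0 by apply: K_char2 iota _.
have bit h : h \in @primitive 5 18 -> kappa_trace h = 0 \/ kappa_trace h = 1.
  move=> hP; rewrite /kappa_trace.
  by case: (@kappa_bit 0%N h isT hP) => ->; case: (@kappa_bit 1 h isT hP) => ->;
    case: (@kappa_bit 2 h isT hP) => ->; rewrite ?add0r ?addr0 ?dd ?add0r; auto.
have [f0|f1] := bit f fP; first by left; apply: kappa_trace_relation.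
have [b0|b1] := bit base bP; first by case: bN; apply: kappa_trace_relation.
right; apply: kappa_trace_relation; first exact: rpredD.
move: f1 b1; rewrite /kappa_trace !kappaD // => f1 b1.
move: (k 0%N f) (k 1%N f) (k 2 f) (k 0%N base) (k 1%N base) (k 2 base) f1 b1 => a b c a' b' c' f1 b1.
have E : a + a' + (b + b') + (c + c') = (a + b + c) + (a' + b' + c') by ring.
by rewrite E f1 b1.
Qed.
End OneDimensional.

(** * The transfer and its properties *)

Lemma mem_span (R : pzRingType) (V : lmodType R) (S : V -> Prop) x : S x -> x \in span S.
Proof.
by move=> Sx; apply/asboolP; exists [:: (1, x)]; [move=> y; rewrite inE => /eqP -> | rewrite big_seq1 scale1r].
Qed.

Lemma span_additive (V : lmodType F2) (S : V -> Prop) (P : V -> Prop) :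
  P 0 -> (forall x y, P x -> P y -> P (x + y)) -> (forall x, S x -> P x) -> forall x, x \in span S -> P x.
Proof.
move=> P0 PD PS x /asboolP[s Ss ->]; rewrite big_seq; apply: big_ind => // y ys.
by have [->|->] := F2_case y.1; rewrite ?scale0r ?scale1r //; apply/PS/Ss.
Qed.

Lemma span_quot_linear (R : pzRingType) (V : lmodType R) (S : V -> Prop) k (x y : V) :
  \pi_(span_quot S) (k *: x + y) = k *: \pi_(span_quot S) x + \pi_(span_quot S) y.
Proof. by rewrite span_quotD; congr (_ + _); exact: span_quotZ. Qed.

Lemma class_form0 : class_form 0 = 0.
Proof.
have := class_formD 0 0; rewrite addr0 => E.
by apply: (addrI (class_form 0)); rewrite addr0 -E.
Qed.

Lemma coboundary_span (c : cocycles 5 (5 + 18)) :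
  c \in span (@coboundary 5 (5 + 18)) <-> class_form (val c) = 0.
Proof.
split=> [|c0]; last by apply: mem_span; apply/coboundaryP.
apply: (span_additive (P := fun c : cocycles 5 (5 + 18) => class_form (val c) = 0)) => [|x y x0 y0|x /coboundaryP //].
  exact: class_form0.
by rewrite -[val (x + y)]/(val x + val y) class_formD x0 y0 addr0.
Qed.

Lemma Ext_eq (c c' : cocycles 5 (5 + 18)) :
  \pi_(Ext 5 (5 + 18)) c = \pi_(Ext 5 (5 + 18)) c' <-> class_form (val c) = class_form (val c').
Proof.
have E : class_form (val (c - c')) = class_form (val c) + class_form (val c').
  by rewrite oppF2 -class_formD.
have H : c - c' \in span (@coboundary 5 (5 + 18)) <-> class_form (val c) = class_form (val c').
  rewrite coboundary_span E; split=> [|->]; last exact: addF2.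
  by rewrite -{1}[class_form (val c')]oppF2 => /subr0_eq.
exact: iff_trans (span_quotP _ _ _) H.
Qed.

Lemma relation_transfer_poly (r : primitives 5 18) :
  r \in span (@GL_relation 5 18) -> val r (transfer_poly 5 7) = 0.
Proof.
apply: (span_additive (P := fun r : primitives 5 18 => val r (transfer_poly 5 7) = 0)) => [||r' /transfer_relation/coboundaryP].
- by [].
- by move=> x y x0 y0; rewrite -[LHS]/(val x (transfer_poly 5 7) + val y (transfer_poly 5 7)) x0 y0 addr0.
by rewrite class_form_transfer.
Qed.

(** [base_form] has value $1$ at $u$ and relations have value $0$. If $h+f_0$ were a relation, then
    $h(u)$ would be $1$; so [h] itself is one. *)
Lemma relation_of_transfer_poly (h : primitives 5 18) :
  val h (transfer_poly 5 7) = 0 -> h \in span (@GL_relation 5 18).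
Proof.
move=> h0; have [K [iota [om om5]]] := closure_F2.
have bN : ~ is_relation base_form.
  case=> r /relation_transfer_poly r0 rb; move: r0; rewrite rb base_form_transfer => /eqP.
  by rewrite oner_eq0.
have [[r rR rh]|[r /relation_transfer_poly r0 rh]] :=
    relation_dichotomy iota om5 base_form_primitive bN (valP h).
  by rewrite (_ : h = r) //; apply/val_inj.
move: r0; rewrite rh -[LHS]/(val h (transfer_poly 5 7) + base_form (transfer_poly 5 7)) h0 base_form_transfer.
by rewrite add0r => /eqP; rewrite oner_eq0.
Qed.

Definition transfer (x : coinvariants 5 18) : Ext 5 (5 + 18) :=
  \pi_(Ext 5 (5 + 18)) (transfer_class (repr x)).

Lemma transferE f : transfer (\pi_(coinvariants 5 18) f) = \pi_(Ext 5 (5 + 18)) (transfer_class f).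
Proof.
apply/Ext_eq; rewrite !class_form_transfer; set r := repr _.
have : r - f \in span (@GL_relation 5 18) by apply/span_quotP; rewrite reprK.
move/relation_transfer_poly.
rewrite -[LHS]/(val r (transfer_poly 5 7) - val f (transfer_poly 5 7)); exact: subr0_eq.
Qed.

Lemma transfer_is_linear : linear transfer.
Proof.
move=> k x y; elim/quotW: x => f; elim/quotW: y => h.
have E : \pi_(coinvariants 5 18) (k *: f + h) = k *: \pi_(coinvariants 5 18) f + \pi_(coinvariants 5 18) h.
  exact: span_quot_linear.
rewrite -E !transferE transfer_class_linear; exact: span_quot_linear.
Qed.
HB.instance Definition _ :=
  GRing.isLinear.Build F2 (coinvariants 5 18) (Ext 5 (5 + 18)) _ transfer transfer_is_linear.

Lemma extend_tensor_relation s (b : bar s -> F2^o) z : multilinear b ->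
  z \in span (@tensor_relation s) -> extend b z = 0.
Proof.
move=> bml; have bl : linear (extend b) := linear_extension_is_linear b.
have bU a : extend b << a >> = b a := linear_extensionU b a.
apply: (span_additive (P := fun z => extend b z = 0)) => [|x y x0 y0|_ [a [i [k [x [y ->]]]]]].
- exact: lin0 bl.
- by rewrite (linD bl) x0 y0 addr0.
by rewrite oppF2 !(linD bl) (linZ bl) !bU bml addF2.
Qed.

(** The pairing moves to the boundary of the cycle, a sum of tensor relations, on which a
    multilinear form vanishes. *)
Lemma extend_coboundary_map s (b : bar s -> F2^o) (z : chain s.+1) : multilinear b ->
  Tor_cycle z -> extend (coboundary_map b) z = 0.
Proof.
move=> bml zc; pose g := extend b; have gl : linear g := linear_extension_is_linear b.
rewrite -[RHS](extend_tensor_relation bml zc) -/g [in RHS]/extend (lin_sum gl).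
by apply: eq_bigr => a _; rewrite (linZ gl).
Qed.

Lemma extend_transfer_cochain f (z : chain 5) : f \in @primitive 5 18 ->
  extend (transfer_cochain f) z = f (cap_e z).
Proof.
move=> /primitive_linear fl; rewrite /cap_e [in RHS]/extend (lin_sum fl).
by apply: eq_bigr => a _; rewrite (linZ fl) e_cocycleE.
Qed.

(** Any representative [c] differs from the transfer cocycle by a coboundary, which pairs to zero
    with cycles. *)
Lemma transfer_is_singer : is_singer_transfer transfer.
Proof.
move=> f c; rewrite transferE => /Ext_eq E z zc.
have [b [bml bd] bE] : coboundary (c + transfer_class f).
  apply/coboundaryP; rewrite -[val (c + _)]/(val c + val (transfer_class f)) class_formD E.
  exact: addF2.
have cE : val c = 1 *: coboundary_map b + transfer_cochain (val f).
  rewrite scale1r -bE -[val (c + _)]/(val c + transfer_cochain (val f)).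
  by rewrite -addrA addF2 addr0.
rewrite cE extend_lincomb (extend_coboundary_map bml zc) scaler0 add0r.
exact: extend_transfer_cochain (valP f).
Qed.

Lemma transfer_injective : injective transfer.
Proof.
move=> x y; elim/quotW: x => f; elim/quotW: y => h.
rewrite !transferE => /Ext_eq; rewrite !class_form_transfer => E.
apply/span_quotP; apply: relation_of_transfer_poly.
by rewrite -[LHS]/(val f (transfer_poly 5 7) - val h (transfer_poly 5 7)) E subrr.
Qed.

(** A class is determined by its number, and [base_form] realizes the value $1$. *)
Lemma transfer_surjective y : exists x, transfer x = y.
Proof.
elim/quotW: y => c; have [c0|c1] := F2_case (class_form (val c)).
  exists (\pi_(coinvariants 5 18) 0); rewrite transferE; apply/Ext_eq.
  by rewrite class_form_transfer c0.
exists (\pi_(coinvariants 5 18) (@exist _ (fun f => f \in @primitive 5 18) _ base_form_primitive)).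
by rewrite transferE; apply/Ext_eq; rewrite class_form_transfer c1 [LHS]base_form_transfer.
Qed.

Theorem corollary2p9 :
  exists Tr : {linear coinvariants 5 18 -> Ext 5 (5 + 18)},
    [/\ is_singer_transfer Tr, bijective Tr & injective Tr].
Proof.
pose Tr : {linear coinvariants 5 18 -> Ext 5 (5 + 18)} := transfer.
exists Tr; split; [exact: transfer_is_singer | | exact: transfer_injective].
have inv y : {x | transfer x = y} by apply/cid/transfer_surjective.
exists (fun y => sval (inv y)) => [x|y]; last exact: svalP (inv y).
by apply: transfer_injective; exact: svalP (inv (transfer x)).
Qed.
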